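(* If $G$ is an $11$-edge-connected planar graph, then $G$ is strongly $\mathbb{Z}_5$-connected.
   Context: Graphs are finite and may have multiple edges but no loops. A $\mathbb{Z}_5$-boundary of $G$ is a function $\beta:V(G)\to\mathbb{Z}_5$ with $\sum_v\beta(v)\equiv 0\pmod 5$. A $(\mathbb{Z}_5,\beta)$-orientation is an orientation $D$ of $G$ with $d^+_D(v)-d^-_D(v)\equiv\beta(v)\pmod 5$ for every vertex $v$. $G$ is strongly $\mathbb{Z}_5$-connected if $G$ admits a $(\mathbb{Z}_5,\beta)$-orientation for every $\mathbb{Z}_5$-boundary $\beta$ of $G$. *)

(* Defs.v *)
From HB Require Import structures.
From mathcomp Require Import all_boot all_order all_algebra.
From mathcomp Require Import all_classical all_reals all_analysis.
Import Order.TTheory GRing.Theory Num.Theory numFieldNormedType.Exports.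

Set Implicit Arguments.
Unset Strict Implicit.
Unset Printing Implicit Defensive.

Local Open Scope classical_set_scope.
Local Open Scope ring_scope.

(* [edge] is a type of its own, so parallel edges are distinct elements with
   the same ends; requiring two distinct ends excludes loops. *)
Record multigraph := Multigraph {
  vertex : finType;
  edge : finType;
  ends : edge -> {set vertex};
  ends_card : forall e, #|ends e| = 2%N
}.

Definition adj_del (G : multigraph) (F : {set edge G}) : rel (vertex G) :=
  fun u v => [exists e, (e \notin F) && (ends e == [set u; v]%SET)].

Definition connected_del (G : multigraph) (F : {set edge G}) : Prop :=
  forall u v : vertex G, connect (adj_del F) u v.

(* By this convention graphs with at most one vertex are k-edge-connected for
   every k. *)
Definition edge_connected (k : nat) (G : multigraph) : Prop :=
  forall F : {set edge G}, (#|F| < k)%N -> connected_del F.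

(* The edge e is drawn as the image of [0, 1] under [arc e]; the values of
   [arc e] outside [0, 1] are irrelevant. *)
Definition is_plane_drawing (R : realType) (G : multigraph)
    (point : vertex G -> R * R) (arc : edge G -> R -> R * R) : Prop :=
  [/\ injective point,
      forall e, {within `[0, 1], continuous (arc e)} /\
        {in `[0, 1] &, injective (arc e)},
      forall e, exists u v : vertex G,
        [/\ ends e = [set u; v]%SET, arc e 0 = point u & arc e 1 = point v],
      forall e v (t : R), t \in `]0, 1[ -> arc e t <> point v
    & forall e f (s t : R), e <> f -> s \in `]0, 1[ -> t \in `]0, 1[ ->
        arc e s <> arc f t].

Definition planar (R : realType) (G : multigraph) : Prop :=
  exists point arc, @is_plane_drawing R G point arc.

Record orientation (G : multigraph) := Orientation {
  tail : edge G -> vertex G;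
  head : edge G -> vertex G;
  orientation_ends : forall e, ends e = [set tail e; head e]%SET
}.

Definition outdeg (G : multigraph) (D : orientation G) (v : vertex G) : nat :=
  #|[set e | tail D e == v]%SET|.

Definition indeg (G : multigraph) (D : orientation G) (v : vertex G) : nat :=
  #|[set e | head D e == v]%SET|.

Definition Z5_boundary (G : multigraph) (beta : vertex G -> 'Z_5) : Prop :=
  \sum_v beta v = 0.

Definition Z5_orientation (G : multigraph) (beta : vertex G -> 'Z_5)
    (D : orientation G) : Prop :=
  forall v, (outdeg D v)%:R - (indeg D v)%:R = beta v.

Definition strongly_Z5_connected (G : multigraph) : Prop :=
  forall beta : vertex G -> 'Z_5, Z5_boundary beta ->
    exists D : orientation G, Z5_orientation beta D.

(* Main.v *)
(* A multigraph is recorded by two end maps [s t : E -> V], restricted to a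
   vertex set X; it is heavy when every partition of X into k parts splits at
   least 4 edges if k = 2, at least 8 if k = 3, and at least (11 k - 19) / 2 if
   k >= 4.  An 11-edge-connected graph is heavy, and by induction on the number
   of vertices every heavy planar graph is strongly Z5-connected.  In a minimal
   counterexample no proper induced subgraph with at least two vertices is
   heavy, so every coarse partition splits substantially more edges than
   required.  This slack pays for lifting a pair of edges xy, yz to an edge xz
   (a choice of orientation for xz then orients both) before contracting a
   small strongly Z5-connected subgraph: 4 parallel edges, a triangle with
   multiplicities 3, 3, 2, a 4-cycle with multiplicities 3, 3, 3, 3, or K4 with
   all multiplicities 2.  Hence all multiplicities are at most 3, edges of
   multiplicity 3 lie in no triangle, and the faces of the underlying simple
   graph satisfy constraints which, after moving charge into the triangles with
   multiplicities 2, 2, 2, contradict Euler's formula.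

   Planarity enters only through grids: discretising the arcs exhibits the
   graph as a minor of a large grid, whose faces are explicit.  Since the
   evenness of faces, the connectivity of the dual and Euler's inequality
   survive the contraction and deletion of edges, the Jordan curve theorem is
   not needed. *)

(* In a minimal counterexample with [n] vertices and [e] edges, discharging and Euler's formula give
   [2 e + 22 <= 11 n], so the final contradiction works for any constant below 22 in place of 19.
   The size of 19 pays for the induction: splitting a part along a partition that violates heaviness
   leaves the coarser partition a slack of at least 5, 8 or 9, for 2, 3 or more new parts, while one
   lifting consumes 4 of it and two liftings 8.

   Lifting does not preserve planarity in general. It is applied only when [x] and [z] are already
   adjacent, and planarity is recorded as a minor model that ignores multiplicities, so a model of
   the old graph also serves the new one. *)
From Stdlib Require Import Classical FunctionalExtensionality.
Require Import Defs.
From mathcomp Require Import all_boot all_order all_algebra.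
From mathcomp Require Import zify ring lra.
Set Implicit Arguments.
Unset Strict Implicit.
Unset Printing Implicit Defensive.
Import Order.TTheory GRing.Theory Num.Theory.

(** * Orientations and boundaries *)

Local Open Scope ring_scope.

Section Orientations.
Variables V E : finType.
Implicit Types (s t : E -> V) (X Y : {set V}) (o : E -> bool) (b : V -> 'Z_5).

Definition edge_in s t X e := (s e \in X) && (t e \in X).
Definition sg (c : bool) : 'Z_5 := if c then 1 else -1.
Definition inc s t (v : V) (e : E) : 'Z_5 := (s e == v)%:R - (t e == v)%:R.
(** With [o e] read as the edge being directed from [s e] to [t e], this is outdegree minus indegree
    modulo 5 inside [X]. *)
Definition net s t X o v := \sum_(e | edge_in s t X e) sg (o e) * inc s t v e.
Definition Z5_conn s t X := forall b, \sum_(v in X) b v = 0 ->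
  exists o, {in X, forall v, net s t X o v = b v}.

Definition joins s t x y e :=
  (s e == x) && (t e == y) || (s e == y) && (t e == x).
Definition mult s t x y := #|[set e | joins s t x y e]|.

(** The contracted set is represented by one of its own vertices and its inner edges become loops,
    so contraction stays within the types [V] and [E]. *)
Definition collapse (Y : {set V}) (y v : V) := if v \in Y then y else v.

Lemma collapse_in_imset X Y y v : Y \subset X -> y \in Y ->
  (collapse Y y v \in collapse Y y @: X) = (v \in X).
Proof.
move=> sYX yY; apply/imsetP/idP => [[u uX]|vX]; last by exists v.
rewrite /collapse; case: ifP => vY; case: ifP => uY.
- by move=> _; apply: (subsetP sYX).
- by move=> _; apply: (subsetP sYX).
- by move=> ->; apply: (subsetP sYX).
- by move=> ->.
Qed.

Lemma edge_in_collapse s t X Y y e : Y \subset X -> y \in Y ->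
  edge_in (collapse Y y \o s) (collapse Y y \o t) (collapse Y y @: X) e =
  edge_in s t X e.
Proof. by move=> sYX yY; rewrite /edge_in /= !collapse_in_imset. Qed.

Lemma edge_in_sub s t X Y e : Y \subset X -> edge_in s t Y e -> edge_in s t X e.
Proof. by move=> /subsetP sYX /andP[/sYX a /sYX c]; apply/andP. Qed.

Lemma collapse_eq_out Y y u v : v \notin Y -> y \in Y ->
  (collapse Y y u == v) = (u == v).
Proof.
move=> vY yY; rewrite /collapse; case: ifP => // uY.
have [eyv|_] := eqVneq y v; first by rewrite -eyv yY in vY.
by have [euv|//] := eqVneq u v; rewrite -euv uY in vY.
Qed.

Lemma collapse_eq_in Y y u : y \in Y -> (collapse Y y u == y) = (u \in Y).
Proof.
move=> yY; rewrite /collapse; case: ifP => uY; first by rewrite eqxx.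
by have [euy|//] := eqVneq u y; rewrite euy yY in uY.
Qed.

Lemma sum_inc s t Y e :
  \sum_(v in Y) inc s t v e = (s e \in Y)%:R - (t e \in Y)%:R.
Proof.
rewrite /inc big_split /= sumrN.
have aux u : \sum_(v in Y) ((u == v)%:R : 'Z_5) = (u \in Y)%:R.
  case: (boolP (u \in Y)) => uY.
    rewrite (bigD1 u) //= eqxx big1 ?addr0 // => v /andP[_ /negbTE nvu].
    by rewrite eq_sym nvu.
  rewrite big1 // => v vY; case: eqP => // uv.
  by rewrite uv vY in uY.
by rewrite !aux.
Qed.

(** Orient the contraction first, with the boundary of [Y] summed at [y]. The edges not inside [Y]
    then contribute [r], and what is still owed, [b - r], sums to 0 over [Y], so an orientation of
    the edges inside [Y] can supply it. *)
Lemma Z5_conn_contract s t X Y y : Y \subset X -> y \in Y -> Z5_conn s t Y ->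
  Z5_conn (collapse Y y \o s) (collapse Y y \o t) (collapse Y y @: X) -> Z5_conn s t X.
Proof.
move=> sYX yY szY szX b b0; set p := collapse Y y.
pose b' w := \sum_(v in X | p v == w) b v.
have b'0 : \sum_(w in p @: X) b' w = 0.
  transitivity (\sum_(v in X) b v) => //.
  rewrite [RHS](partition_big p (mem (p @: X))) //= => v vX; exact: imset_f.
have [o1 o1P] := szX b' b'0.
have net1 w : w \in p @: X ->
    \sum_(e | edge_in s t X e && ~~ edge_in s t Y e)
      sg (o1 e) * inc (p \o s) (p \o t) w e = b' w.
  move=> wX; rewrite -(o1P w wX) /net.
  rewrite [RHS](bigID (edge_in s t Y)) /= [X in _ = X + _]big1 ?add0r.
    by apply: eq_bigl => e; rewrite edge_in_collapse.
  move=> e /andP[_ /andP[sY tY]].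
  by rewrite /inc /p /collapse /= sY tY subrr mulr0.
pose r v := \sum_(e | edge_in s t X e && ~~ edge_in s t Y e)
  sg (o1 e) * inc s t v e.
have c0 : \sum_(v in Y) (b v - r v) = 0.
  rewrite big_split /= sumrN exchange_big /=.
  have -> : \sum_(v in Y) b v = b' y.
    by apply: eq_bigl => v; rewrite collapse_eq_in //;
      case: (boolP (v \in Y)) => [/(subsetP sYX)->|]; rewrite ?andbF.
  rewrite -net1; last by apply/imsetP; exists y;
    rewrite ?(subsetP sYX) // /p /collapse yY.
  rewrite -sumrB big1 // => e _.
  by rewrite -mulr_sumr sum_inc /inc /= !collapse_eq_in // subrr.
have [o2 o2P] := szY _ c0.
exists (fun e => if edge_in s t Y e then o2 e else o1 e) => v vX.
rewrite /net (bigID (edge_in s t Y)) /=.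
have -> : \sum_(e | edge_in s t X e && ~~ edge_in s t Y e)
    sg (if edge_in s t Y e then o2 e else o1 e) * inc s t v e = r v.
  by apply: eq_bigr => e /andP[_ /negbTE->].
rewrite (eq_bigl (edge_in s t Y)); last first.
  by move=> e; case: (boolP (edge_in s t Y e)) => [/(edge_in_sub sYX)->|];
    rewrite ?andbF.
rewrite (eq_bigr (fun e => sg (o2 e) * inc s t v e)); last by move=> e ->.
case: (boolP (v \in Y)) => vY.
  by have := o2P v vY; rewrite /net => ->; rewrite subrK.
rewrite big1 ?add0r; last first.
  move=> e /andP[sY tY]; rewrite /inc.
  have -> : (s e == v) = false by apply: contraNF vY => /eqP<-.
  have -> : (t e == v) = false by apply: contraNF vY => /eqP<-.
  by rewrite subrr mulr0.
have pv : p v = v by rewrite /p /collapse (negbTE vY).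
transitivity (b' v).
  rewrite -net1; last by rewrite -pv imset_f.
  by apply: eq_bigr => e _; rewrite /inc /= !collapse_eq_out.
rewrite /b' (big_pred1 v) // => u /=; rewrite collapse_eq_out //.
by case: eqP => [->|]; rewrite ?vX ?andbF.
Qed.

(* Applied to both [s] and [t], this turns [e1] into an edge from [x] to [z] and
   parks [e2] as a loop at [y]; loops contribute nothing to [net]. *)
Definition lift_s s (x y : V) (e1 e2 : E) e :=
  if e == e1 then x else if e == e2 then y else s e.

Lemma Z5_conn_lift s t X x y z e1 e2 : x \in X -> y \in X -> z \in X ->
  x != y -> y != z -> e1 != e2 -> joins s t x y e1 -> joins s t y z e2 ->
  Z5_conn (lift_s s x y e1 e2) (lift_s t z y e1 e2) X -> Z5_conn s t X.
Proof.
move=> xX yX zX nxy nyz n12 j1 j2 szX b b0; have [o oP] := szX b b0.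
(* [o e1] tells whether the lifted edge runs from [x] to [z]. Both original edges follow it; the
   tests on [s e1] and [s e2] account for the order in which their ends are stored. *)
pose f e := if e == e1 then (s e1 == x) == o e1
  else if e == e2 then (s e2 == y) == o e1 else o e.
exists f => v vX; rewrite -(oP v vX) /net.
have w1 : edge_in s t X e1.
  by case/orP: j1 => /andP[/eqP s1 /eqP t1]; rewrite /edge_in s1 t1 xX yX.
have w2 : edge_in s t X e2.
  by case/orP: j2 => /andP[/eqP s1 /eqP t1]; rewrite /edge_in s1 t1 zX yX.
have n21 : (e2 == e1) = false by rewrite eq_sym (negbTE n12).
rewrite (bigD1 e1) //= (bigD1 e2) /=; last by rewrite w2 n21.
rewrite [RHS](bigD1 e1) /=; last by rewrite /edge_in /lift_s eqxx xX zX.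
rewrite [X in _ = _ + X](bigD1 e2) /=; last first.
  by rewrite /edge_in /lift_s n21 eqxx yX.
rewrite !addrA; congr (_ + _); last first.
  apply: eq_big => [e|e /andP[/andP[_ ne1] ne2]].
    rewrite /edge_in /lift_s; case: eqP => /=; first by rewrite !andbF.
    by case: eqP => /=; rewrite ?andbF.
  by rewrite /f /inc /lift_s (negbTE ne1) (negbTE ne2).
rewrite /f /inc /lift_s !eqxx n21 ?eqxx subrr mulr0 addr0.
have -> : sg ((s e1 == x) == o e1) * ((s e1 == v)%:R - (t e1 == v)%:R) =
    sg (o e1) * ((x == v)%:R - (y == v)%:R).
  case/orP: j1 => /andP[/eqP-> /eqP->]; rewrite ?eqxx //.
  by rewrite (eq_sym y x) (negbTE nxy); case: (o e1); rewrite /sg /=; ring.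
have -> : sg ((s e2 == y) == o e1) * ((s e2 == v)%:R - (t e2 == v)%:R) =
    sg (o e1) * ((y == v)%:R - (z == v)%:R).
  case/orP: j2 => /andP[/eqP-> /eqP->]; rewrite ?eqxx //.
  by rewrite (eq_sym z y) (negbTE nyz); case: (o e1); rewrite /sg /=; ring.
ring.
Qed.

(* [(x, y, c)] stands for a class of [c] parallel edges; sending [k] of them from
   [x] to [y] and the others back contributes [2 k - c]. *)
Fixpoint reach (cl : seq (V * V * nat)) b : Prop :=
  if cl is (x, y, c) :: cl' then
    exists2 k, (k <= c)%N &
      reach cl' (fun v => b v - (k%:R *+ 2 - c%:R) * ((x == v)%:R - (y == v)%:R))
  else forall v, b v = 0.

Definition class_pair (q : V * V * nat) : {set V} := [set q.1.1; q.1.2].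

Lemma joinsE s t x y e : joins s t x y e = ([set s e; t e] == [set x; y]).
Proof.
apply/idP/eqP => [/orP[]/andP[/eqP-> /eqP->] //|]; first by rewrite setUC.
move=> eq; have := set21 (s e) (t e); have := set22 (s e) (t e).
rewrite eq /joins !inE => /orP[]/eqP ht /orP[]/eqP hs; rewrite hs ht ?eqxx ?orbT //.
  have := set22 x y; rewrite -eq hs ht setUid inE => /eqP->.
  by rewrite eqxx.
have := set21 x y; rewrite -eq hs ht setUid inE => /eqP->.
by rewrite eqxx.
Qed.

(** [A] takes exactly [q.2] edges from each class [q]. Since the unordered pairs are distinct, these
    choices are disjoint and the contributions of the classes add up. *)
Lemma reachP s t (cl : seq (V * V * nat)) :
  uniq (map class_pair cl) -> {in cl, forall q, q.1.1 != q.1.2} ->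
  {in cl, forall q, (q.2 <= mult s t q.1.1 q.1.2)%N} ->
  exists A : {set E},
    (forall e, e \in A -> [set s e; t e] \in map class_pair cl) /\
    forall b, reach cl b -> exists o, forall v,
      \sum_(e in A) sg (o e) * inc s t v e = b v.
Proof.
elim: cl => [|[[x y] c] cl IH] /=.
  move=> _ _ _; exists set0; split=> [e|b b0]; first by rewrite inE.
  by exists xpredT => v; rewrite b0 big_set0.
case/andP=> nxy ucl hd hm.
have [A [AP Ar]] : exists A : {set E},
    (forall e, e \in A -> [set s e; t e] \in map class_pair cl) /\
    forall b, reach cl b -> exists o, forall v,
      \sum_(e in A) sg (o e) * inc s t v e = b v.
  by apply: IH => // q qcl; [apply: hd|apply: hm]; rewrite inE qcl orbT.
have dxy : x != y by have := hd (x, y, c); rewrite inE eqxx => /(_ isT).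
have : (c <= mult s t x y)%N.
  by have := hm (x, y, c); rewrite inE eqxx => /(_ isT).
rewrite /mult => /card_geqP[cs [ucs scs csP]].
pose C := [set e in cs].
have CP e : e \in C -> joins s t x y e by rewrite inE => /csP; rewrite inE.
have CA e : e \in C -> e \notin A.
  move=> /CP; rewrite joinsE => /eqP eC; apply: contra nxy => /AP.
  by rewrite eC.
exists (C :|: A); split=> [e|b [k kc /Ar[o oP]]].
  rewrite inE => /orP[/CP|/AP]; last by rewrite inE => ->; rewrite orbT.
  by rewrite joinsE inE /class_pair /= => ->.
pose K := [set e in take k cs].
have KC : K \subset C by apply/subsetP => e; rewrite !inE => /mem_take.
have cK : #|K| = k.
  rewrite cardsE; have /card_uniqP -> := take_uniq k ucs.
  by rewrite size_take scs; case: ltngtP kc => // ->.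
have cC : #|C| = c by rewrite cardsE; have /card_uniqP -> := ucs.
exists (fun e => if e \in C then (s e == x) == (e \in K) else o e) => v.
rewrite (bigID (mem C)) /=.
rewrite (eq_bigl (mem C)); last by move=> e; rewrite in_setU /= andb_orl andbb;
  case: (boolP (e \in C)); rewrite ?andbF.
rewrite [X in _ + X](eq_bigl (mem A)); last first.
  move=> e; rewrite in_setU /=; case: (boolP (e \in C)) => [/CA/negbTE->|];
    rewrite ?andbT //=.
rewrite [X in _ + X = _](eq_bigr (fun e => sg (o e) * inc s t v e)); last first.
  by move=> e; rewrite /= => eA; case: ifP => // /CA; rewrite eA.
rewrite oP.
rewrite (eq_bigr (fun e => sg (e \in K) * ((x == v)%:R - (y == v)%:R))); last first.
  move=> e; rewrite /= => eC; rewrite eC; case/orP: (CP e eC) => /andP[/eqP es /eqP et];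
    rewrite /inc es et ?eqxx //.
  by rewrite (eq_sym y x) (negbTE dxy); case: (e \in K); rewrite /sg /=; ring.
rewrite -mulr_suml (bigID (mem K)) /=.
rewrite (eq_bigr (fun=> 1)); last by move=> e /andP[_ ->].
rewrite [X in (_ + X) * _](eq_bigr (fun=> -1)); last by move=> e /andP[_ /negbTE->].
rewrite !sumr_const.
have -> : #|[pred e in C | e \in K]| = k.
  rewrite -cK; apply: eq_card => e; rewrite !inE.
  by case: (boolP (e \in take k cs)) => [/mem_take->|]; rewrite ?andbF.
have -> : #|[pred e in C | e \notin K]| = (c - k)%N.
  rewrite -cK -cC -cardsDS //; apply: eq_card => e; rewrite !inE.
  by rewrite andbC.
rewrite mulNrn natrB //; ring.
Qed.

(** Surplus edges are all directed from [s] to [t] and their contribution [r] is subtracted from the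
    boundary beforehand; the chosen edges [A] then realise the rest. *)
Lemma Z5_conn_of_reach s t X cl :
  uniq (map class_pair cl) -> {in cl, forall q, q.1.1 != q.1.2} ->
  {in cl, forall q, (q.2 <= mult s t q.1.1 q.1.2)%N} ->
  {in cl, forall q, class_pair q \subset X} ->
  (forall b, {in [predC X], forall v, b v = 0} -> \sum_(v in X) b v = 0 ->
     reach cl b) ->
  Z5_conn s t X.
Proof.
move=> ucl hd hm hX hr b b0.
have [A [AP Ar]] := reachP ucl hd hm.
have AX e : e \in A -> edge_in s t X e.
  move=> /AP /mapP[q /hX sq eq]; rewrite /edge_in.
  by rewrite !(subsetP sq) // -eq !inE eqxx ?orbT.
pose r v := \sum_(e | edge_in s t X e && (e \notin A)) sg true * inc s t v e.
pose c v := if v \in X then b v - r v else 0.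
have [|o oP] := Ar c.
  apply: hr => [v|]; first by rewrite !inE /c => /negbTE->.
  rewrite (eq_bigr (fun v => b v - r v)); last by move=> v; rewrite /c => ->.
  rewrite sumrB b0 exchange_big /= big1 ?subrr // => e /andP[/andP[eX1 eX2] _].
  by rewrite -mulr_sumr sum_inc eX1 eX2 subrr mulr0.
exists (fun e => (e \in A) ==> o e) => v vX.
rewrite /net (bigID (mem A)) /=.
rewrite (eq_bigl (mem A)); last first.
  by move=> e /=; case: (boolP (e \in A)) => [/AX->|]; rewrite ?andbF.
rewrite (eq_bigr (fun e => sg (o e) * inc s t v e)); last first.
  by move=> e; rewrite /= => ->.
rewrite oP /c vX [X in _ + X](eq_bigr (fun e => sg true * inc s t v e)); last first.
  by move=> e /andP[_ /negbTE->].
by rewrite -/(r v) subrK.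
Qed.

End Orientations.

Lemma natr_Z5 (m n : nat) : m = n %[mod 5] -> m%:R = n%:R :> 'Z_5.
Proof. by move=> e; rewrite -(@Zp_nat_mod 5) // e Zp_nat_mod. Qed.

Lemma Z5_natr (a : 'Z_5) : exists2 k, k \in iota 0 5 & a = k%:R.
Proof. by exists (val a); [rewrite mem_iota /= ltn_ord|rewrite natr_Zp]. Qed.

(** * The contractible small graphs *)

Section SmallGraphs.
Variables V E : finType.
Variables s t : E -> V.

Lemma eq_set2 (x y u v : V) :
  ([set x; y] == [set u; v]) = (x == u) && (y == v) || (x == v) && (y == u).
Proof. by rewrite -(joinsE (fun _ : unit => x) (fun=> y) u v tt). Qed.

Lemma neqF (x y : V) : x != y -> ((x == y) = false) * ((y == x) = false).
Proof. by move=> xy; rewrite [y == x]eq_sym (negbTE xy). Qed.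

(** Sending [k] of 4 parallel edges one way contributes [2 k - 4], and 2 is invertible modulo 5, so
    [k = 0, ..., 4] reaches every residue. *)
Lemma Z5_conn_two x y : x != y -> (4 <= mult s t x y)%N -> Z5_conn s t [set x; y].
Proof.
move=> xy m.
have D := (neqF xy).
apply: (Z5_conn_of_reach (cl := [:: (x, y, 4%N)])) => //.
- by move=> q; rewrite inE => /eqP->.
- by move=> q; rewrite inE => /eqP->.
- by move=> q; rewrite inE => /eqP->; rewrite subxx.
move=> b bout; rewrite big_setU1 ?inE //= big_set1 => b0.
have [a aI ba] := Z5_natr (b x).
have /allP/(_ a aI)/hasP[k kI /eqP ek] :
  all (fun a => has (fun k => (a + 4) %% 5 == (2 * k) %% 5)%N (iota 0 5)) (iota 0 5).
  by vm_compute.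
exists k; first by move: kI; rewrite mem_iota.
have {}ek : b x = 2%:R * k%:R - 4%:R.
  by rewrite ba -natrM -(natr_Z5 ek) natrD addrK.
have ey : b y = - b x by rewrite -(add0r (- b x)) -b0; ring.
move=> v; have [->|nvx] := eqVneq v x.
  by rewrite ?eqxx ?D ek /=; ring.
have [->|nvy] := eqVneq v y.
  by rewrite ?eqxx ?D ey ek /=; ring.
by rewrite bout ?inE ?negb_or ?nvx //; ring.
Qed.

Lemma Z5_conn_three x y z : x != y -> x != z -> y != z ->
  (3 <= mult s t x y)%N -> (3 <= mult s t y z)%N -> (2 <= mult s t x z)%N ->
  Z5_conn s t [set x; y; z].
Proof.
move=> xy xz yz m1 m2 m3.
have D := (neqF xy, neqF xz, neqF yz).
apply: (Z5_conn_of_reach (cl := [:: (x, y, 3%N); (y, z, 3%N); (x, z, 2%N)])).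
- by rewrite /= !inE /class_pair /= !eq_set2 ?D ?andbF.
- by move=> q; rewrite !inE => /or3P[] /eqP->.
- by move=> q; rewrite !inE => /or3P[] /eqP->.
- by move=> q; rewrite !inE => /or3P[] /eqP->; apply/subsetP => w;
    rewrite !inE => /orP[]->; rewrite ?orbT.
move=> b bout; rewrite setUC big_setU1 ?inE ?D //=.
rewrite big_setU1 ?inE ?D //= big_set1 => b0.
have [a aI ba] := Z5_natr (b x); have [c cI bc] := Z5_natr (b y).
(* A finite search over residues. Terms are moved across the congruences to avoid subtraction of
   naturals; the condition at the last vertex follows because the boundary sums to 0. *)
have /allP/(_ a aI)/allP/(_ c cI)/hasP[k1 I1 /hasP[k2 I2 /hasP[k3 I3 /andP[/eqP e1
  /eqP e2]]]] :
  all (fun a => all (fun c => has (fun k1 => has (fun k2 => has (fun k3 =>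
    ((a + 5) %% 5 == (2 * k1 + 2 * k3) %% 5)%N &&
    ((c + 2 * k1) %% 5 == (2 * k2) %% 5)%N)
   (iota 0 3)) (iota 0 4)) (iota 0 4)) (iota 0 5)) (iota 0 5).
  by vm_compute.
exists k1; first by move: I1; rewrite mem_iota.
exists k2; first by move: I2; rewrite mem_iota.
exists k3; first by move: I3; rewrite mem_iota.
have ex : b x = 2%:R * k1%:R + 2%:R * k3%:R - 5%:R.
  by rewrite ba -!natrM -natrD -(natr_Z5 e1) natrD addrK.
have ey : b y = 2%:R * k2%:R - 2%:R * k1%:R.
  by rewrite bc -!natrM -(natr_Z5 e2) natrD addrK.
have ez : b z = - b x - b y by rewrite -(addr0 (- b x)) -b0; ring.
move=> v; have [->|nvx] := eqVneq v x.
  by rewrite ?eqxx ?D ex /=; ring.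
have [->|nvy] := eqVneq v y.
  by rewrite ?eqxx ?D ey /=; ring.
have [->|nvz] := eqVneq v z.
  by rewrite ?eqxx ?D ez ey ex /=; ring.
by rewrite bout ?inE ?negb_or ?nvx ?nvy //; ring.
Qed.

Lemma sum_set4 (b : V -> 'Z_5) x y z u : uniq [:: x; y; z; u] ->
  \sum_(v in [set x; y; z; u]) b v = b x + b y + b z + b u.
Proof.
rewrite /= !inE !negb_or => /and4P[/and3P[xy xz xu] /andP[yz yu] zu _].
have D := (neqF xy, neqF xz, neqF xu, neqF yz, neqF yu, neqF zu).
rewrite setUC big_setU1 ?inE ?D //=.
rewrite setUC big_setU1 ?inE ?D //=.
by rewrite big_setU1 ?inE ?D //= big_set1; ring.
Qed.

Lemma Z5_conn_cycle4 x y z u : uniq [:: x; y; z; u] ->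
  (3 <= mult s t x y)%N -> (3 <= mult s t y z)%N -> (3 <= mult s t z u)%N ->
  (3 <= mult s t u x)%N -> Z5_conn s t [set x; y; z; u].
Proof.
move=> U m1 m2 m3 m4; have := U.
rewrite /= !inE !negb_or => /and4P[/and3P[xy xz xu] /andP[yz yu] zu _].
have D := (neqF xy, neqF xz, neqF xu, neqF yz, neqF yu, neqF zu).
apply: (Z5_conn_of_reach (cl := [:: (x, y, 3%N); (y, z, 3%N); (z, u, 3%N);
  (u, x, 3%N)])).
- by rewrite /= !inE /class_pair /= !eq_set2 ?D ?andbF.
- by move=> q; rewrite !inE => /or4P[] /eqP-> //=; rewrite eq_sym.
- by move=> q; rewrite !inE => /or4P[] /eqP->.
- by move=> q; rewrite !inE => /or4P[] /eqP->; apply/subsetP => w;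
    rewrite !inE => /orP[]->; rewrite ?orbT.
move=> b bout; rewrite sum_set4 // => b0.
have [a aI ba] := Z5_natr (b x); have [c cI bc] := Z5_natr (b y).
have [d dI bd] := Z5_natr (b z).
have /allP/(_ a aI)/allP/(_ c cI)/allP/(_ d dI)/hasP[k1 I1 /hasP[k2 I2 /hasP[k3 I3
  /hasP[k4 I4 /and3P[/eqP e1 /eqP e2 /eqP e3]]]]] :
  all (fun a => all (fun c => all (fun d => has (fun k1 => has (fun k2 =>
    has (fun k3 => has (fun k4 =>
    [&& ((a + 2 * k4) %% 5 == (2 * k1) %% 5)%N,
    ((c + 2 * k1) %% 5 == (2 * k2) %% 5)%N &
    ((d + 2 * k2) %% 5 == (2 * k3) %% 5)%N])
   (iota 0 4)) (iota 0 4)) (iota 0 4)) (iota 0 4)) (iota 0 5)) (iota 0 5)) (iota 0 5).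
  by vm_compute.
exists k1; first by move: I1; rewrite mem_iota.
exists k2; first by move: I2; rewrite mem_iota.
exists k3; first by move: I3; rewrite mem_iota.
exists k4; first by move: I4; rewrite mem_iota.
have ex : b x = 2%:R * k1%:R - 2%:R * k4%:R.
  by rewrite ba -!natrM -(natr_Z5 e1) natrD addrK.
have ey : b y = 2%:R * k2%:R - 2%:R * k1%:R.
  by rewrite bc -!natrM -(natr_Z5 e2) natrD addrK.
have ez : b z = 2%:R * k3%:R - 2%:R * k2%:R.
  by rewrite bd -!natrM -(natr_Z5 e3) natrD addrK.
have eu : b u = - b x - b y - b z by rewrite -(addr0 (- b x)) -b0; ring.
move=> v; have [->|nvx] := eqVneq v x.
  by rewrite ?eqxx ?D ex /=; ring.
have [->|nvy] := eqVneq v y.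
  by rewrite ?eqxx ?D ey /=; ring.
have [->|nvz] := eqVneq v z.
  by rewrite ?eqxx ?D ez /=; ring.
have [->|nvu] := eqVneq v u.
  by rewrite ?eqxx ?D eu ez ey ex /=; ring.
by rewrite bout ?inE ?negb_or ?nvx ?nvy ?nvz //; ring.
Qed.

Lemma Z5_conn_k4 x y z u : uniq [:: x; y; z; u] ->
  (2 <= mult s t x y)%N -> (2 <= mult s t x z)%N -> (2 <= mult s t x u)%N ->
  (2 <= mult s t y z)%N -> (2 <= mult s t y u)%N -> (2 <= mult s t z u)%N ->
  Z5_conn s t [set x; y; z; u].
Proof.
move=> U m1 m2 m3 m4 m5 m6; have := U.
rewrite /= !inE !negb_or => /and4P[/and3P[xy xz xu] /andP[yz yu] zu _].
have D := (neqF xy, neqF xz, neqF xu, neqF yz, neqF yu, neqF zu).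
have clP q : q \in [:: (x, y, 2%N); (x, z, 2%N); (x, u, 2%N); (y, z, 2%N);
  (y, u, 2%N); (z, u, 2%N)] ->
    [/\ q.1.1 != q.1.2, (q.2 <= mult s t q.1.1 q.1.2)%N & class_pair q \subset [set
      x; y; z; u]].
  by rewrite !inE => /orP[/eqP->|/orP[/eqP->|/orP[/eqP->|/or3P[]/eqP->]]];
    split=> //; apply/subsetP => w; rewrite !inE => /orP[]->; rewrite ?orbT.
apply: (Z5_conn_of_reach (cl := [:: (x, y, 2%N); (x, z, 2%N); (x, u, 2%N);
  (y, z, 2%N); (y, u, 2%N); (z, u, 2%N)])).
- by rewrite /= !inE /class_pair /= !eq_set2 ?D ?andbF.
- by move=> q /clP[].
- by move=> q /clP[].
- by move=> q /clP[].
move=> b bout; rewrite sum_set4 // => b0.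
have [a aI ba] := Z5_natr (b x); have [c cI bc] := Z5_natr (b y).
have [d dI bd] := Z5_natr (b z).
have /allP/(_ a aI)/allP/(_ c cI)/allP/(_ d dI)/hasP[k1 I1 /hasP[k2 I2 /hasP[k4 I4
  /hasP[k3 I3 /hasP[k5 I5 /hasP[k6 I6 /and3P[/eqP e1 /eqP e2 /eqP e3]]]]]]] :
  all (fun a => all (fun c => all (fun d => has (fun k1 => has (fun k2 =>
    has (fun k4 => has (fun k3 => has (fun k5 => has (fun k6 =>
    [&& ((a + 6) %% 5 == (2 * k1 + 2 * k2 + 2 * k3) %% 5)%N,
    ((c + 2 + 2 * k1) %% 5 == (2 * k4 + 2 * k5) %% 5)%N &
    ((d + 2 * k2 + 2 * k4) %% 5 == (2 * k6 + 2) %% 5)%N])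
   (iota 0 3)) (iota 0 3)) (iota 0 3)) (iota 0 3)) (iota 0 3)) (iota 0 3))
   (iota 0 5)) (iota 0 5)) (iota 0 5).
  by vm_compute.
exists k1; first by move: I1; rewrite mem_iota.
exists k2; first by move: I2; rewrite mem_iota.
exists k3; first by move: I3; rewrite mem_iota.
exists k4; first by move: I4; rewrite mem_iota.
exists k5; first by move: I5; rewrite mem_iota.
exists k6; first by move: I6; rewrite mem_iota.
have ex : b x = 2%:R * k1%:R + 2%:R * k2%:R + 2%:R * k3%:R - 6%:R.
  by rewrite ba -!natrM -!natrD -(natr_Z5 e1) natrD addrK.
have ey : b y = 2%:R * k4%:R + 2%:R * k5%:R - 2%:R * k1%:R - 2%:R.
  by rewrite bc -!natrM -!natrD -(natr_Z5 e2) !natrD; ring.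
have ez : b z = 2%:R * k6%:R + 2%:R - 2%:R * k2%:R - 2%:R * k4%:R.
  by rewrite bd -!natrM -!natrD -(natr_Z5 e3) !natrD; ring.
have eu : b u = - b x - b y - b z by rewrite -(addr0 (- b x)) -b0; ring.
move=> v; have [->|nvx] := eqVneq v x.
  by rewrite ?eqxx ?D ex /=; ring.
have [->|nvy] := eqVneq v y.
  by rewrite ?eqxx ?D ey /=; ring.
have [->|nvz] := eqVneq v z.
  by rewrite ?eqxx ?D ez /=; ring.
have [->|nvu] := eqVneq v u.
  by rewrite ?eqxx ?D eu ez ey ex /=; ring.
by rewrite bout ?inE ?negb_or ?nvx ?nvy ?nvz //; ring.
Qed.
End SmallGraphs.

(** * Partition weights and minors *)

Local Open Scope nat_scope.

Section Weights.
Variables V E : finType.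
Implicit Types (s t : E -> V) (X Y : {set V}).

Definition cross s t X (T : finType) (pi : V -> T) :=
  #|[set e | edge_in s t X e && (pi (s e) != pi (t e))]|.

(* The bounds for 2 and 3 parts exceed (11 k - 19) / 2 so as to exclude the
   graphs with 2 or 3 vertices that are not strongly Z5-connected. *)
Definition heavy k c :=
  [&& (k == 2) ==> (4 <= c), (k == 3) ==> (8 <= c)
    & (4 <= k) ==> (11 * k <= 2 * c + 19)].

Definition Heavy s t X := forall (T : finType) (pi : V -> T),
  heavy #|pi @: X| (cross s t X pi).

(** Connectivity in cut form, which heaviness yields at once by taking membership in [K] as a
    partition into 2 parts. *)
Definition gconn s t Y := forall K : {set V},
  Y :&: K != set0 -> Y :\: K != set0 ->
  exists2 e, edge_in s t Y e & (s e \in K) != (t e \in K).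

Lemma heavyW k c : 2 <= k -> heavy k c -> 11 * k <= 2 * c + 19.
Proof. by rewrite /heavy => k2 /and3P[]; lia. Qed.

Lemma cross_collapse s t X Y y (T : finType) (pi : V -> T) :
  Y \subset X -> y \in Y ->
  cross (collapse Y y \o s) (collapse Y y \o t) (collapse Y y @: X) pi =
  cross s t X (pi \o collapse Y y).
Proof.
by move=> sYX yY; apply: eq_card => e; rewrite !inE edge_in_collapse.
Qed.

Lemma card_collapse X Y y : Y \subset X -> y \in Y ->
  #|collapse Y y @: X| + #|Y| = #|X|.+1.
Proof.
move=> sYX yY.
have -> : collapse Y y @: X = y |: (X :\: Y).
  apply/setP => v; rewrite !inE; apply/imsetP/orP.
    move=> [u uX ->]; rewrite /collapse; case: ifP => uY; first by left.
    by right; rewrite uY.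
  case=> [/eqP->|/andP[vY vX]]; first by exists y; rewrite /collapse ?yY ?(subsetP sYX).
  by exists v; rewrite // /collapse (negbTE vY).
by rewrite cardsU1 !inE yY /= add1n addSn cardsDS // subnK // subset_leq_card.
Qed.

Lemma Heavy_collapse s t X Y y : Y \subset X -> y \in Y ->
  (forall (T : finType) (pi : V -> T), {in Y, forall u, pi u = pi y} ->
     heavy #|pi @: X| (cross s t X pi)) ->
  Heavy (collapse Y y \o s) (collapse Y y \o t) (collapse Y y @: X).
Proof.
move=> sYX yY H T pi; rewrite cross_collapse // -imset_comp; apply: H => u uY.
by rewrite /= /collapse uY yY.
Qed.

Lemma Heavy_gconn s t Y : Heavy s t Y -> gconn s t Y.
Proof.
move=> H K /set0Pn[a /setIP[aY aK]] /set0Pn[b /setDP[bY bK]].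
have := H _ (fun v => v \in K).
have -> : (fun v => v \in K) @: Y = [set: bool].
  apply/setP => -[]; rewrite !inE; apply/imsetP; first by exists a.
  by exists b => //; apply/esym/negbTE.
rewrite cardsT card_bool /heavy /= => /andP[c4 _].
have /card_gt0P[e] : 0 < cross s t Y (fun v => v \in K) by apply: leq_trans c4.
by rewrite inE => /andP[we ne]; exists e.
Qed.

Section Refine.
Variables (s t : E -> V) (X : {set V}) (T T' : finType) (pi : V -> T).
Variables (c : T) (q : V -> T').
Let Y := [set v in X | pi v == c].
(** The tag [None] keeps every part other than [c] whole, whatever [q] does there. *)
Definition refine v := (pi v, if pi v == c then Some (q v) else None).

Lemma card_refine : c \in pi @: X ->
  #|refine @: X|.+1 = #|pi @: X| + #|q @: Y|.
Proof.
move=> cX; pose A := (fun u => (u, None : option T')) @: (pi @: X :\ c).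
pose B := (fun r => (c, Some r)) @: (q @: Y).
have -> : refine @: X = A :|: B.
  apply/setP => -[u r]; rewrite inE; apply/imsetP/orP.
    move=> [v vX ->]; rewrite /refine; case: eqP => [pv|/eqP pv].
      right; rewrite pv; apply/imsetP; exists (q v) => //.
      by apply: imset_f; rewrite inE vX pv eqxx.
    by left; apply/imsetP; exists (pi v) => //; rewrite !inE pv imset_f.
  case=> /imsetP[].
    move=> u' /setD1P[nu /imsetP[v vX eu]] [-> ->]; exists v => //.
    by rewrite /refine -eu (negbTE nu).
  move=> r' /imsetP[v]; rewrite inE => /andP[vX /eqP pv] -> [-> ->].
  by exists v => //; rewrite /refine pv eqxx.
have dAB : A :&: B = set0.
  apply/setP => x; rewrite !inE; apply/negbTE/negP => /andP[].
  by move=> /imsetP[u _ ->] /imsetP[r _ []].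
have i1 : injective (fun u : T => (u, None : option T')) by move=> ? ? [->].
have i2 : injective (fun r : T' => (c, Some r)) by move=> ? ? [->].
rewrite cardsU dAB cards0 subn0 (card_imset _ i1) (card_imset _ i2).
by rewrite (cardsD1 c (pi @: X)) cX; lia.
Qed.

Lemma cross_refine : cross s t X refine = cross s t X pi + cross s t Y q.
Proof.
rewrite /cross -(cardsID [set e | pi (s e) != pi (t e)]); congr (_ + _).
  apply: eq_card => e; rewrite !inE /refine xpair_eqE.
  by case: (pi (s e) == pi (t e)); rewrite /= ?andbF ?andbT.
apply: eq_card => e; rewrite !inE /refine xpair_eqE /edge_in !inE negbK.
have [eqp|] := eqVneq; last first.
  move=> npi; rewrite /=; symmetry; apply/negbTE; apply: contra npi.
  by case/andP => /andP[/andP[_ /eqP->] /andP[_ /eqP->]].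
by rewrite eqp; case: (pi (t e) == c); rewrite /= ?andbF ?andbT //=.
Qed.
End Refine.

Lemma crossE s t X (T : finType) (pi : V -> T) :
  cross s t X pi = \sum_e (edge_in s t X e && (pi (s e) != pi (t e))).
Proof.
rewrite /cross cardsE -sum1_card big_mkcond; apply: eq_bigr => e _.
by rewrite unfold_in; case: ifP.
Qed.

Lemma joins_sym s t x y e : joins s t x y e = joins s t y x e.
Proof. by rewrite /joins orbC. Qed.

Lemma mult_sym s t x y : mult s t x y = mult s t y x.
Proof. by apply: eq_card => e; rewrite !inE joins_sym. Qed.

Lemma mult_gt0 s t x y : 0 < mult s t x y -> exists e, joins s t x y e.
Proof. by move=> /card_gt0P[e]; rewrite inE; exists e. Qed.

Lemma gconn1 s t x : gconn s t [set x].
Proof.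
move=> K /set0Pn[a]; rewrite !inE => /andP[/eqP-> xK] /set0Pn[b].
by rewrite !inE => /andP[bK /eqP bx]; rewrite bx xK in bK.
Qed.

Lemma gconnU1 s t Y x y : gconn s t Y -> y \in Y -> 0 < mult s t x y ->
  gconn s t (x |: Y).
Proof.
move=> cY yY /mult_gt0[e0 j0] K n1 n2.
have [[n3 n4]|] : (Y :&: K != set0 /\ Y :\: K != set0) \/
    (x \in K) != (y \in K).
  case/boolP: (x \in K) => xK; case/boolP: (y \in K) => yK; try by right.
    left; split; first by apply/set0Pn; exists y; rewrite inE yY.
    case/set0Pn: n2 => v; rewrite !inE => /andP[vK /orP[/eqP vx|vY]].
      by rewrite vx xK in vK.
    by apply/set0Pn; exists v; rewrite !inE vY vK.
  left; split; last by apply/set0Pn; exists y; rewrite !inE yY yK.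
  case/set0Pn: n1 => v; rewrite !inE => /andP[/orP[/eqP vx|vY] vK].
    by rewrite vx (negbTE xK) in vK.
  by apply/set0Pn; exists v; rewrite !inE vY vK.
- have [e we ne] := cY K n3 n4; exists e => //.
  by apply: edge_in_sub we; rewrite subsetUr.
move=> nxy; exists e0; rewrite /edge_in ?inE.
  by case/orP: j0 => /andP[/eqP-> /eqP->]; rewrite eqxx yY ?orbT.
by case/orP: j0 => /andP[/eqP-> /eqP->] //; rewrite eq_sym.
Qed.

Lemma gconn3 s t x y z : 0 < mult s t x y -> 0 < mult s t y z ->
  gconn s t [set x; y; z].
Proof.
move=> m1 m2; have c1 : gconn s t [set x; y].
  by refine (gconnU1 (@gconn1 s t y) (set11 _) _).
rewrite (setUC _ [set z]); refine (gconnU1 c1 (set22 _ _) _).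
by rewrite mult_sym.
Qed.

Lemma gconn4 s t x y z u : 0 < mult s t x y -> 0 < mult s t y z ->
  0 < mult s t z u -> gconn s t [set x; y; z; u].
Proof.
move=> m1 m2 m3; rewrite (setUC _ [set u]).
refine (gconnU1 (y := z) (gconn3 m1 m2) _ _); first by rewrite !inE eqxx !orbT.
by rewrite mult_sym.
Qed.

Lemma joins_neq s t x y z e1 e2 : joins s t x y e1 -> joins s t y z e2 ->
  x != y -> x != z -> e1 != e2.
Proof.
rewrite !joinsE => /eqP j1 j2 xy xz; apply: contraTneq j2 => <-.
by rewrite j1 eq_set2 (negbTE xy) (negbTE xz).
Qed.

(** Both lifted edges have [y] as an end, so no edge that avoids [y] is lost. *)
Lemma mult_lift s t x y z e1 e2 a b : joins s t x y e1 -> joins s t y z e2 ->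
  y != a -> y != b ->
  mult s t a b <= mult (lift_s s x y e1 e2) (lift_s t z y e1 e2) a b.
Proof.
move=> j1 j2 ya yb; apply/subset_leq_card/subsetP => e; rewrite !inE => je.
have ny : (s e != y) && (t e != y).
  by case/orP: je => /andP[/eqP-> /eqP->]; rewrite ![_ == y]eq_sym ya yb.
rewrite /joins /lift_s; case: (eqVneq e e1) => [ee|_].
  by move: ny; rewrite ee; case/orP: j1 => /andP[/eqP-> /eqP->]; rewrite eqxx ?andbF.
case: (eqVneq e e2) => [ee|//].
by move: ny; rewrite ee; case/orP: j2 => /andP[/eqP-> /eqP->]; rewrite eqxx ?andbF.
Qed.

Lemma mult_lift_new s t x y z e1 e2 : joins s t x y e1 -> joins s t y z e2 ->
  x != y -> y != z ->
  mult s t x z < mult (lift_s s x y e1 e2) (lift_s t z y e1 e2) x z.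
Proof.
move=> j1 j2 xy yz.
have n1 : ~~ joins s t x z e1.
  rewrite /joins negb_or; case/orP: j1 => /andP[/eqP-> /eqP->].
    by rewrite (negbTE yz) (eq_sym y) (negbTE xy) !andbF.
  by rewrite (eq_sym y x) (negbTE xy) (negbTE yz).
apply: proper_card; apply/properP; split; last first.
  by exists e1; rewrite !inE // /joins /lift_s !eqxx.
apply/subsetP => e; rewrite !inE => je.
have ny : (s e != y) && (t e != y).
  by case/orP: je => /andP[/eqP-> /eqP->]; rewrite ![_ == y]eq_sym ?yz eq_sym xy.
rewrite /joins /lift_s; case: (eqVneq e e1) => [ee|_]; first by rewrite !eqxx.
case: (eqVneq e e2) => [ee|//].
by move: ny; rewrite ee; case/orP: j2 => /andP[/eqP-> /eqP->]; rewrite eqxx ?andbF.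
Qed.

(** Written additively to avoid truncated subtraction. When [x] and [z] lie in one part, lifting
    costs 2 crossing edges if [y] lies in another part, and none otherwise. *)
Lemma cross_lift s t X x y z e1 e2 (T : finType) (pi : V -> T) :
  x \in X -> y \in X -> z \in X ->
  e1 != e2 -> joins s t x y e1 -> joins s t y z e2 ->
  cross (lift_s s x y e1 e2) (lift_s t z y e1 e2) X pi
    + (pi x != pi y) + (pi y != pi z) = cross s t X pi + (pi x != pi z).
Proof.
move=> xX yX zX n12 j1 j2.
have n21 : (e2 == e1) = false by rewrite eq_sym (negbTE n12).
rewrite !crossE (bigD1 e1) //= (bigD1 e2) ?n21 //=.
rewrite [in RHS](bigD1 e1) //= [in RHS](bigD1 e2) ?n21 //=.
set A := \sum_(i | _) _; set B := \sum_(i | _) _.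
have -> : A = B.
  by apply: eq_bigr => e /andP[ne1 ne2];
    rewrite /edge_in /lift_s (negbTE ne1) (negbTE ne2).
rewrite /edge_in /lift_s !eqxx n21 eqxx xX yX zX /=.
have -> : (s e1 \in X) && (t e1 \in X) && (pi (s e1) != pi (t e1)) = (pi x != pi y).
  by case/orP: j1 => /andP[/eqP-> /eqP->]; rewrite xX yX //= eq_sym.
have -> : (s e2 \in X) && (t e2 \in X) && (pi (s e2) != pi (t e2)) = (pi y != pi z).
  by case/orP: j2 => /andP[/eqP-> /eqP->]; rewrite zX yX //= eq_sym.
rewrite ?eqxx /=; lia.
Qed.
End Weights.

(** * Minor models under contraction and lifting *)

Section Models.
Variables W : finType.
Variable h : rel W.
Hypothesis hsym : symmetric h.

Definition hconn (B : {set W}) := forall K : {set W},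
  B :&: K != set0 -> B :\: K != set0 ->
  exists a b, [/\ a \in B :&: K, b \in B :\: K & h a b].

Variables V E : finType.
Implicit Types (s t : E -> V) (X Y : {set V}).

(* [B] is a minor model in the host relation [h]; an edge joining two branch sets
   is needed only once for a whole class of parallel edges. *)
Definition model s t X := exists B : V -> {set W},
  [/\ {in X, forall x, B x != set0},
      {in X, forall x, hconn (B x)},
      {in X &, forall x y, x != y -> [disjoint B x & B y]}
    & forall e, edge_in s t X e -> s e != t e ->
        exists a b, [/\ a \in B (s e), b \in B (t e) & h a b]].

Lemma model_sub s t X Y : Y \subset X -> model s t X -> model s t Y.
Proof.
move=> /subsetP sYX [B [B1 B2 B3 B4]]; exists B; split.
- by move=> x /sYX; apply: B1.
- by move=> x /sYX; apply: B2.
- by move=> x y /sYX xX /sYX; apply: B3.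
- by move=> e we; apply: B4; apply: edge_in_sub we; apply/subsetP.
Qed.

(** If [K] splits some [B u], the connectivity of that branch set gives the crossing pair. Otherwise
    every branch set lies inside [K] or misses it, so [K] induces a cut of [Y], and an edge crossing
    this cut gives the pair. *)
Lemma hconn_bigcup s t Y (B : V -> {set W}) : gconn s t Y ->
  {in Y, forall x, hconn (B x)} -> {in Y, forall x, B x != set0} ->
  (forall e, edge_in s t Y e -> s e != t e ->
        exists a b, [/\ a \in B (s e), b \in B (t e) & h a b]) ->
  hconn (\bigcup_(u in Y) B u).
Proof.
move=> cY B2 B1 B4 K n1 n2.
have [[u [uY m1 m2]]|nou] := classic (exists u,
    [/\ u \in Y, B u :&: K != set0 & B u :\: K != set0]).
  have [a [b [ha hb hab]]] := B2 u uY K m1 m2; exists a, b.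
  move: ha hb; rewrite !inE => /andP[aB ->] /andP[-> bB]; split=> //.
    by rewrite andbT; apply/bigcupP; exists u.
  by apply/bigcupP; exists u.
have all u : u \in Y -> (B u \subset K) || [disjoint B u & K].
  move=> uY; rewrite -setD_eq0 -setI_eq0; apply/negPn; rewrite negb_or.
  by apply/negP => /andP[m2 m1]; apply: nou; exists u.
have [||e we ne] := cY [set u | B u \subset K].
- case/set0Pn: n1 => w; rewrite inE => /andP[/bigcupP[u uY wu] wK].
  apply/set0Pn; exists u; rewrite !inE uY /=.
  case/orP: (all u uY) => //; rewrite -setI_eq0 => /eqP /setP/(_ w).
  by rewrite !inE wu wK.
- case/set0Pn: n2 => w; rewrite inE => /andP[wK /bigcupP[u uY wu]].
  apply/set0Pn; exists u; rewrite !inE uY andbT.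
  by apply: contra wK => /subsetP; apply.
have nse : s e != t e by apply: contraNneq ne => ->.
have [a [b [aB bB hab]]] := B4 e we nse; case/andP: we => sY tY.
have key u w : u \in Y -> w \in B u -> (w \in K) = (B u \subset K).
  move=> uY wu; apply/idP/idP => [wK|/subsetP]; last exact.
  case/orP: (all u uY) => //; rewrite -setI_eq0 => /eqP /setP/(_ w).
  by rewrite !inE wu wK.
have aU : a \in \bigcup_(u in Y) B u by apply/bigcupP; exists (s e).
have bU : b \in \bigcup_(u in Y) B u by apply/bigcupP; exists (t e).
move: ne; rewrite !inE -(key _ a) // -(key _ b) //.
case: (boolP (a \in K)) => aK; case: (boolP (b \in K)) => bK // _.
  by exists a, b; rewrite !inE aK bK aU bU.
by exists b, a; rewrite !inE aK bK aU bU hsym.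
Qed.

Lemma model_collapse s t X Y y : Y \subset X -> y \in Y -> gconn s t Y ->
  model s t X ->
  model (collapse Y y \o s) (collapse Y y \o t) (collapse Y y @: X).
Proof.
move=> sYX yY cY [B [B1 B2 B3 B4]]; have yX := subsetP sYX y yY.
pose B' v := if v == y then \bigcup_(u in Y) B u else B v.
have inX v : v \in collapse Y y @: X -> v != y -> v \in X /\ v \notin Y.
  move=> /imsetP[u uX ->]; rewrite /collapse; case: ifP => uY; first by rewrite eqxx.
  by rewrite uY uX.
have sub v : v \in X -> B v \subset B' (collapse Y y v).
  move=> vX; rewrite /collapse; case: ifP => vY; rewrite /B'.
    by rewrite eqxx; apply: bigcup_sup.
  by case: eqP => // vy; rewrite vy yY in vY.
exists B'; split.
- move=> v vX; rewrite /B'; case: (eqVneq v y) => [_|nvy]; last first.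
    by have [vX' _] := inX v vX nvy; apply: B1.
  have /set0Pn[w wB] := B1 y yX; apply/set0Pn; exists w.
  by apply/bigcupP; exists y.
- move=> v vX; rewrite /B'; case: (eqVneq v y) => [_|nvy]; last first.
    by have [vX' _] := inX v vX nvy; apply: B2.
  apply: (@hconn_bigcup s t) => // [u /(subsetP sYX)|u /(subsetP sYX)|e we].
  + exact: B2.
  + exact: B1.
  + by apply: B4; apply: edge_in_sub we.
- have key v : v \in collapse Y y @: X -> v != y ->
      [disjoint B v & \bigcup_(u in Y) B u].
    move=> vX nvy; have [vX' vY] := inX v vX nvy.
    apply: bigcup_disjoint => u uY; apply: B3 => //; first exact: (subsetP sYX).
    by apply: contraNneq vY => ->.
  move=> u v uX vX; rewrite /B'; case: (eqVneq u y) => [->|nuy] nuv.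
    rewrite eq_sym (negbTE nuv) disjoint_sym; apply: key => //.
    by rewrite eq_sym.
  case: (eqVneq v y) => [_|nvy]; first exact: key.
  by apply: B3 => //; have [] := inX _ uX nuy; have [] := inX _ vX nvy.
- move=> e; rewrite edge_in_collapse // => we /= npe.
  have nse : s e != t e by apply: contraNneq npe => ->.
  have [a [b [aB bB hab]]] := B4 e we nse; case/andP: we => sX tX.
  by exists a, b; rewrite (subsetP (sub _ sX)) // (subsetP (sub _ tX)).
Qed.

(** The host adjacency that serves an existing edge between [x] and [z] serves the new one as well;
    this is why [x] and [z] must be adjacent beforehand. *)
Lemma model_lift s t X x y z e1 e2 : 0 < mult s t x z -> e1 != e2 ->
  model s t X -> model (lift_s s x y e1 e2) (lift_s t z y e1 e2) X.
Proof.
move=> /mult_gt0[e je] n12 [B [B1 B2 B3 B4]]; exists B; split=> // f.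
rewrite /edge_in /lift_s; case: eqP => [_ /andP[xX zX] nxz|_].
  have nse : s e != t e.
    by case/orP: je => /andP[/eqP-> /eqP->] //; rewrite eq_sym.
  have we : edge_in s t X e.
    by rewrite /edge_in; case/orP: je => /andP[/eqP-> /eqP->]; rewrite xX zX.
  have [a [b [aB bB hab]]] := B4 e we nse.
  case/orP: je aB bB => /andP[/eqP-> /eqP->] aB bB; first by exists a, b.
  by exists b, a; rewrite hsym.
by case: eqP => [_ _|_]; [rewrite eqxx|apply: B4].
Qed.

Lemma Z5_conn_card_le1 s t X : #|X| <= 1 -> Z5_conn s t X.
Proof.
move=> /card_le1P X1 b b0; exists xpredT => v vX.
have Xv : X = [set v].
  by apply/setP => u; rewrite (X1 _ vX u) !inE.
move: b0; rewrite Xv big_set1 => ->; rewrite /net big1 // => e.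
rewrite /edge_in !inE => /andP[/eqP es /eqP et].
by rewrite /inc es et eqxx subrr mulr0.
Qed.

(** Crossing edges are counted class by class. It is enough that [P] covers, in either order, the
    adjacent pairs separated by [pi]. *)
Lemma cross_id2 s t X (T : finType) (pi : V -> T) (P : seq (V * V)) :
  (forall u v, u \in X -> v \in X -> pi u != pi v -> 0 < mult s t u v ->
    ((u, v) \in P) || ((v, u) \in P)) ->
  cross s t X pi <= \sum_(p <- P) mult s t p.1 p.2.
Proof.
move=> HP; have -> : \sum_(p <- P) mult s t p.1 p.2 =
    \sum_(p <- P) \sum_(e : E) (joins s t p.1 p.2 e : nat).
  apply: eq_bigr => p _; rewrite /mult cardsE -sum1_card big_mkcond.
  by apply: eq_bigr => e _; rewrite unfold_in -/(joins s t p.1 p.2 e);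
    case: (joins _ _ _ _ e).
rewrite crossE exchange_big /=; apply: leq_sum => e _.
case: (boolP (edge_in s t X e)) => //= /andP[sX tX].
case: (boolP (pi (s e) != pi (t e))) => //= npi.
have [p pP jp] : exists2 p, p \in P & joins s t p.1 p.2 e.
  have mst : 0 < mult s t (s e) (t e).
    by apply/card_gt0P; exists e; rewrite inE /joins !eqxx.
  case/orP: (HP _ _ sX tX npi mst) => pP; [exists (s e, t e)|exists (t e, s e)] => //;
  by rewrite /joins /= !eqxx ?orbT.
by rewrite (big_rem p pP) /= jp.
Qed.

Lemma cards3P X : #|X| = 3 -> exists x y z,
  [/\ x != y, x != z, y != z & X = [set x; y; z]].
Proof.
move=> X3; have /card_gt0P[x xX] : 0 < #|X| by rewrite X3.
have := cardsD1 x X; rewrite xX X3 => -[] /esym/eqP/cards2P[y [z [yz eX]]].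
have /setP/(_ x) := eX; rewrite !inE eqxx /= => /esym/norP[xy xz].
exists x, y, z; split=> //.
by rewrite -(setD1K xX) eX setUA.
Qed.

(** The special bounds 4 and 8 are used here. Two vertices carry 4 parallel edges. With three
    vertices, either some multiplicity is at least 4 and contracting that pair leaves two vertices,
    or all are at most 3 with sum at least 8, hence at least 3, 3, 2 in some order. *)
Lemma Z5_conn_small s t X : #|X| <= 3 -> Heavy s t X -> Z5_conn s t X.
Proof.
have two s' t' Y : #|Y| = 2 -> Heavy s' t' Y -> Z5_conn s' t' Y.
  move=> /eqP/cards2P[x [y [xy ->]]] H; apply: Z5_conn_two => //.
  have := H V id; rewrite imset_id cards2 xy /= /heavy /= => /andP[c4 _].
  apply: leq_trans c4 _; apply: leq_trans (@cross_id2 s' t' _ _ _ [:: (x, y)] _) _.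
    move=> u v; rewrite !inE /= => /orP[]/eqP-> /orP[]/eqP->; rewrite ?eqxx ?orbT //.
  by rewrite big_seq1.
rewrite leq_eqVlt => /orP[/eqP/cards3P[x [y [z [xy xz yz eX]]]] H|]; last first.
  rewrite ltnS leq_eqVlt => /orP[/eqP|X1 _]; first exact: two.
  by apply: Z5_conn_card_le1; rewrite -ltnS.
have three x' y' z' : x' != y' -> x' != z' -> y' != z' -> X = [set x'; y'; z'] ->
    4 <= mult s t x' y' -> Z5_conn s t X.
  move=> xy' xz' yz' eX' m4; have sY : [set x'; y'] \subset X.
    by rewrite eX' subsetUl.
  have xY : x' \in [set x'; y'] by rewrite set21.
  apply: (Z5_conn_contract sY xY); first exact: Z5_conn_two.
  apply: two; last by apply: Heavy_collapse => // T pi _; apply: H.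
  have := card_collapse sY xY; rewrite cards2 xy' eX' /= => e.
  apply/eqP; rewrite -(eqn_add2r 2) e addn2 !eqSS eqn_leq.
  have -> : [set x'; y'; z'] = z' |: [set x'; y'] by rewrite setUC.
  by rewrite cardsU1 cards2 !inE negb_or xy' (eq_sym z') xz' (eq_sym z') yz'.
have e1 : [set x; y; z] = [set y; z; x] by rewrite [RHS]setUC setUA.
have e2 : [set x; y; z] = [set x; z; y] by rewrite setUAC.
case: (leqP 4 (mult s t x y)) => [|m1]; first by apply: (three x y z).
case: (leqP 4 (mult s t y z)) => [|m2].
  by apply: (three y z x); rewrite -?e1 // eq_sym.
case: (leqP 4 (mult s t x z)) => [|m3].
  by apply: (three x z y); rewrite -?e2 // eq_sym.
have tot : 8 <= mult s t x y + mult s t y z + mult s t x z.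
  have := H V id; rewrite imset_id.
  have -> : #|X| = 3.
    rewrite eX setUC cardsU1 cards2 !inE negb_or xy.
    by rewrite (eq_sym z) xz (eq_sym z) yz.
  rewrite /heavy /= andbT => c8; apply: leq_trans c8 _.
  apply: leq_trans (@cross_id2 s t _ _ _ [:: (x, y); (y, z); (x, z)] _) _.
    move=> u v; rewrite eX !inE /= !xpair_eqE -!orbA.
    by move=> /or3P[]/eqP-> /or3P[]/eqP->; rewrite ?eqxx ?orbT.
  by rewrite !big_cons big_nil /= addn0 addnA.
rewrite eX; case: (leqP 3 (mult s t x y)) => k1; last first.
  rewrite e2; apply: Z5_conn_three; rewrite // 1?eq_sym // ?[mult s t z y]mult_sym; lia.
case: (leqP 3 (mult s t y z)) => k2; first by apply: Z5_conn_three => //; lia.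
by rewrite (setUC [set x]); apply: Z5_conn_three;
  rewrite // 1?eq_sym // ?[mult s t y x]mult_sym; lia.
Qed.
End Models.

(** * A minimal counterexample *)

Section Counterexample.
Variables (W : finType) (h : rel W).
Hypothesis hsym : symmetric h.
Variables V E : finType.
Variables (s t : E -> V) (X : {set V}).
Hypothesis IH : forall (s' t' : E -> V) (X' : {set V}), #|X'| < #|X| ->
  Heavy s' t' X' -> model h s' t' X' -> Z5_conn s' t' X'.
Hypotheses (HX : Heavy s t X) (MX : model h s t X) (nX : ~ Z5_conn s t X).

Implicit Types Y : {set V}.
Let n := #|X|.

Lemma heavyI k c : (k = 2 -> 4 <= c) -> (k = 3 -> 8 <= c) ->
  (4 <= k -> 11 * k <= 2 * c + 19) -> heavy k c.
Proof.
move=> h2 h3 h4; rewrite /heavy; apply/and3P; split.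
- by apply/implyP => /eqP.
- by apply/implyP => /eqP.
- exact/implyP.
Qed.

(** One lifting costs at most 2 crossing edges, that is 4 in [2 * c], which the slack 5 absorbs. The
    stricter bound for two parts takes the slack 8, available there because [2 <= m - 2]. *)
Lemma heavy_drop2 m k c c' : 4 <= m ->
  (2 <= k < m -> 11 * k + 5 <= 2 * c + 19) ->
  (2 <= k <= m - 2 -> 11 * k + 8 <= 2 * c + 19) ->
  2 <= k -> k < m -> c <= c' + 2 -> heavy k c'.
Proof.
move=> m4 w1 w2 k2 km cc; have {}w1 := w1 (introT andP (conj k2 km)).
have {}w2 : k <= m - 2 -> 11 * k + 8 <= 2 * c + 19 by move=> ?; apply: w2; lia.
by apply: heavyI => kk; lia.
Qed.

Lemma heavy_drop2_far m k c c' :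
  (2 <= k <= m - 3 -> 11 * k + 9 <= 2 * c + 19) ->
  2 <= k -> k + 3 <= m -> c <= c' + 2 -> heavy k c'.
Proof.
move=> w3 k2 km cc; have {}w3 : 11 * k + 9 <= 2 * c + 19 by apply: w3; lia.
by apply: heavyI => kk; lia.
Qed.

(** Two liftings may cost 8 in [2 * c], exactly the slack in [w2]. The two exceptional bounds ask
    for more: [cut] serves the bound 4 for two parts, and [tight] the bound 8 for three parts when
    [m = 5]. *)
Lemma heavy_drop4 m k c c' : 5 <= m ->
  (2 <= k <= m - 2 -> 11 * k + 8 <= 2 * c + 19) ->
  (2 <= k <= m - 3 -> 11 * k + 9 <= 2 * c + 19) ->
  (k = m - 2 -> 11 * m <= 2 * (c + 6) + 19) ->
  (k = 2 -> c <= c' + 2 \/ 16 <= 2 * c) ->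
  2 <= k -> k + 2 <= m -> c <= c' + 4 -> heavy k c'.
Proof.
move=> m5 w2 w3 tight cut k2 km cc.
have {}w2 : 11 * k + 8 <= 2 * c + 19 by apply: w2; lia.
have {}w3 : k <= m - 3 -> 11 * k + 9 <= 2 * c + 19 by move=> ?; apply: w3; lia.
by apply: heavyI => kk; lia.
Qed.

Lemma part_size_le3 m k a : 5 <= m -> k = m - 2 -> k + a <= m.+1 -> a <= 3.
Proof. by lia. Qed.

Lemma heavy_refine3 m k k' c g : 5 <= m -> k = m - 2 -> k'.+1 = k + 3 ->
  g <= 6 -> heavy k' (c + g) -> 11 * m <= 2 * (c + 6) + 19.
Proof. by move=> m5 e1 e2 g6 /heavyW; lia. Qed.

Lemma n_ge4 : 4 <= n.
Proof. by rewrite ltnNge; apply/negP => n3; apply/nX/Z5_conn_small. Qed.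

Definition light k c := [|| (k == 2) && (c <= 3), (k == 3) && (c <= 7)
  | (4 <= k) && (2 * c + 19 < 11 * k)].

Lemma lightP k c : light k c = ~~ heavy k c.
Proof.
rewrite /light /heavy; apply/idP/idP.
  by move=> /or3P[]/andP[]; lia.
by lia.
Qed.

Lemma light_ge2 k c : light k c -> 2 <= k.
Proof. by move=> /or3P[]/andP[]; lia. Qed.

(** If [Y] were heavy, minimality would apply both to [Y] and to the contraction of [Y], and the two
    orientations would combine to one of [X]. *)
Lemma light_part Y : Y \subset X -> 2 <= #|Y| -> Y != X ->
  exists (T : finType) (q : V -> T), light #|q @: Y| (cross s t Y q).
Proof.
move=> sYX Y2 nYX; apply: NNPP => nq; apply: nX.
have HY : Heavy s t Y.
  move=> T q; apply/negPn/negP; rewrite -lightP => l.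
  by apply: nq; exists T, q.
have ltY : #|Y| < n by apply: proper_card; rewrite properEneq nYX.
have szY : Z5_conn s t Y by apply: IH => //; apply: model_sub MX.
have /card_gt0P[y yY] : 0 < #|Y| by apply: leq_trans Y2.
apply: (Z5_conn_contract sYX yY szY); apply: IH.
- by have := card_collapse sYX yY; rewrite /n; lia.
- by apply: Heavy_collapse => // T pi _; apply: HX.
- by apply: model_collapse => //; apply: Heavy_gconn.
Qed.

Lemma part_refine (T : finType) (pi : V -> T) c :
  2 <= #|pi @: X| -> 2 <= #|[set v in X | pi v == c]| ->
  exists (T' : finType) (pi' : V -> T') k g,
   [/\ light k g, k <= #|[set v in X | pi v == c]|,
       #|pi' @: X|.+1 = #|pi @: X| + k & cross s t X pi' = cross s t X pi + g].
Proof.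
move=> k2 Y2; set Y := [set v in X | pi v == c] in Y2 *.
have sYX : Y \subset X by apply/subsetP => v; rewrite inE => /andP[].
have cX : c \in pi @: X.
  have /card_gt0P[v] : 0 < #|Y| by apply: leq_trans Y2.
  by rewrite inE => /andP[vX /eqP<-]; apply: imset_f.
have nYX : Y != X.
  apply: contraTneq k2 => eY; rewrite -ltnNge ltnS -(cards1 c).
  apply/subset_leq_card/subsetP => u /imsetP[v vX ->]; have : v \in Y by rewrite eY.
  by rewrite !inE => /andP[].
have [T' [q lq]] := light_part sYX Y2 nYX.
exists _, (refine pi c q), #|q @: Y|, (cross s t Y q); split=> //.
- exact: leq_imset_card.
- exact: card_refine.
- exact: cross_refine.
Qed.

Lemma nontrivial_part (T : finType) (pi : V -> T) : #|pi @: X| < n ->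
  exists c, 2 <= #|[set v in X | pi v == c]|.
Proof.
move=> lt; apply: NNPP => nc; move: lt; rewrite ltnNge => /negP; apply.
rewrite card_in_imset // => u v uX vX e; apply/eqP/negPn/negP => nuv.
apply: nc; exists (pi u); apply: leq_trans (_ : #|[set u; v]| <= _).
  by rewrite cards2 nuv.
apply/subset_leq_card/subsetP => w; rewrite !inE.
by move=> /orP[]/eqP->; rewrite ?uX ?vX -?e eqxx.
Qed.

Lemma part_bound (T : finType) (pi : V -> T) Y y : Y \subset X -> y \in Y ->
  {in Y, forall u, pi u = pi y} -> #|pi @: X| + #|Y| <= n.+1.
Proof.
move=> sYX yY cst; have := card_collapse sYX yY; rewrite -/n => <-.
rewrite leq_add2r; apply: leq_trans (leq_imset_card pi _).
rewrite -imset_comp; apply/subset_leq_card/subsetP => u /imsetP[v vX ->].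
apply/imsetP; exists v => //=; rewrite /collapse; case: ifP => // vY.
by rewrite (cst v).
Qed.

(** Splitting a part along a light partition with [k] parts and [g] crossing edges adds [k - 1]
    parts and [g] edges, so the bound for the refinement gives [pi] a slack of
    [11 * (k - 1) - 2 * g]. Lightness makes this at least 5, 8, 9 for [k = 2], [k = 3], [k >= 4]. *)
Lemma weight1 (T : finType) (pi : V -> T) : 2 <= #|pi @: X| < n ->
  11 * #|pi @: X| + 5 <= 2 * cross s t X pi + 19.
Proof.
case/andP => k2 kn; have [c c2] := nontrivial_part kn.
have [T' [pi' [k [g [l _ e1 e2]]]]] := part_refine k2 c2.
have := heavyW _ (HX pi'); rewrite e2; have := light_ge2 l.
by move/or3P: l => []/andP[]; lia.
Qed.

(** For [k = 2] the refinement has at most [n - 1] parts, so [weight1] adds another 5 and the slack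
    is 10; the other two cases already give 8 and 9. *)
Lemma weight2 (T : finType) (pi : V -> T) : 2 <= #|pi @: X| <= n - 2 ->
  11 * #|pi @: X| + 8 <= 2 * cross s t X pi + 19.
Proof.
case/andP => k2 kn; have [|c c2] := nontrivial_part (pi := pi); first by lia.
have [T' [pi' [k [g [l _ e1 e2]]]]] := part_refine k2 c2.
have w1 := @weight1 _ pi'; have := heavyW _ (HX pi'); rewrite e2 in w1 *.
have := light_ge2 l.
by move/or3P: l => []/andP[]; lia.
Qed.

(** Now refinements with [k = 2] or [k = 3] are still coarse enough for [weight2] or [weight1], so
    the worst case is the 9 of [k >= 4]. *)
Lemma weight3 (T : finType) (pi : V -> T) : 2 <= #|pi @: X| <= n - 3 ->
  11 * #|pi @: X| + 9 <= 2 * cross s t X pi + 19.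
Proof.
case/andP => k2 kn; have [|c c2] := nontrivial_part (pi := pi); first by lia.
have [T' [pi' [k [g [l _ e1 e2]]]]] := part_refine k2 c2.
have w1 := @weight1 _ pi'; have w2 := @weight2 _ pi'.
have := heavyW _ (HX pi'); rewrite e2 in w1 w2 *; have := light_ge2 l.
by move/or3P: l => []/andP[]; lia.
Qed.

(** The refinement has at most [n - 2] parts, so the slack 8 of [weight2] is added to the slack of
    the split, at least 5, and [22 + 5 + 8 - 19 = 16]. *)
Lemma weight_cut (T : finType) (pi : V -> T) c : #|pi @: X| = 2 ->
  2 <= #|[set v in X | pi v == c]| <= n - 3 -> 16 <= 2 * cross s t X pi.
Proof.
move=> k2 /andP[c2 cn].
have [|T' [pi' [k [g [l kc e1 e2]]]]] := @part_refine _ pi c _ c2; first by rewrite k2.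
have w2 := @weight2 _ pi'; rewrite e2 in w2; have := light_ge2 l.
by move/or3P: l => []/andP[]; lia.
Qed.

(** Here [s'] and [t'] may come from [s] and [t] by liftings, so heaviness has to be established
    anew, but only for partitions that keep [Y] in one part. *)
Lemma reduction (s' t' : E -> V) Y y : Y \subset X -> y \in Y -> 2 <= #|Y| ->
  Z5_conn s' t' Y -> gconn s' t' Y -> model h s' t' X ->
  (forall (T : finType) (pi : V -> T), {in Y, forall u, pi u = pi y} ->
     2 <= #|pi @: X| -> heavy #|pi @: X| (cross s' t' X pi)) ->
  Z5_conn s' t' X.
Proof.
move=> sYX yY Y2 szY cY mX H; apply: (Z5_conn_contract sYX yY szY); apply: IH.
- by have := card_collapse sYX yY; rewrite /n; lia.
- apply: Heavy_collapse => // T pi cst.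
  case: (leqP 2 #|pi @: X|) => [|k1]; first exact: H.
  by rewrite /heavy; lia.
- exact: model_collapse.
Qed.

Lemma mult_le3 x y : x \in X -> y \in X -> x != y -> mult s t x y <= 3.
Proof.
move=> xX yX xy; rewrite leqNgt; apply/negP => m4; apply: nX.
have sY : [set x; y] \subset X by apply/subsetP => v /set2P[]->.
apply: (@reduction s t _ x sY) => //; first by rewrite set21.
- by rewrite cards2 xy.
- exact: Z5_conn_two.
- refine (gconnU1 (@gconn1 _ _ s t y) (set11 _) _).
  by apply: leq_trans m4.
Qed.

(** Lifting through [y] raises the multiplicity of [xz] to 4, which makes this pair contractible. *)
Lemma no_triangle3 x y z : x \in X -> y \in X -> z \in X ->
  x != y -> y != z -> x != z ->
  0 < mult s t x y -> 0 < mult s t y z -> mult s t x z <= 2.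
Proof.
move=> xX yX zX xy yz xz /mult_gt0[e1 j1] /mult_gt0[e2 j2].
rewrite leqNgt; apply/negP => m3; apply: nX.
have n12 := joins_neq j1 j2 xy xz.
apply: (Z5_conn_lift xX yX zX xy yz n12 j1 j2).
set s' := lift_s _ _ _ _ _; set t' := lift_s _ _ _ _ _.
have m4 : 4 <= mult s' t' x z.
  by apply: leq_ltn_trans m3 _; apply: mult_lift_new.
have sY : [set x; z] \subset X by apply/subsetP => v /set2P[]->.
have n4 := n_ge4.
apply: (@reduction s' t' _ x sY) => //; first by rewrite set21.
- by rewrite cards2 xz.
- exact: Z5_conn_two.
- refine (gconnU1 (@gconn1 _ _ s' t' z) (set11 _) _).
  by apply: leq_trans m4.
- by apply: model_lift => //; apply: leq_trans m3.
move=> T pi cst k2.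
have kb := @part_bound _ pi _ x sY (set21 _ _) cst.
have := cross_lift (X := X) pi xX yX zX n12 j1 j2; rewrite -/s' -/t'.
rewrite (cst z (set22 _ _)) eqxx eq_sym addn0 => ecr.
apply: (heavy_drop2 n4 (@weight1 _ pi) (@weight2 _ pi) k2).
  by move: kb; rewrite cards2 xz addn2.
by rewrite -ecr -addnA leq_add2l; case: (_ == _).
Qed.

Lemma card_set4 (x y z u : V) : uniq [:: x; y; z; u] -> #|[set x; y; z; u]| = 4.
Proof.
move=> U; have <- : #|[:: x; y; z; u]| = 4 by apply/card_uniqP.
apply: eq_card => v.
by rewrite !inE !orbA.
Qed.

Lemma no_cycle3333 (x y z u : V) : uniq [:: x; y; z; u] ->
  [set x; y; z; u] \subset X ->
  3 <= mult s t x y -> 3 <= mult s t y z -> 3 <= mult s t z u ->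
  3 <= mult s t u x -> False.
Proof.
move=> U sY m1 m2 m3 m4; apply: nX.
have xY : x \in [set x; y; z; u] by rewrite !inE eqxx.
apply: (@reduction s t _ x sY) => //.
- by rewrite card_set4.
- exact: Z5_conn_cycle4.
- by apply: gconn4; [apply: leq_trans m1|apply: leq_trans m2|apply: leq_trans m3].
Qed.

Lemma no_k4 (x y z u : V) : uniq [:: x; y; z; u] ->
  [set x; y; z; u] \subset X ->
  2 <= mult s t x y -> 2 <= mult s t x z -> 2 <= mult s t x u ->
  2 <= mult s t y z -> 2 <= mult s t y u -> 2 <= mult s t z u -> False.
Proof.
move=> U sY m1 m2 m3 m4 m5 m6; apply: nX.
have xY : x \in [set x; y; z; u] by rewrite !inE eqxx.
apply: (@reduction s t _ x sY) => //.
- by rewrite card_set4.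
- exact: Z5_conn_k4.
- by apply: gconn4; [apply: leq_trans m1|apply: leq_trans m4|apply: leq_trans m6].
Qed.

(** Lifting through [z] completes the cycle to multiplicities 3, 3, 3, 3. Contracting four vertices
    leaves at most [n - 3] parts, the range of [weight3]. *)
Lemma no_cycle2333 (x y u v z : V) : uniq [:: x; y; u; v] ->
  [set x; y; u; v] \subset X -> z \in X -> z \notin [set x; y; u; v] ->
  2 <= mult s t x y -> 3 <= mult s t y u -> 3 <= mult s t u v ->
  3 <= mult s t v x -> 0 < mult s t x z -> 0 < mult s t z y -> False.
Proof.
move=> U sY zX; rewrite !inE !negb_or => /andP[/andP[/andP[zx zy] zu] zv].
move=> m1 m2 m3 m4 /mult_gt0[e1 j1] /mult_gt0[e2 j2]; apply: nX.
have xY : x \in [set x; y; u; v] by rewrite !inE eqxx.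
have yY : y \in [set x; y; u; v] by rewrite !inE eqxx orbT.
have xX := subsetP sY x xY; have yX := subsetP sY y yY.
have xy : x != y by move: U; rewrite /= !inE; case: eqP.
have xz : x != z by rewrite eq_sym.
have n12 := joins_neq j1 j2 xz xy.
apply: (Z5_conn_lift xX zX yX xz zy n12 j1 j2).
set s' := lift_s _ _ _ _ _; set t' := lift_s _ _ _ _ _.
have m1' : 3 <= mult s' t' x y.
  by apply: leq_ltn_trans m1 _; apply: mult_lift_new.
have m2' : 3 <= mult s' t' y u by apply: leq_trans m2 _; apply: mult_lift.
have m3' : 3 <= mult s' t' u v by apply: leq_trans m3 _; apply: mult_lift.
have m4' : 3 <= mult s' t' v x by apply: leq_trans m4 _; apply: mult_lift.
have n4 := n_ge4.
apply: (@reduction s' t' _ x sY) => //.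
- by rewrite card_set4.
- exact: Z5_conn_cycle4.
- by apply: gconn4; [apply: leq_trans m1'|apply: leq_trans m2'|apply: leq_trans m3'].
- by apply: model_lift => //; apply: leq_trans m1.
move=> T pi cst k2.
have kb := @part_bound _ pi _ x sY xY cst.
have := cross_lift (X := X) pi xX zX yX n12 j1 j2; rewrite -/s' -/t'.
rewrite (cst y yY) eqxx eq_sym addn0 => ecr.
apply: (heavy_drop2_far (@weight3 _ pi) k2).
  by move: kb; rewrite card_set4 // addnS.
by rewrite -ecr -addnA leq_add2l; case: (_ == _).
Qed.

(** Lifting through [w] and through [w'] raises [xy] and [xz] to 3, which with [yz] gives the
    contractible triangle 3, 3, 2. *)
Lemma no_double222 (x y z w w' : V) : uniq [:: x; y; z; w; w'] ->
  {subset [:: x; y; z; w; w'] <= X} ->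
  mult s t x y = 2 -> mult s t y z = 2 -> mult s t x z = 2 ->
  0 < mult s t x w -> 0 < mult s t w y -> 0 < mult s t x w' ->
  0 < mult s t w' z -> False.
Proof.
move=> U sX m1 m2 m3 /mult_gt0[e1 j1] /mult_gt0[e2 j2] mw1 mw2; apply: nX.
have [xX yX zX wX w'X] : [/\ x \in X, y \in X, z \in X, w \in X & w' \in X].
  by split; apply: sX; rewrite !inE eqxx ?orbT.
have := U; rewrite /= !inE !negb_or => /and5P[/and4P[xy xz xw xw'] /and3P[yz yw yw']
  /andP[zw zw'] ww' _].
have wy : w != y by rewrite eq_sym.
have w'z : w' != z by rewrite eq_sym.
have sY : [set x; y; z] \subset X.
  by apply/subsetP => v; rewrite !inE => /orP[/orP[]|]/eqP->.
have xY : x \in [set x; y; z] by rewrite !inE eqxx.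
have yY : y \in [set x; y; z] by rewrite !inE eqxx orbT.
have zY : z \in [set x; y; z] by rewrite !inE eqxx orbT.
have cY : #|[set x; y; z]| = 3.
  by rewrite setUC cardsU1 cards2 !inE negb_or xy (eq_sym z) xz (eq_sym z) yz.
have n12 := joins_neq j1 j2 xw xy.
apply: (Z5_conn_lift xX wX yX xw wy n12 j1 j2).
have cr1 := cross_lift (X := X) _ xX wX yX n12 j1 j2.
have mo1 : model h (lift_s s x w e1 e2) (lift_s t y w e1 e2) X.
  by apply: model_lift => //; rewrite m1.
have := mult_lift_new j1 j2 xw wy; rewrite m1 => m1'.
have ml := mult_lift j1 j2.
move: m1' ml mo1 cr1; set s1 := lift_s s _ _ _ _; set t1 := lift_s t _ _ _ _.
move=> m1' ml mo1 cr1.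
have m2' : 2 <= mult s1 t1 y z by rewrite -m2; apply: ml => //; rewrite eq_sym.
have m3' : 2 <= mult s1 t1 x z by rewrite -m3; apply: ml => //; rewrite eq_sym.
have /mult_gt0[e3 j3] : 0 < mult s1 t1 x w'.
  by apply: leq_trans mw1 _; apply: ml => //; rewrite eq_sym.
have /mult_gt0[e4 j4] : 0 < mult s1 t1 w' z.
  by apply: leq_trans mw2 _; apply: ml => //; rewrite eq_sym.
have n34 := joins_neq j3 j4 xw' xz.
apply: (Z5_conn_lift xX w'X zX xw' w'z n34 j3 j4).
have cr2 := cross_lift (X := X) _ xX w'X zX n34 j3 j4.
have mo2 : model h (lift_s s1 x w' e3 e4) (lift_s t1 z w' e3 e4) X.
  by apply: model_lift => //; apply: leq_trans m3'.
have := leq_ltn_trans m3' (mult_lift_new j3 j4 xw' w'z).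
have ml2 := mult_lift j3 j4.
move: ml2 mo2 cr2; set s2 := lift_s s1 _ _ _ _; set t2 := lift_s t1 _ _ _ _.
move=> ml2 mo2 cr2 m3''.
have m1'' : 3 <= mult s2 t2 x y.
  by apply: leq_trans m1' _; apply: ml2; rewrite eq_sym.
have m2'' : 2 <= mult s2 t2 y z.
  by apply: leq_trans m2' _; apply: ml2; rewrite eq_sym.
have szY : Z5_conn s2 t2 [set x; y; z].
  rewrite (setUC [set x]); apply: Z5_conn_three; rewrite // 1?eq_sym //.
  by rewrite mult_sym.
have n5 : 5 <= n.
  have <- : #|[:: x; y; z; w; w']| = 5 by apply/card_uniqP.
  by apply/subset_leq_card/subsetP => v; apply: sX.
apply: (@reduction s2 t2 _ x sY) => //.
- by rewrite cY.
- by apply: gconn3; [apply: leq_trans m1''|apply: leq_trans m2''].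
move=> T pi cst k2.
have pY := cst y yY; have pZ := cst z zY.
have := @part_bound _ pi _ x sY xY cst; rewrite cY => kn.
have := cr1 _ pi; have := cr2 _ pi;
  rewrite pY pZ eqxx !addn0 !(eq_sym _ (pi x)) => c2 c1.
(* With [n - 2] parts, the part of [x] is exactly the triangle. Splitting it into single vertices
   adds just its 6 edges and two parts, which leaves [pi] a slack of 10. *)
have tight : #|pi @: X| = n - 2 -> 11 * n <= 2 * (cross s t X pi + 6) + 19.
  move=> kn2; set Z := [set v in X | pi v == pi x].
  have sZX : Z \subset X by apply/subsetP => v; rewrite inE => /andP[].
  have xZ : x \in Z by rewrite inE xX eqxx.
  have cZ : {in Z, forall u, pi u = pi x}.
    by move=> u; rewrite inE => /andP[_ /eqP].
  have eZ : [set x; y; z] = Z.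
    apply/eqP; rewrite eqEcard cY; apply/andP; split.
      by apply/subsetP => v vY; rewrite inE (subsetP sY) //= cst.
    exact: part_size_le3 n5 kn2 (part_bound sZX xZ cZ).
  have hr := HX (refine pi (pi x) id); rewrite cross_refine -/Z -eZ in hr.
  have xpi : pi x \in pi @: X by apply: imset_f.
  have := card_refine id xpi; rewrite -/Z imset_id -eZ cY => kk.
  apply: heavy_refine3 n5 kn2 kk _ hr.
  apply: leq_trans (@cross_id2 V E s t _ _ _ [:: (x, y); (y, z); (x, z)] _) _.
    move=> u v; rewrite !inE /= !xpair_eqE -!orbA.
    by move=> /or3P[]/eqP-> /or3P[]/eqP->; rewrite ?eqxx ?orbT.
  by rewrite !big_cons big_nil /= m1 m2 m3.
(* When both liftings cost edges and there are two parts, [w] and [w'] lie together opposite the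
   triangle. Their part has between 2 and [n - 3] vertices, as [weight_cut] requires. *)
have cut : #|pi @: X| = 2 -> pi x != pi w -> pi x != pi w' ->
    16 <= 2 * cross s t X pi.
  move=> k22 nw nw'; apply: (weight_cut (c := pi w) k22).
  have eww : pi w' = pi w.
    apply/eqP/negPn/negP => nww; have : 3 <= #|pi @: X|; last by rewrite k22.
    have <- : #|[:: pi x; pi w; pi w']| = 3.
      by apply/card_uniqP; rewrite /= !inE !negb_or nw nw' eq_sym nww.
    by apply/subset_leq_card/subsetP => v; rewrite !inE => /or3P[]/eqP->;
      apply: imset_f.
  apply/andP; split.
    apply: leq_trans (_ : #|[set w; w']| <= _); first by rewrite cards2 ww'.
    apply/subset_leq_card/subsetP => v; rewrite !inE.
    by move=> /orP[]/eqP->; rewrite ?wX ?w'X ?eww eqxx.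
  rewrite -cY -cardsDS //; apply/subset_leq_card/subsetP => v; rewrite in_set in_setD.
  move=> /andP[vX /eqP pv]; rewrite vX andbT; apply/negP => /cst; rewrite pv => pe.
  by rewrite pe eqxx in nw.
apply: (heavy_drop4 n5 (@weight2 _ pi) (@weight3 _ pi) tight) => //.
- move=> k22; case: (eqVneq (pi x) (pi w)) => [ew|nw].
    left; rewrite -c1 ew eqxx !addn0 -c2 -addnA leq_add2l.
    by case: (_ == _).
  case: (eqVneq (pi x) (pi w')) => [ew'|nw']; last by right; apply: cut.
  left; rewrite -c1 -c2 ew' eqxx !addn0 -addnA leq_add2l.
  by case: (_ == _).
- by move: kn; rewrite addnS.
rewrite -c1 -c2 -!addnA leq_add2l.
by case: (_ == _); case: (_ == _).
Qed.
End Counterexample.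

(** * Combinatorial plane maps *)

Section PlaneMap.
Variable H : finType.
Implicit Types D : {set H}.

Definition incid (S : finType) (s t : H -> S) v e := (s e == v) + (t e == v).

(** Modulo 2 this is the degree of [v] in the boundary of the face [i]: an edge with [i] on both
    sides contributes an even number. *)
Definition incid_sum (S J : finType) (s t : H -> S) (l r : H -> J) D v i :=
  \sum_(e in D) incid s t v e * incid l r i e.

Definition splits (S : finType) (s t : H -> S) D (A : {set S}) :=
  forall K : {set S}, A :&: K != set0 -> A :\: K != set0 ->
    exists2 e, e \in D & (s e \in K) != (t e \in K).

(* [pm_even] says that the boundary of every face is an even subgraph, and
   [splits l r D B] that the dual graph is connected.  The conditions are
   symmetric under duality up to primal connectivity, so deleting an edge is
   contracting it in the dual. *)
Record plane_map (S J : finType) (s t : H -> S) (l r : H -> J) D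
    (A : {set S}) (B : {set J}) : Prop := PlaneMap {
  pm_even : forall v i, ~~ odd (incid_sum s t l r D v i);
  pm_dual : splits l r D B;
  pm_ends : forall e, e \in D -> (s e \in A) && (t e \in A);
  pm_sides : forall e, e \in D -> (l e \in B) && (r e \in B);
  pm_euler : #|D| + 2 <= #|A| + #|B| }.

Definition merge (S : finType) (x y z : S) := if z == y then x else z.

Lemma incid_sumC (S J : finType) (s t : H -> S) (l r : H -> J) D v i :
  incid_sum s t l r D v i = incid_sum l r s t D i v.
Proof. by apply: eq_bigr => e _; rewrite mulnC. Qed.

Lemma incid_sumD1 (S J : finType) (s t : H -> S) (l r : H -> J) D v i e :
  e \in D -> incid_sum s t l r D v i =
    incid s t v e * incid l r i e + incid_sum s t l r (D :\ e) v i.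
Proof.
move=> eD; rewrite /incid_sum (bigD1 e) //=; congr (_ + _).
by apply: eq_bigl => f; rewrite !inE andbC.
Qed.

(** At the merged vertex the new sum is the sum of the two old ones minus the contributions of [e],
    which are the same at both ends because [e] is not a loop. *)
Lemma even_merge (S J : finType) (s t : H -> S) (l r : H -> J) D e :
  (forall v i, ~~ odd (incid_sum s t l r D v i)) -> e \in D -> s e != t e ->
  forall v i, ~~ odd (incid_sum (merge (s e) (t e) \o s) (merge (s e) (t e) \o t)
                        l r (D :\ e) v i).
Proof.
move=> ev eD nst v i; set m := merge _ _.
have mE z : (m z == t e) = false.
  rewrite /m /merge; case: (eqVneq z (t e)) => [_|/negbTE //].
  exact: negbTE.
case: (eqVneq v (t e)) => [->|nvt].
  by rewrite /incid_sum big1 // => f _; rewrite /incid /= !mE.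
have m2 z : (m z == s e) = (z == s e) + (z == t e) :> nat.
  rewrite /m /merge; case: (eqVneq z (t e)) => [->|_].
    by rewrite eqxx eq_sym (negbTE nst).
  by rewrite addn0.
case: (eqVneq v (s e)) => [->|nvs].
  have -> : incid_sum (m \o s) (m \o t) l r (D :\ e) (s e) i =
      incid_sum s t l r (D :\ e) (s e) i + incid_sum s t l r (D :\ e) (t e) i.
    rewrite /incid_sum -big_split /=; apply: eq_bigr => f _.
    by rewrite -mulnDl /incid /= !m2 addnACA.
  have := ev (s e) i; have := ev (t e) i; rewrite !(incid_sumD1 _ _ _ _ _ _ eD) !oddD.
  rewrite /incid !eqxx [t e == s e]eq_sym (negbTE nst) add0n addn0.
  by case: (odd (1 * _)) => /=; case: (odd (incid_sum _ _ _ _ _ _ _));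
    case: (odd (incid_sum _ _ _ _ _ _ _)).
have -> : incid_sum (m \o s) (m \o t) l r (D :\ e) v i = incid_sum s t l r D v i.
  have iv : incid s t v e = 0.
    by rewrite /incid !(eq_sym _ v) (negbTE nvs) (negbTE nvt).
  rewrite (incid_sumD1 _ _ _ _ _ _ eD) iv mul0n add0n.
  apply: eq_bigr => f _; congr (_ * _); rewrite /incid /=.
  have mv z : (m z == v) = (z == v).
    rewrite /m /merge; case: (eqVneq z (t e)) => [->|//].
    by rewrite !(eq_sym _ v) (negbTE nvs) (negbTE nvt).
  by rewrite !mv.
exact: ev.
Qed.

Lemma card_merge (S : finType) (A : {set S}) x y : #|A| <= #|merge x y @: A|.+1.
Proof.
apply: leq_trans (_ : #|y |: merge x y @: A| <= _).
  apply/subset_leq_card/subsetP => z zA; rewrite inE in_set1.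
  case: (eqVneq z y) => //= zy; apply/imsetP; exists z => //.
  by rewrite /merge (negbTE zy).
by rewrite cardsU1; case: (_ \notin _).
Qed.

Lemma merge_eq (S : finType) (x y : S) : merge x y x = merge x y y.
Proof. by rewrite /merge eqxx; case: eqP. Qed.

(** The dual stays connected: otherwise [e] alone would leave some set [K] of faces. Summing the
    even numbers at the vertex [s e] over [K], every other edge contributes an even amount and [e]
    an odd one. *)
Lemma plane_map_contract (S J : finType) (s t : H -> S) (l r : H -> J) D A B e :
  plane_map s t l r D A B -> e \in D -> s e != t e ->
  plane_map (merge (s e) (t e) \o s) (merge (s e) (t e) \o t) l r (D :\ e)
    (merge (s e) (t e) @: A) B.
Proof.
case=> ev du en si eu eD nst; split.
- exact: even_merge.
- move=> K n1 n2; apply: NNPP => nof.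
  have same f : f \in D -> f != e -> (l f \in K) = (r f \in K).
    move=> fD fe; apply/eqP/negPn/negP => ne; apply: nof; exists f => //.
    by rewrite !inE fe.
  have [f fD nef] := du K n1 n2.
  have ef : f = e by apply/eqP/negPn/negP => /(same f fD) fe; rewrite fe eqxx in nef.
  rewrite {}ef in nef fD.
  have : ~~ odd (\sum_(i in K) incid_sum s t l r D (s e) i).
    elim/big_ind: _ => [//|x y /negbTE ox /negbTE oy|i _]; last exact: ev.
    by rewrite oddD ox oy.
  apply/negP; rewrite negbK exchange_big /=.
  have aux x : \sum_(i in K) (x == i) = (x \in K).
    case: (boolP (x \in K)) => xK; last first.
      by rewrite big1 // => i iK; case: eqP => // xi; rewrite xi iK in xK.
    rewrite (bigD1 x) //= eqxx big1 // => i /andP[_].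
    by rewrite eq_sym => /negbTE->.
  have eq2 g : \sum_(i in K) incid s t (s e) g * incid l r i g =
      incid s t (s e) g * ((l g \in K) + (r g \in K)).
    by rewrite -big_distrr /= big_split /= !aux.
  rewrite (eq_bigr _ (fun g _ => eq2 g)) (bigD1 e) //= oddD.
  rewrite {1}/incid eqxx [t e == s e]eq_sym (negbTE nst) addn0 mul1n.
  have -> : odd ((l e \in K) + (r e \in K)).
    by move: nef; case: (l e \in K); case: (r e \in K).
  rewrite addTb; elim/big_ind: _ => [//|x y ox oy|g /andP[grid_edges ge]].
    by rewrite oddD; case: (odd x) ox; case: (odd y) oy.
  by rewrite (same g) // oddM addnn odd_double andbF.
- move=> f; rewrite inE => /andP[_ /en/andP[sA tA]].
  by rewrite /= !imset_f.
- by move=> f; rewrite inE => /andP[_ /si].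
- have := card_merge A (s e) (t e); have := cardsD1 e D; rewrite eD; lia.
Qed.

(** If [e] has one face on both sides, the faces stay as they are and Euler's inequality only gains
    room. Otherwise its two faces merge, and evenness is [even_merge] with vertices and faces
    exchanged. *)
Lemma plane_map_delete (S J : finType) (s t : H -> S) (l r : H -> J) D A B e :
  plane_map s t l r D A B -> e \in D ->
  exists (l' r' : H -> J) B', plane_map s t l' r' (D :\ e) A B'.
Proof.
case=> ev du en si eu eD; case: (eqVneq (l e) (r e)) => nlr.
  exists l, r, B; split.
  - move=> v i; have := ev v i; rewrite (incid_sumD1 _ _ _ _ _ _ eD) oddD.
    by rewrite {2}/incid nlr addnn oddM odd_double andbF.
  - move=> K n1 n2; have [f fD nf] := du K n1 n2; exists f => //.
    by rewrite !inE fD andbT; apply: contraNneq nf => ->; rewrite nlr.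
  - by move=> f; rewrite inE => /andP[_ /en].
  - by move=> f; rewrite inE => /andP[_ /si].
  - by have := cardsD1 e D; rewrite eD; lia.
set m := merge (l e) (r e).
exists (m \o l), (m \o r), (m @: B); split.
- move=> v i; rewrite incid_sumC; apply: even_merge => // w j.
  by rewrite incid_sumC.
- move=> K n1 n2; have [||f fD nf] := du [set i | m i \in K].
  + case/set0Pn: n1 => i; rewrite inE => /andP[/imsetP[j jB ->] jK].
    by apply/set0Pn; exists j; rewrite !inE jB.
  + case/set0Pn: n2 => i; rewrite inE => /andP[jK /imsetP[j jB ej]].
    by apply/set0Pn; exists j; rewrite !inE jB -ej jK.
  exists f; last by move: nf; rewrite !inE.
  rewrite !inE fD andbT; apply: contraNneq nf => ->.
  by rewrite !inE /m merge_eq.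
- by move=> f; rewrite inE => /andP[_ /en].
- by move=> f; rewrite inE => /andP[_ /si /andP[lB rB]]; rewrite /= !imset_f.
- by have := card_merge B (l e) (r e); have := cardsD1 e D; rewrite -/m eD; move: eu;
  clear; lia.
Qed.

Lemma plane_map_restrict (S J : finType) (s t : H -> S) (l r : H -> J) D A B D0 :
  plane_map s t l r D A B -> D0 \subset D ->
  exists (l' r' : H -> J) B', plane_map s t l' r' D0 A B'.
Proof.
have [k] := ubnP #|D :\: D0|; elim: k => // k IH in l r D B *.
rewrite ltnS => kD pm sD; have [/eqP e0|[e]] := set_0Vmem (D :\: D0).
  rewrite setD_eq0 in e0; have -> : D0 = D by apply/eqP; rewrite eqEsubset sD.
  by exists l, r, B.
rewrite inE => /andP[eD0 eD].
have [l' [r' [B' pm']]] := plane_map_delete pm eD.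
apply: IH pm' _; last by rewrite subsetD1 sD.
apply: leq_trans kD; apply: proper_card; apply/properP; split.
  by apply: setSD; apply: subD1set.
by exists e; rewrite !inE ?eD ?eD0 ?eqxx.
Qed.

Definition fiber (S V : finType) (p : S -> V) (A : {set S}) v :=
  [set x in A | p x == v].

(** Edges inside the fibres of [p] are contracted one at a time until [p] is injective on the
    remaining vertices. Only edges within a fibre are consumed, so those between different fibres
    survive. *)
Lemma plane_map_quotient (S J V : finType) (s t : H -> S) (l r : H -> J) D A B
    (p : S -> V) : plane_map s t l r D A B ->
  (forall v (K : {set S}), fiber p A v :&: K != set0 ->
     fiber p A v :\: K != set0 ->
     exists2 e, e \in D & [/\ p (s e) = v, p (t e) = v &
                              (s e \in K) != (t e \in K)]) ->
  exists D' : {set H}, plane_map (p \o s) (p \o t) l r D' (p @: A) B /\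
    forall e, e \in D -> p (s e) != p (t e) -> e \in D'.
Proof.
have [k] := ubnP #|A|; elim: k => // k IH in s t D A *.
rewrite ltnS => kA pm C.
have [inj|ninj] := classic {in A &, injective p}.
  exists D; split=> //; case: pm => ev du en si eu; split=> //.
  - move=> v i; case: (boolP (v \in p @: A)) => [/imsetP[x xA ->]|nv].
      have -> : incid_sum (p \o s) (p \o t) l r D (p x) i = incid_sum s t l r D x i.
        apply: eq_bigr => e /en/andP[sA tA]; congr (_ * _).
        by rewrite /incid /= !(inj_in_eq inj).
      exact: ev.
    rewrite /incid_sum big1 // => e /en/andP[sA tA]; rewrite /incid /=.
    have nz z : z \in A -> (p z == v) = false.
      by move=> zA; apply: contraNF nv => /eqP<-; apply: imset_f.
    by rewrite !nz.
  - by move=> e /en/andP[sA tA]; rewrite /= !imset_f.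
  - by rewrite (card_in_imset inj).
have [x [y [xA yA pxy nxy]]] : exists x y, [/\ x \in A, y \in A, p x = p y & x <> y].
  apply: NNPP => no; apply: ninj => x y xA yA pxy; apply: NNPP => nxy.
  by apply: no; exists x, y.
have [||e eD [ps pt nst]] := C (p x) [set x].
- by apply/set0Pn; exists x; rewrite !inE xA !eqxx.
- by apply/set0Pn; exists y; rewrite !inE yA pxy eqxx !andbT; apply/eqP => yx;
  apply: nxy.
have nst' : s e != t e by apply: contraNneq nst => ->.
set m := merge (s e) (t e); have pm' := plane_map_contract pm eD nst'.
have pmE z : p (m z) = p z by rewrite /m /merge; case: eqP => // ->; rewrite ps pt.
have [||D' [pmD' kD']] := IH _ _ _ _ _ pm'.
- apply: leq_trans kA; apply: leq_trans (_ : #|A :\ t e| < _); last first.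
    by have /andP[_ tA] := pm_ends pm eD; rewrite (cardsD1 (t e) A) tA.
  rewrite ltnS; apply/subset_leq_card/subsetP => z /imsetP[z' zA ->].
  have /andP[sA _] := pm_ends pm eD.
  rewrite !inE /merge; case: (eqVneq z' (t e)) => [_|->] //; by rewrite nst'.
- move=> v K n1 n2; have [||f fD [fs ft nf]] := C v [set z | m z \in K].
  + case/set0Pn: n1 => z; rewrite !inE => /andP[/andP[/imsetP[z' zA ->] pz] zK].
    by apply/set0Pn; exists z'; rewrite !inE zA -pmE pz zK.
  + case/set0Pn: n2 => z; rewrite !inE => /andP[zK /andP[/imsetP[z' zA ez] pz]].
    by apply/set0Pn; exists z'; rewrite !inE zA -pmE -/m in ez *; rewrite -ez pz zK.
  exists f; last by rewrite /= !pmE; move: nf; rewrite !inE.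
  rewrite !inE fD andbT; apply: contraNneq nf => ->.
  by rewrite !inE /m merge_eq.
exists D'; split; last first.
  move=> f fD npf; apply: kD'; last by rewrite /= !pmE.
  rewrite !inE fD andbT; apply: contraNneq npf => ->.
  by rewrite ps pt.
have e1 : p \o (m \o s) = p \o s by apply: functional_extensionality => z;
  rewrite /= pmE.
have e2 : p \o (m \o t) = p \o t by apply: functional_extensionality => z;
  rewrite /= pmE.
have e3 : p @: (m @: A) = p @: A by rewrite -imset_comp; apply: eq_imset => z;
  rewrite /= pmE.
by move: pmD'; rewrite e1 e2 e3.
Qed.

End PlaneMap.

(** * Discharging *)

Section Discharge.
Variables (V J H : finType) (X : {set V}) (m : V -> V -> nat).
Variables (a b : H -> V) (l r : H -> J) (D : {set H}) (B : {set J}).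
Hypothesis n4 : 4 <= #|X|.
Hypothesis pm : plane_map a b l r D X B.
Hypothesis msym : forall u v, m u v = m v u.
Hypothesis ends_neq : forall e, e \in D -> a e != b e.
Let ends e := [set a e; b e].
Hypothesis ends_inj : {in D &, injective ends}.
Hypothesis mpos : forall e, e \in D -> 0 < m (a e) (b e).
Hypothesis mD : forall u v, u \in X -> v \in X -> u != v -> 0 < m u v ->
  exists2 e, e \in D & ends e = [set u; v].
Hypothesis m3 : forall u v, u \in X -> v \in X -> u != v -> m u v <= 3.
Hypothesis tri3 : forall x y z, x \in X -> y \in X -> z \in X ->
  x != y -> y != z -> x != z -> 0 < m x y -> 0 < m y z -> m x z <= 2.
Hypothesis cycle3333 : forall x y z u, uniq [:: x; y; z; u] ->
  [set x; y; z; u] \subset X -> 3 <= m x y -> 3 <= m y z -> 3 <= m z u ->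
  3 <= m u x -> False.
Hypothesis cycle2333 : forall x y u v z, uniq [:: x; y; u; v] ->
  [set x; y; u; v] \subset X -> z \in X -> z \notin [set x; y; u; v] ->
  2 <= m x y -> 3 <= m y u -> 3 <= m u v -> 3 <= m v x ->
  0 < m x z -> 0 < m z y -> False.
Hypothesis double222 : forall x y z w w', uniq [:: x; y; z; w; w'] ->
  {subset [:: x; y; z; w; w'] <= X} -> m x y = 2 -> m y z = 2 -> m x z = 2 ->
  0 < m x w -> 0 < m w y -> 0 < m x w' -> 0 < m w' z -> False.
Hypothesis k4 : forall x y z u, uniq [:: x; y; z; u] ->
  [set x; y; z; u] \subset X -> 2 <= m x y -> 2 <= m x z -> 2 <= m x u ->
  2 <= m y z -> 2 <= m y u -> 2 <= m z u -> False.
Hypothesis total : 11 * #|X| <= 2 * \sum_(e in D) m (a e) (b e) + 19.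

Let me e := m (a e) (b e).
(** Edges with [i] on both sides are left out; by [pm_even] the remaining boundary is an even
    subgraph. *)
Definition face i := [set e in D | (l e == i) != (r e == i)].

Lemma ends_sub e : e \in D -> ends e \subset X.
Proof.
by move=> /(pm_ends pm)/andP[aX bX]; apply/subsetP => v /set2P[]->.
Qed.

Lemma me_ends e u v : ends e = [set u; v] -> me e = m u v.
Proof.
move/eqP; rewrite eq_set2 => /orP[]/andP[/eqP au /eqP bv].
  by rewrite /me au bv.
by rewrite /me au bv msym.
Qed.

Lemma me_bounds e : e \in D -> 0 < me e <= 3.
Proof.
move=> eD; rewrite mpos //=; have /andP[aX bX] := pm_ends pm eD.
by apply: m3 => //; apply: ends_neq.
Qed.

Lemma ends_other e v : e \in D -> v \in ends e ->
  exists w, [/\ ends e = [set v; w], v != w, v \in X & w \in X].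
Proof.
move=> eD; have /andP[aX bX] := pm_ends pm eD; have := ends_neq eD => nab.
move=> /set2P[->|->]; first by exists (b e).
by exists (a e); rewrite eq_sym; split=> //; apply: setUC.
Qed.

(** A vertex of an even subgraph never has degree 1. *)
Lemma face_next i e v : e \in face i -> v \in ends e ->
  exists f, [/\ f \in face i, f != e & v \in ends f].
Proof.
move=> eF ve; apply: NNPP => no.
have eD : e \in D by move: eF; rewrite inE => /andP[].
have := pm_even pm v i; rewrite (incid_sumD1 _ _ _ _ _ _ eD) oddD.
have -> : odd (incid a b v e * incid l r i e).
  rewrite oddM /incid; move: eF; rewrite inE => /andP[_].
  have := ends_neq eD; case/set2P: ve => ->; rewrite eqxx.
    by rewrite eq_sym => /negbTE->; case: (_ == i); case: (_ == i).
  by move=> /negbTE->; case: (_ == i); case: (_ == i).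
rewrite addTb negbK /incid_sum; apply/negP.
elim/big_ind: _ => [//|x y ox oy|f].
  by rewrite oddD; case: (odd x) ox; case: (odd y) oy.
rewrite !inE => /andP[fe fD]; rewrite oddM negb_and /incid.
case: (boolP (f \in face i)) => fF.
  have : v \notin ends f by apply/negP => vf; apply: no; exists f.
  by rewrite !inE negb_or ![v == _]eq_sym => /andP[/negbTE-> /negbTE->].
move: fF; rewrite inE fD /= negbK => /eqP->.
by rewrite addnn odd_double orbT.
Qed.

Lemma endsP e f u v : e \in D -> f \in D -> ends e = [set u; v] ->
  u \in ends f -> v \in ends f -> u != v -> e = f.
Proof.
move=> eD fD ee uf vf uv; apply: ends_inj => //; rewrite ee.
apply/eqP; rewrite eqEcard !cards2 uv.
by rewrite (ends_neq fD) leqnn andbT; apply/subsetP => w /set2P[]->.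
Qed.

Lemma faceD i e : e \in face i -> e \in D.
Proof. by rewrite inE => /andP[]. Qed.

(** A nonempty even subgraph of a simple graph with at most 4 edges is a triangle or a 4-cycle.
    Following the boundary with [face_next], the first three edges are distinct by simplicity, and
    the walk then closes at once or with a fourth edge. *)
Lemma face_shape i : face i != set0 ->
  [\/ 5 <= #|face i|,
      exists x y z h1 h2 h3, [/\ uniq [:: x; y; z] /\ uniq [:: h1; h2; h3],
        face i = [set h1; h2; h3], ends h1 = [set x; y],
        ends h2 = [set y; z] & ends h3 = [set z; x]]
    | exists x y z u h1 h2 h3 h4,
       [/\ uniq [:: x; y; z; u] /\ uniq [:: h1; h2; h3; h4],
         face i = h4 |: [set h1; h2; h3],
         ends h1 = [set x; y] /\ ends h2 = [set y; z],
         ends h3 = [set z; u] & ends h4 = [set u; x]]].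
Proof.
move=> /set0Pn[h1 f1]; case: (leqP 5 #|face i|) => [?|F4]; first by constructor 1.
have d1 := faceD f1.
have [y [e1 xy xX yX]] := ends_other d1 (set21 (a h1) (b h1)).
set x := a h1 in e1 xy xX.
have [h2 [f2 n21 y2]] : exists f, [/\ f \in face i, f != h1 & y \in ends f].
  by apply: face_next => //; rewrite e1 set22.
have d2 := faceD f2; have [z [e2 yz _ zX]] := ends_other d2 y2.
have xz : x != z.
  apply: contraNneq n21 => xz; apply/eqP; apply: (endsP d2 d1 e2) => //.
    by rewrite e1 set22.
  by rewrite -xz e1 set21.
have [h3 [f3 n32 z3]] : exists f, [/\ f \in face i, f != h2 & z \in ends f].
  by apply: face_next => //; rewrite e2 set22.
have d3 := faceD f3; have [u [e3 zu _ uX]] := ends_other d3 z3.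
have yu : y != u.
  apply: contraNneq n32 => yu; apply/eqP; apply: (endsP d3 d2 e3) => //.
    by rewrite e2 set22.
  by rewrite -yu e2 set21.
have n31 : h3 != h1.
  apply: contraTneq z3 => ->; rewrite e1 !inE negb_or [z == x]eq_sym xz.
  by rewrite eq_sym.
have s3 : [set h1; h2; h3] \subset face i.
  by apply/subsetP => h; rewrite in_setU in_set2 in_set1 => /orP[/orP[]|]/eqP->.
have c3 : #|[set h1; h2; h3]| = 3.
  by rewrite setUC cardsU1 cards2 !inE negb_or n31 n32 eq_sym n21.
case: (eqVneq u x) => [ux|nux].
  constructor 2; exists x, y, z, h1, h2, h3.
  have U3 : uniq [:: x; y; z] by rewrite /= !inE !negb_or xy xz yz.
  have UH : uniq [:: h1; h2; h3].
    by rewrite /= !inE !negb_or (eq_sym h1) n21 (eq_sym h1) n31 (eq_sym h2) n32.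
  have e3' : ends h3 = [set z; x] by rewrite e3 ux.
  suff eF : face i = [set h1; h2; h3] by split.
  (* With at most 4 edges in the face, an extra edge [h] could continue at each end only along the
     triangle. Then both its ends are corners and simplicity identifies it with a side. *)
  apply/esym/eqP; rewrite eqEsubset s3 /=; apply/subsetP => h hF.
  apply/negPn/negP => hT; have hD := faceD hF.
  have inT v : v \in ends h -> v \in [set x; y; z].
    move=> vh; have [g [gF gh vg]] := face_next hF vh.
    have gT : g \in [set h1; h2; h3].
      apply/negPn/negP => gT; move: F4; rewrite ltnNge => /negP; apply.
      apply: leq_trans (_ : #|h |: (g |: [set h1; h2; h3])| <= _); last first.
        apply/subset_leq_card/subsetP => k /setU1P[->//|/setU1P[->//|]].
        exact: (subsetP s3).
      rewrite !cardsU1 c3 gT in_setU1 negb_or hT.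
      by rewrite eq_sym gh.
    move: gT; rewrite in_setU in_set2 in_set1 => /orP[/orP[]|]/eqP eg;
      move: vg; rewrite eg ?e1 ?e2 ?e3 ?ux !inE => /orP[]->; by rewrite ?orbT.
  have ha : a h \in ends h by rewrite set21.
  have [w [eh vw _ _]] := ends_other hD ha.
  have hb : w \in ends h by rewrite eh set22.
  have a1 := inT _ ha; have a2 := inT _ hb.
  have [g [gT ag wg]] : exists g, [/\ g \in [set h1; h2;
    h3], a h \in ends g & w \in ends g].
    move: a1 a2 vw; rewrite !inE -!orbA => /or3P[]/eqP-> /or3P[]/eqP->;
      rewrite ?eqxx // => _.
    + by exists h1; rewrite e1 !set21 !set22; split=> //;
      rewrite in_setU in_set2 in_set1 eqxx ?orbT.
    + by exists h3; rewrite e3 ux !set21 !set22; split=> //;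
      rewrite in_setU in_set2 in_set1 eqxx ?orbT.
    + by exists h1; rewrite e1 !set21 !set22; split=> //;
      rewrite in_setU in_set2 in_set1 eqxx ?orbT.
    + by exists h2; rewrite e2 !set21 !set22; split=> //;
      rewrite in_setU in_set2 in_set1 eqxx ?orbT.
    + by exists h3; rewrite e3 ux !set21 !set22; split=> //;
      rewrite in_setU in_set2 in_set1 eqxx ?orbT.
    + by exists h2; rewrite e2 !set21 !set22; split=> //;
      rewrite in_setU in_set2 in_set1 eqxx ?orbT.
  have hg : h = g by apply: (endsP hD (faceD (subsetP s3 _ gT)) eh).
  by rewrite hg gT in hT.
have [h4 [f4 n43 u4]] : exists f, [/\ f \in face i, f != h3 & u \in ends f].
  by apply: face_next => //; rewrite e3 set22.
have d4 := faceD f4; have [w [e4 uw _ wX]] := ends_other d4 u4.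
have n41 : h4 != h1.
  apply: contraTneq u4 => ->; rewrite e1 !inE negb_or nux eq_sym.
  by rewrite yu.
have n42 : h4 != h2.
  apply: contraTneq u4 => ->; rewrite e2 !inE negb_or eq_sym yu eq_sym.
  by rewrite zu.
have n4T : h4 \notin [set h1; h2; h3] by rewrite !inE !negb_or n41 n42.
have eF : face i = h4 |: [set h1; h2; h3].
  apply/esym/eqP; rewrite eqEcard; apply/andP; split.
    by apply/subsetP => h /setU1P[->//|]; apply: (subsetP s3).
  by rewrite cardsU1 n4T c3.
have x1 : x \in ends h1 by rewrite e1 set21.
have [g [gF g1 xg]] := face_next f1 x1.
have x4 : x \in ends h4.
  move: gF xg; rewrite eF => /setU1P[->//|].
  rewrite in_setU in_set2 in_set1 (negbTE g1) /= => /orP[]/eqP->; rewrite ?e2 ?e3 !inE.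
    by rewrite (negbTE xy) (negbTE xz).
  by rewrite (negbTE xz) eq_sym (negbTE nux).
have wx : w = x.
  move: x4; rewrite e4 !inE eq_sym (negbTE nux) /=.
  by move/eqP.
have U4 : uniq [:: x; y; z; u].
  by rewrite /= !inE !negb_or xy xz yz yu zu (eq_sym x) nux.
have UH : uniq [:: h1; h2; h3; h4].
  rewrite /= !inE !negb_or (eq_sym h1) n21 (eq_sym h1) n31 (eq_sym h1) n41.
  by rewrite (eq_sym h2) n32 (eq_sym h2) n42 (eq_sym h3) n43.
have e4' : ends h4 = [set u; x] by rewrite e4 wx.
by constructor 3; exists x, y, z, u, h1, h2, h3, h4.
Qed.

Lemma face_in_X i e v : e \in face i -> v \in ends e -> v \in X.
Proof. by move=> /faceD/ends_sub/subsetP; apply. Qed.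

Lemma sum_face3 (g : H -> nat) h1 h2 h3 : uniq [:: h1; h2; h3] ->
  \sum_(e in [set h1; h2; h3]) g e = g h1 + g h2 + g h3.
Proof.
rewrite /= !inE negb_or andbT => /andP[/andP[n12 n13] n23].
rewrite setUC big_setU1 ?inE ?negb_or ?(eq_sym h3) ?n13 ?n23 //=.
by rewrite big_setU1 ?inE //= big_set1; lia.
Qed.

Lemma sum_face4 (g : H -> nat) h1 h2 h3 h4 : uniq [:: h1; h2; h3; h4] ->
  \sum_(e in h4 |: [set h1; h2; h3]) g e = g h1 + g h2 + g h3 + g h4.
Proof.
move=> U; have := U; rewrite (cat_uniq [:: h1; h2; h3] [:: h4]) => /and3P[U3 n4' _].
rewrite big_setU1 /=; last first.
  by move: n4'; rewrite /= !inE !orbF orbA.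
by rewrite sum_face3 // addnC.
Qed.

(** Multiplicities at most 3 and [total] force many edges, hence many faces. The bound guarantees
    that one or two faces never exhaust [B], so dual connectivity yields an edge leaving them. *)
Lemma B_ge3 : 3 <= #|B|.
Proof.
have M3 : \sum_(e in D) m (a e) (b e) <= 3 * #|D|.
  rewrite -sum1_card big_distrr /=; apply: leq_sum => e eD.
  by rewrite muln1; have /andP[] := me_bounds eD.
have := pm_euler pm; move: M3 total n4; clear; lia.
Qed.

Lemma face_neq0 i : i \in B -> face i != set0.
Proof.
move=> iB; have [||e eD ne] := @pm_dual _ _ _ _ _ _ _ _ _ _ pm [set i].
- by apply/set0Pn; exists i; rewrite !inE iB eqxx.
- rewrite -card_gt0 cardsD subn_gt0.
  apply: leq_ltn_trans (subset_leq_card (subsetIr B [set i])) _.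
  by rewrite cards1; apply: leq_trans B_ge3.
by apply/set0Pn; exists e; rewrite inE eD; move: ne; rewrite !inE.
Qed.

(** A dual edge leaving [{i, j}] has one side there and one elsewhere, so it lies on exactly one of
    the two boundaries. *)
Lemma face_inj : {in B &, injective face}.
Proof.
move=> i j iB jB /setP eF; apply/eqP/negPn/negP => nij.
have [||e eD ne] := @pm_dual _ _ _ _ _ _ _ _ _ _ pm [set i; j].
- by apply/set0Pn; exists i; rewrite !inE iB eqxx.
- rewrite -card_gt0 cardsD subn_gt0.
  apply: leq_ltn_trans (subset_leq_card (subsetIr B [set i; j])) _.
  by rewrite cards2 nij; apply: B_ge3.
have := eF e; rewrite !inE eD /=; move: ne; rewrite !inE.
have ex k : ~~ ((k == i) && (k == j)).
  by apply/negP => /andP[/eqP-> ij]; rewrite ij in nij.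
by move: (ex (l e)) (ex (r e)); case: (l e == i); case: (l e == j);
  case: (r e == i); case: (r e == j).
Qed.

Lemma side_count e : e \in D -> \sum_(i in B) (e \in face i) <= 2.
Proof.
move=> eD; have /andP[lB rB] := pm_sides pm eD.
have aux x : \sum_(i in B) (x == i : nat) <= 1.
  case: (boolP (x \in B)) => xB.
    by rewrite (bigD1 x) //= eqxx big1 // => i /andP[_]; rewrite eq_sym => /negbTE->.
  by rewrite big1 // => i iB; case: eqP => // xi; rewrite xi iB in xB.
apply: leq_trans (_ : \sum_(i in B) ((l e == i) + (r e == i)) <= _).
  by apply: leq_sum => i _; rewrite inE eD /=; case: (l e == i); case: (r e == i).
by rewrite big_split /=; apply: (leq_add (aux _) (aux _)).
Qed.

Lemma other_side e j : e \in face j ->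
  exists j', [/\ j' \in B, j' != j & e \in face j'].
Proof.
move=> eF; have eD := faceD eF; have /andP[lB rB] := pm_sides pm eD.
move: eF; rewrite inE eD /=.
case: (eqVneq (l e) j) => lj; case: (eqVneq (r e) j) => rj // _.
  by exists (r e); split=> //; rewrite inE eD lj eqxx [j == _]eq_sym (negbTE rj).
by exists (l e); split=> //; rewrite inE eD rj eqxx [j == _]eq_sym (negbTE lj).
Qed.

(* The only faces with negative charge: each receives half a unit across at least
   two of its edges. *)
Definition T222 i := [exists S : {set V}, [&& #|S| == 3, S \subset X,
  [forall u in S, forall v in S, (u != v) ==> (m u v == 2)]
  & face i == [set e in D | ends e \subset S]]].

Lemma T222P i : T222 i -> exists S : {set V}, [/\ #|S| = 3, S \subset X,
  {in S &, forall u v, u != v -> m u v = 2}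
  & face i = [set e in D | ends e \subset S]].
Proof.
move=> /existsP[S /and4P[/eqP S3 SX /forall_inP HS /eqP eF]]; exists S; split=> //.
by move=> u v uS vS uv; have /forall_inP/(_ v vS)/implyP/(_ uv)/eqP := HS u uS.
Qed.

Definition inT e := [exists i in B, T222 i && (e \in face i)].

Lemma third_vertex (S : {set V}) x y : #|S| = 3 -> x \in S -> y \in S -> x != y ->
  exists z, [/\ z \in S, x != z, y != z & S = [set x; y; z]].
Proof.
move=> S3 xS yS xy; have [z] : exists z, z \in S :\: [set x; y].
  by apply/set0Pn; rewrite -card_gt0 cardsDS ?cards2 ?xy ?S3 //;
    apply/subsetP => v /set2P[]->.
rewrite !inE negb_or => /andP[/andP[zx zy] zS].
exists z; split; rewrite // 1?eq_sym //.
apply/esym/eqP; rewrite eqEcard S3; apply/andP; split.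
  by apply/subsetP => v; rewrite !inE => /orP[/orP[]|]/eqP->.
by rewrite setUC cardsU1 cards2 !inE negb_or xy zx zy.
Qed.

Lemma inT_nbr e u v : inT e -> ends e = [set u; v] -> u != v ->
  [/\ m u v = 2 & exists w, [/\ w \in X, u != w, v != w, m u w = 2 & m w v = 2]].
Proof.
move=> /exists_inP[i iB /andP[/T222P[S [S3 SX S2 eF]]]];
  rewrite eF inE => /andP[eD eS] ee uv.
have uS : u \in S by apply: (subsetP eS); rewrite ee set21.
have vS : v \in S by apply: (subsetP eS); rewrite ee set22.
split; first exact: S2.
have [w [wS uw vw _]] := third_vertex S3 uS vS uv.
by exists w; split; rewrite ?(subsetP SX) ?S2 // eq_sym.
Qed.

Lemma inT_me e : e \in D -> inT e -> me e = 2.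
Proof. by move=> eD eT; have [] := inT_nbr eT (erefl _) (ends_neq eD). Qed.

Lemma face_ge3 i : i \in B -> 3 <= #|face i|.
Proof.
move=> iB; case: (face_shape (face_neq0 iB)).
- by apply: leq_trans.
- move=> [x [y [z [h1 [h2 [h3 [[_ U] -> _ _ _]]]]]]].
  by rewrite -sum1_card sum_face3.
move=> [x [y [z [u [h1 [h2 [h3 [h4 [[_ U] -> _ _ _]]]]]]]]].
by rewrite -sum1_card sum_face4.
Qed.

(* The charge of a face is the sum of 11 - 2 me over its edges, minus 22; it is
   doubled here because of the transfer of halves. *)
Lemma chargeT i : i \in B -> T222 i -> 42 <= 2 * \sum_(e in face i) (11 - 2 * me e).
Proof.
move=> iB iT; rewrite (eq_bigr (fun=> 7)); last first.
  move=> e eF; rewrite inT_me ?(faceD eF) //.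
  by apply/exists_inP; exists i => //; rewrite iT.
by rewrite sum_nat_const; have := face_ge3 iB; lia.
Qed.

Lemma tri_edge (x y z : V) h1 h2 h3 e : h1 \in D -> h2 \in D -> h3 \in D ->
  ends h1 = [set x; y] -> ends h2 = [set y; z] -> ends h3 = [set z; x] ->
  e \in D -> ends e \subset [set x; y; z] -> e \in [set h1; h2; h3].
Proof.
move=> d1 d2 d3 e1 e2 e3 eD /subsetP sub.
have ha := sub _ (set21 _ _); have hb := sub _ (set22 _ _).
have key h : h \in D -> a e \in ends h -> b e \in ends h -> e = h.
  by move=> hD ah bh; apply: (endsP eD hD (erefl _)) => //; apply: ends_neq.
have nab := ends_neq eD.
suff : [|| (a e \in ends h1) && (b e \in ends h1),
           (a e \in ends h2) && (b e \in ends h2)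
         | (a e \in ends h3) && (b e \in ends h3)].
  rewrite in_setU in_set2 in_set1.
  by move=> /or3P[]/andP[ah bh]; rewrite -(key _ _ ah bh) ?eqxx ?orbT.
rewrite e1 e2 e3; move: ha hb nab; rewrite !inE.
move=> /orP[/orP[]|]/eqP-> /orP[/orP[]|]/eqP->; rewrite ?eqxx ?orbT //=.
Qed.

(** The third vertex [w] of the 2, 2, 2 triangle at [xy] either lies on the cycle, making an edge of
    multiplicity 3 part of a triangle, or lies outside, as [cycle2333] forbids. *)
Lemma cycle_inT (x y z u : V) e : uniq [:: x; y; z; u] ->
  {subset [:: x; y; z; u] <= X} -> ends e = [set x; y] -> inT e ->
  m y z = 3 -> m z u = 3 -> m u x = 3 -> False.
Proof.
move=> U sX ee eT m1 m2 m4.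
have [xX yX zX uX] : [/\ x \in X, y \in X, z \in X & u \in X].
  by split; apply: sX; rewrite !inE eqxx ?orbT.
have := U; rewrite /= !inE !negb_or => /and4P[/and3P[xy xz xu] /andP[yz yu] zu _].
have [mxy [w [wX xw yw mxw mwy]]] := inT_nbr eT ee xy.
case: (eqVneq w z) => [wz|nwz].
  have := @tri3 y x z yX xX zX; rewrite eq_sym xy xz yz [m y x]msym mxy m1.
  by rewrite -wz mxw; do ![move/(_ isT)].
case: (eqVneq w u) => [wu|nwu].
  have := @tri3 x y u xX yX uX; rewrite xy yu xu mxy [m x u]msym m4 -wu [m y w]msym mwy.
  by do ![move/(_ isT)].
apply: (cycle2333 (z := w) U); rewrite ?mxy ?m1 ?m2 ?m4 ?mxw ?mwy //.
  by apply/subsetP => v; rewrite !inE => /orP[/orP[/orP[]|]|]/eqP->.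
by rewrite !inE !negb_or ![w == _]eq_sym xw yw [z == w]eq_sym nwz [u == w]eq_sym nwu.
Qed.

(** The face can pay half a unit across each edge shared with a 2, 2, 2 triangle. From 5 edges on,
    the weights 5, and 7 on paying edges, suffice. A triangle has weight at least [7 + 7 + 9 = 23]
    and at most two paying edges. A 4-cycle with total multiplicity 11 has weight 22 but no paying
    edge by [cycle_inT]; with total at most 10 it has weight at least 24. *)
Lemma charge i : i \in B -> ~~ T222 i ->
  44 + \sum_(e in face i) inT e <= 2 * \sum_(e in face i) (11 - 2 * me e).
Proof.
move=> iB nT; case: (face_shape (face_neq0 iB)).
- move=> F5; apply: leq_trans (_ : \sum_(e in face i) (10 + inT e) <= _).
    by rewrite big_split /= sum_nat_const leq_add2r; lia.
  rewrite big_distrr /=; apply: leq_sum => e eF; have eD := faceD eF.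
  have /andP[_ mb] := me_bounds eD; case: (boolP (inT e)) => [/(inT_me eD)->|_] //.
  by move: mb; clear; lia.
- move=> [x [y [z [h1 [h2 [h3 [[U UH] eF e1 e2 e3]]]]]]].
  have := U; rewrite /= !inE !negb_or andbT => /andP[/andP[xy xz] yz].
  have [f1 f2 f3] : [/\ h1 \in face i, h2 \in face i & h3 \in face i].
    by rewrite eF; split; rewrite in_setU in_set2 in_set1 eqxx ?orbT.
  have [d1 d2 d3] := And3 (faceD f1) (faceD f2) (faceD f3).
  have xX : x \in X by apply: (face_in_X f1); rewrite e1 set21.
  have yX : y \in X by apply: (face_in_X f1); rewrite e1 set22.
  have zX : z \in X by apply: (face_in_X f2); rewrite e2 set22.
  have [/andP[p1 _] /andP[p2 _] /andP[p3 _]] := And3 (me_bounds d1) (me_bounds d2)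
    (me_bounds d3).
  have m1 := me_ends e1; have m2 := me_ends e2; have m3' := me_ends e3.
  rewrite eF !sum_face3 //.
  have q1 : me h1 <= 2.
    by rewrite m1; apply: (@tri3 x z y); rewrite // 1?eq_sym // msym -?m2 -?m3'.
  have q2 : me h2 <= 2.
    by rewrite m2; apply: (@tri3 y x z); rewrite // 1?eq_sym // msym -?m1 -?m3'.
  have q3 : me h3 <= 2.
    by rewrite m3' msym; apply: (@tri3 x y z); rewrite // -?m1 -?m2.
  have not222 : ~ (me h1 = 2 /\ me h2 = 2 /\ me h3 = 2).
    move=> [v1 [v2 v3]]; move/negP: nT; apply; apply/existsP; exists [set x; y; z].
    apply/and4P; split.
    + by rewrite setUC cardsU1 cards2 !inE negb_or xy (eq_sym z) xz (eq_sym z) yz.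
    + by apply/subsetP => v; rewrite !inE => /orP[/orP[]|]/eqP->.
    + apply/forall_inP => u1; rewrite !inE -orbA => uS; apply/forall_inP => u2.
      rewrite !inE -orbA => vS; apply/implyP.
      move: uS vS => /or3P[]/eqP-> /or3P[]/eqP->; rewrite ?eqxx // => _; apply/eqP.
      * by rewrite -m1. * by rewrite msym -m3'. * by rewrite msym -m1.
      * by rewrite -m2. * by rewrite -m3'. * by rewrite msym -m2.
    apply/eqP/setP => e; apply/idP/idP => [eF'|].
      rewrite inE (faceD eF'); apply/subsetP => v.
      move: eF'; rewrite eF in_setU in_set2 in_set1 => /orP[/orP[]|]/eqP->;
      rewrite ?e1 ?e2 ?e3 !inE => /orP[]->; by rewrite ?orbT.
    rewrite inE => /andP[eD eS]; rewrite eF.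
    exact: (tri_edge d1 d2 d3 e1 e2 e3).
  have i1 : inT h1 -> me h1 = 2 := inT_me d1.
  have i2 : inT h2 -> me h2 = 2 := inT_me d2.
  have i3 : inT h3 -> me h3 = 2 := inT_me d3.
  move: p1 p2 p3 q1 q2 q3 not222 i1 i2 i3; clear.
  move: (me h1) (me h2) (me h3) => k1 k2 k3 p1 p2 p3 q1 q2 q3 n.
  case: (inT h1) => /= [/(_ isT) e1|_]; case: (inT h2) => /= [/(_ isT) e2|_];
  case: (inT h3) => /= [/(_ isT) e3|_]; lia.
move=> [x [y [z [u [h1 [h2 [h3 [h4 [[U UH] eF [e1 e2] e3 e4]]]]]]]]].
have f4 : h4 \in face i by rewrite eF setU11.
have [f1 f2 f3] : [/\ h1 \in face i, h2 \in face i & h3 \in face i].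
  by rewrite eF; split; rewrite in_setU in_setU in_set2 !in_set1 eqxx ?orbT.
have sX : {subset [:: x; y; z; u] <= X}.
  move=> v; rewrite !inE => /or4P[]/eqP->.
  - by apply: (face_in_X f1); rewrite e1 set21.
  - by apply: (face_in_X f1); rewrite e1 set22.
  - by apply: (face_in_X f2); rewrite e2 set22.
  - by apply: (face_in_X f3); rewrite e3 set22.
have [/andP[_ q1] /andP[_ q2] /andP[_ q3] /andP[_ q4]] :=
  And4 (me_bounds (faceD f1)) (me_bounds (faceD f2)) (me_bounds (faceD f3))
    (me_bounds (faceD f4)).
have m1 := me_ends e1; have m2 := me_ends e2; have m3' := me_ends e3;
  have m4 := me_ends e4.
rewrite eF !sum_face4 //.
have not3 : ~ (me h1 = 3 /\ me h2 = 3 /\ me h3 = 3 /\ me h4 = 3).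
  move=> [v1 [v2 [v3 v4]]]; apply: (cycle3333 U);
    rewrite -?m1 -?m2 -?m3' -?m4 ?v1 ?v2 ?v3 ?v4 //.
  by apply/subsetP => v; rewrite !inE -!orbA => vS; apply: sX; rewrite !inE.
have rotU (p : seq V) k : uniq p -> {subset p <= X} -> uniq (rot k p) /\ {subset rot
  k p <= X}.
  by move=> Up sp; rewrite rot_uniq; split=> // v; rewrite mem_rot; apply: sp.
have i1 : inT h1 -> me h1 = 2 /\ ~ (me h2 = 3 /\ me h3 = 3 /\ me h4 = 3).
  move=> hT; split; first exact: inT_me (faceD f1) hT.
  by rewrite m2 m3' m4 => -[v2 [v3 v4]]; apply: (cycle_inT U sX e1 hT).
have i2 : inT h2 -> me h2 = 2 /\ ~ (me h3 = 3 /\ me h4 = 3 /\ me h1 = 3).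
  move=> hT; split; first exact: inT_me (faceD f2) hT.
  have [U' sX'] := rotU _ 1 U sX.
  by rewrite m1 m3' m4 => -[v2 [v3 v4]]; apply: (cycle_inT U' sX' e2 hT).
have i3 : inT h3 -> me h3 = 2 /\ ~ (me h4 = 3 /\ me h1 = 3 /\ me h2 = 3).
  move=> hT; split; first exact: inT_me (faceD f3) hT.
  have [U' sX'] := rotU _ 2 U sX.
  by rewrite m1 m2 m4 => -[v2 [v3 v4]]; apply: (cycle_inT U' sX' e3 hT).
have i4 : inT h4 -> me h4 = 2 /\ ~ (me h1 = 3 /\ me h2 = 3 /\ me h3 = 3).
  move=> hT; split; first exact: inT_me (faceD f4) hT.
  have [U' sX'] := rotU _ 3 U sX.
  by rewrite m1 m2 m3' => -[v2 [v3 v4]]; apply: (cycle_inT U' sX' e4 hT).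
move: q1 q2 q3 q4 not3 i1 i2 i3 i4; clear.
move: (me h1) (me h2) (me h3) (me h4) => k1 k2 k3 k4 q1 q2 q3 q4 n i1 i2 i3 i4.
have [[[[b1 b2] b3] b4]|] : (((inT h1 = false /\ inT h2 = false) /\ inT h3 = false)
  /\ inT h4 = false) \/ k1 + k2 + k3 + k4 <= 10.
  move: i1 i2 i3 i4.
  case: (inT h1) => [/(_ isT) i1 _ _ _|_]; first by right; lia.
  case: (inT h2) => [/(_ isT) i1 _ _|_]; first by right; lia.
  case: (inT h3) => [/(_ isT) i1 _|_]; first by right; lia.
  case: (inT h4) => [/(_ isT) i1|_]; first by right; lia.
  by left.
- by rewrite b1 b2 b3 b4 /=; lia.
move=> k10; have : inT h1 + inT h2 + inT h3 + inT h4 <= 4.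
  by case: (inT h1); case: (inT h2); case: (inT h3); case: (inT h4).
by move: (inT h1 + _ + _ + _) q1 q2 q3 q4 k10; clear; lia.
Qed.

Let TB := [set i in B | T222 i].
Let NB := [set i in B | ~~ T222 i].
Definition receives e := [exists i in NB, e \in face i].

(** If [e] does not receive, a 2, 2, 2 triangle lies on its other side too. It has a different third
    vertex because, by [face_inj], distinct faces have distinct boundaries. *)
Lemma other_T222 (x y z : V) e j : j \in TB -> x != y -> x != z -> y != z ->
  face j = [set e in D | ends e \subset [set x; y; z]] ->
  e \in face j -> ends e = [set x; y] -> ~~ receives e ->
  exists w, [/\ w \in X, w \notin [set x; y; z], m x w = 2 & m w y = 2].
Proof.
move=> /setIdP[jB jT] xy xz yz ej eF ee nr.
have [j' [j'B nj eF']] := other_side eF.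
have jT' : T222 j'.
  case: (boolP (T222 j')) => // nT; move/negP: nr; case; apply/exists_inP.
  by exists j' => //; apply/setIdP.
have [S [S3 SX S2 fS]] := T222P jT'.
have eS : ends e \subset S by move: eF'; rewrite fS inE => /andP[].
have xS : x \in S by apply: (subsetP eS); rewrite ee set21.
have yS : y \in S by apply: (subsetP eS); rewrite ee set22.
have [w [wS xw yw eSw]] := third_vertex S3 xS yS xy.
exists w; split; [exact: (subsetP SX)| |exact: S2|by rewrite S2 // eq_sym].
rewrite !inE !negb_or ![w == _]eq_sym xw yw /=.
apply: contraNneq nj => zw; apply/eqP; apply: face_inj => //.
by rewrite fS ej eSw zw.
Qed.

(** Triangles across both edges at [x] have third vertices [w] and [w']: if equal they complete a K4
    with all multiplicities 2, if distinct they give the configuration of [double222]. *)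
Lemma receives_pair (x y z : V) exy exz j : j \in TB ->
  uniq [:: x; y; z] -> {subset [:: x; y; z] <= X} ->
  m x y = 2 -> m y z = 2 -> m x z = 2 ->
  face j = [set e in D | ends e \subset [set x; y; z]] ->
  exy \in face j -> exz \in face j ->
  ends exy = [set x; y] -> ends exz = [set x; z] ->
  ~~ receives exy -> ~~ receives exz -> False.
Proof.
move=> jT U sX mxy myz mxz ej f1 f2 e1 e2 n1 n2.
have [xX yX zX] : [/\ x \in X, y \in X & z \in X].
  by split; apply: sX; rewrite !inE eqxx ?orbT.
have := U; rewrite /= !inE !negb_or andbT => /andP[/andP[xy xz] yz].
have [w [wX wS mxw mwy]] := other_T222 jT xy xz yz ej f1 e1 n1.
have ej' : face j = [set e in D | ends e \subset [set x; z; y]].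
  by rewrite setUAC.
have zy : z != y by rewrite eq_sym.
have [w' [w'X w'S mxw' mwz']] := other_T222 jT xz xy zy ej' f2 e2 n2.
move: wS w'S; rewrite !inE !negb_or -!andbA => /and3P[wx wy wz] /and3P[wx' wz' wy'].
case: (eqVneq w w') => [ww|nww].
  apply: (@k4 x y z w); rewrite ?mxy ?mxz ?mxw ?myz //.
  - by rewrite /= !inE !negb_or xy xz yz ![_ == w]eq_sym wx wy wz.
  - by apply/subsetP => v; rewrite !inE -!orbA => /or4P[]/eqP->.
  - by rewrite msym mwy.
  - by rewrite msym ww mwz'.
apply: (@double222 x y z w w'); rewrite ?mxw ?mwy ?mxw' ?mwz' //.
- rewrite /= !inE !negb_or xy xz yz ![_ == w]eq_sym wx wy wz.
  by rewrite ![_ == w']eq_sym wx' wy' wz' eq_sym nww.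
- by move=> v; rewrite !inE => /orP[/eqP->|/orP[/eqP->|/or3P[]/eqP->]].
Qed.

(** Any two sides of a triangle share a corner, so [receives_pair] at the three corners leaves at
    most one side that does not receive. *)
Lemma receives_ge2 j : j \in TB -> 2 <= \sum_(e in face j) receives e.
Proof.
move=> jT; have := jT; rewrite in_set => /andP[jB /T222P[S [S3 SX S2 fS]]].
have /cards3P[x [y [z [xy xz yz eS]]]] := S3.
have [xX yX zX] : [/\ x \in X, y \in X & z \in X].
  by split; apply: (subsetP SX); rewrite eS !inE eqxx ?orbT.
have [xS yS zS] : [/\ x \in S, y \in S & z \in S].
  by split; rewrite eS !inE eqxx ?orbT.
have mxy := S2 _ _ xS yS xy; have myz := S2 _ _ yS zS yz; have mxz := S2 _ _ xS zS xz.
have ex u v : u \in S -> v \in S -> u != v ->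
    exists2 e, e \in face j & ends e = [set u; v].
  move=> uS vS uv; have [||||e eD ee] := @mD u v; rewrite ?(subsetP SX) ?S2 //.
  exists e => //; rewrite fS inE eD ee; apply/subsetP => w.
  by move=> /set2P[]->.
have [h1 f1 e1] := ex x y xS yS xy; have [h2 f2 e2] := ex y z yS zS yz.
have [h3 f3 e3] := ex x z xS zS xz.
have UH : uniq [:: h1; h2; h3].
  rewrite /= !inE !negb_or andbT; apply/andP; split; [apply/andP; split|].
  - by apply: contra_neq (_ : ends h1 != ends h2) => [->//|];
    rewrite e1 e2 eq_set2 (negbTE xy) (negbTE xz).
  - by apply: contra_neq (_ : ends h1 != ends h3) => [->//|];
    rewrite e1 e3 eq_set2 (negbTE yz) (negbTE xz) andbF.
  - by apply: contra_neq (_ : ends h2 != ends h3) => [->//|];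
    rewrite e2 e3 eq_set2 ![_ == x]eq_sym (negbTE xy) (negbTE yz) (negbTE xz).
apply: leq_trans (_ : \sum_(e in [set h1; h2; h3]) receives e <= _); last first.
  rewrite [X in _ <= X](bigID (mem [set h1; h2; h3])) /=.
  apply: leq_trans (leq_addr _ _); rewrite leq_eqVlt; apply/orP; left; apply/eqP.
  apply: eq_bigl => e; rewrite in_setU in_set2 in_set1; case: eqP => [->|_];
    first by rewrite f1.
  case: eqP => [->|_]; first by rewrite f2.
  by case: eqP => [->|_]; rewrite ?f3 ?andbF.
rewrite sum_face3 //.
have U3 : uniq [:: x; y; z] by rewrite /= !inE !negb_or xy xz yz.
have s3 : {subset [:: x; y; z] <= X} by move=> v; rewrite !inE => /or3P[]/eqP->.
have e1' : ends h1 = [set y; x] by rewrite e1 setUC.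
have e2' : ends h2 = [set z; y] by rewrite e2 setUC.
have e3' : ends h3 = [set z; x] by rewrite e3 setUC.
have b12 : ~~ receives h1 -> ~~ receives h3 -> False.
  by apply: (receives_pair jT U3 s3) => //; rewrite fS eS.
have b13 : ~~ receives h1 -> ~~ receives h2 -> False.
  apply: (@receives_pair y x z h1 h2 j) => //.
  - by rewrite /= !inE !negb_or eq_sym xy xz yz.
  - by move=> v; rewrite !inE => /or3P[]/eqP->.
  - by rewrite msym.
  - by rewrite fS eS (setUC [set x]).
have b23 : ~~ receives h3 -> ~~ receives h2 -> False.
  apply: (@receives_pair z x y h3 h2 j) => //.
  - by rewrite /= !inE !negb_or xy ![z == _]eq_sym xz yz.
  - by move=> v; rewrite !inE => /or3P[]/eqP->.
  - by rewrite msym.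
  - by rewrite msym.
  - by rewrite fS eS -[[set z; x; y]]setUA [in RHS](setUC [set z]).
by move: b12 b13 b23; case: (receives h1); case: (receives h2);
  case: (receives h3) => //= b1 b2 b3; exfalso; auto.
Qed.

Lemma faces_sum (Q : {set J}) (g : H -> nat) :
  \sum_(i in Q) \sum_(e in face i) g e =
  \sum_(e in D) g e * \sum_(i in Q) (e \in face i).
Proof.
under eq_bigr => i _.
  rewrite (_ : \sum_(e in face i) g e = \sum_(e in D) g e * (e \in face i)); last first.
    rewrite [RHS](bigID (mem (face i))) /= [X in _ = _ + X]big1 ?addn0; last first.
      by move=> e /andP[_ /negbTE->]; rewrite muln0.
    apply: eq_big => [e|e ->]; last by rewrite muln1.
    by case: (boolP (e \in face i)) => [/faceD->|]; rewrite ?andbF.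
  over.
by rewrite exchange_big /=; apply: eq_bigr => e _; rewrite big_distrr.
Qed.

(** A receiving edge has a side in [NB] and at most two sides in all, so it lies on at most one face
    of [TB], and that half unit is paid by a face of [NB]. *)
Lemma transfer : 2 * #|TB| <= \sum_(i in NB) \sum_(e in face i) inT e.
Proof.
apply: leq_trans (_ : \sum_(j in TB) \sum_(e in face j) receives e <= _).
  rewrite -sum1_card big_distrr /=; apply: leq_sum => j jT.
  by rewrite muln1 receives_ge2.
rewrite !faces_sum; apply: leq_sum => e eD.
case: (boolP (receives e)) => [/exists_inP[i iN eFi]|_]; last by rewrite mul0n.
have := side_count eD; rewrite (bigID (mem TB)) /= => s2.
have eT : \sum_(i in B | i \in TB) (e \in face i) = \sum_(i in TB) (e \in face i).
  by apply: eq_bigl => k; rewrite !in_set; case: (k \in B).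
have eN : \sum_(i in B | i \notin TB) (e \in face i) = \sum_(i in NB) (e \in face i).
  by apply: eq_bigl => k; rewrite !in_set; case: (k \in B).
rewrite eT eN in s2.
have N1 : 0 < \sum_(i in NB) (e \in face i) by rewrite (bigD1 i) //= eFi.
case: (boolP (inT e)) => [_|nT].
  by move: s2 N1; clear; rewrite !mul1n; lia.
rewrite big1 ?muln0 // => j jT; apply/eqP; rewrite eqb0.
apply: contra nT => eFj; apply/exists_inP.
by move: jT; rewrite in_set => /andP[jB jT]; exists j; rewrite ?jT.
Qed.

Theorem discharge : False.
Proof.
have eB (g : J -> nat) : \sum_(i in B) g i = \sum_(i in TB) g i + \sum_(i in NB) g i.
  rewrite (bigID T222) /=; congr (_ + _); by apply: eq_bigl => i; rewrite !in_set.
pose w e := 11 - 2 * me e.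
have low : 44 * #|B| <= 2 * \sum_(i in B) \sum_(e in face i) w e.
  have eq1 : 2 * \sum_(i in TB) \sum_(e in face i) w e >= 42 * #|TB|.
    rewrite -sum1_card !big_distrr /=; apply: leq_sum => i; rewrite in_set muln1.
    by move=> /andP[iB iT]; apply: chargeT.
  have eq2 : 2 * \sum_(i in NB) \sum_(e in face i) w e >=
      44 * #|NB| + \sum_(i in NB) \sum_(e in face i) inT e.
    rewrite -sum1_card !big_distrr -big_split /=; apply: leq_sum => i.
    by rewrite in_set muln1 => /andP[iB iT]; apply: charge.
  have cB : #|B| = #|TB| + #|NB| by rewrite -!sum1_card eB.
  by have := transfer; rewrite eB cB; move: eq1 eq2; clear; lia.
have up : \sum_(i in B) \sum_(e in face i) w e <= 2 * \sum_(e in D) w e.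
  rewrite faces_sum big_distrr /=; apply: leq_sum => e eD.
  by rewrite mulnC leq_mul2r side_count // orbT.
have tot : \sum_(e in D) w e + 2 * \sum_(e in D) m (a e) (b e) = 11 * #|D|.
  rewrite -sum1_card !big_distrr -big_split /=; apply: eq_bigr => e eD.
  by have /andP[_ b3] := me_bounds eD;
    rewrite subnK // (leq_trans (n := 6)) // (leq_mul2l 2 _ 3).
(* With [S] the total multiplicity, [low], [up] and [tot] give [11 |B| <= 11 |D| - 2 S]. Euler's
   inequality turns this into [2 S + 22 <= 11 |X|], against [total]. *)
have := pm_euler pm; move: low up tot total; clear; lia.
Qed.
End Discharge.

(** * Hosts and grids *)

Section Host.
Variables (W H I : finType) (sH tH : H -> W) (lH rH : H -> I).
Variables (D : {set H}) (B : {set I}).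
Hypothesis pm : plane_map sH tH lH rH D [set: W] B.
Hypothesis primal : splits sH tH D [set: W].

Definition hadj (x y : W) := [exists e in D, [set sH e; tH e] == [set x; y]].

Lemma hadj_sym : symmetric hadj.
Proof. by move=> x y; rewrite /hadj /= [[set y; x]]setUC. Qed.

Lemma hconnU1 (Y : {set W}) u w : hconn hadj Y -> u \in Y -> hadj u w ->
  hconn hadj (w |: Y).
Proof.
move=> cY uY uw K n1 n2.
have [[n3 n4]|] : (Y :&: K != set0 /\ Y :\: K != set0) \/
    (u \in K) != (w \in K).
  case/boolP: (w \in K) => wK; case/boolP: (u \in K) => uK; try by right.
    left; split; first by apply/set0Pn; exists u; rewrite inE uY.
    case/set0Pn: n2 => v; rewrite !inE => /andP[vK /orP[/eqP vx|vY]].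
      by rewrite vx wK in vK.
    by apply/set0Pn; exists v; rewrite !inE vY vK.
  left; split; last by apply/set0Pn; exists u; rewrite !inE uY uK.
  case/set0Pn: n1 => v; rewrite !inE => /andP[/orP[/eqP vx|vY] vK].
    by rewrite vx (negbTE wK) in vK.
  by apply/set0Pn; exists v; rewrite !inE vY vK.
- have [a [b [aK bK ab]]] := cY K n3 n4; exists a, b; split=> //.
    by move: aK; rewrite !inE => /andP[-> ->]; rewrite orbT.
  by move: bK; rewrite !inE => /andP[-> ->]; rewrite orbT.
case/boolP: (u \in K) => uK; case/boolP: (w \in K) => wK // _.
  by exists u, w; rewrite !inE uK uY wK eqxx orbT.
by exists w, u; rewrite !inE uK uY wK eqxx orbT; split=> //; rewrite hadj_sym.
Qed.

(** Unlabelled host vertices join an adjacent class one at a time. Branch sets thus grow to a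
    partition of the whole host, so that the minor arises by contracting the classes and deleting
    edges. *)
Lemma extend_labels (V : finType) (f : W -> option V) :
  (exists w, f w != None) ->
  (forall v, hconn hadj [set w | f w == Some v]) ->
  exists p : W -> V, (forall w v, f w = Some v -> p w = v) /\
    (forall w, exists w', f w' = Some (p w)) /\
    forall v, hconn hadj [set w | p w == v].
Proof.
have [k] := ubnP #|[set w | f w == None]|; elim: k => // k IH in f *.
rewrite ltnS => kN [w0 fw0] cf.
have [e0|[w1]] := set_0Vmem [set w | f w == None].
  have fS w : f w != None.
    by apply/negP => fw; have := in_set0 w; rewrite -e0 inE fw.
  case ew0: (f w0) => [v0|]; last by rewrite ew0 in fw0.
  have pE w : f w = Some (odflt v0 (f w)) by case: (f w) (fS w).
  exists (fun w => odflt v0 (f w)); split; first by move=> w v ->.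
  split; first by move=> w; exists w.
  move=> v; have -> : [set w | odflt v0 (f w) == v] = [set w | f w == Some v].
    by apply/setP => w; rewrite !inE pE.
  exact: cf.
rewrite inE => fw1.
have [||e eD ne] := @primal [set w | f w != None].
- by apply/set0Pn; exists w0; rewrite !inE.
- by apply/set0Pn; exists w1; rewrite !inE fw1.
have [u [w [uw fu fw]]] : exists u w, [/\ hadj u w, f u != None & f w = None].
  move: ne; rewrite !inE; case fs: (f (sH e)) => [v|];
    case ft: (f (tH e)) => [v'|] //= _.
    exists (sH e), (tH e); rewrite fs ft; split=> //.
    by apply/exists_inP; exists e.
  exists (tH e), (sH e); rewrite fs ft; split=> //.
  by apply/exists_inP; exists e; rewrite // setUC.
pose g x := if x == w then f u else f x.
have [|||p [p1 [p2 p3]]] := IH g.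
- apply: leq_trans kN; apply: proper_card; apply/properP; split.
    by apply/subsetP => x; rewrite !inE /g; case: (eqVneq x w) => [->|//];
      rewrite (negbTE fu).
  by exists w; rewrite !inE ?fw // /g eqxx.
- by exists w; rewrite /g eqxx.
- move=> v; case: (eqVneq (f u) (Some v)) => fuv.
    have -> : [set x | g x == Some v] = w |: [set x | f x == Some v].
      apply/setP => x; rewrite !inE /g; case: (eqVneq x w) => //= _.
      by rewrite fuv eqxx.
    by apply: hconnU1 (cf v) _ uw; rewrite inE fuv.
  have -> : [set x | g x == Some v] = [set x | f x == Some v].
    apply/setP => x; rewrite !inE /g; case: (eqVneq x w) => //= ->.
    by rewrite fw (negbTE fuv).
  exact: cf.
exists p; split; last split=> //.
  by move=> x v fx; apply: p1; rewrite /g; case: (eqVneq x w) => // xw;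
    rewrite xw fw in fx.
move=> x; have [x' gx] := p2 x; move: gx; rewrite /g.
by case: (eqVneq x' w) => _ ?; [exists u|exists x'].
Qed.

Section Graph.
Variables (V E : finType).

Lemma counterexample_false (s t : E -> V) (X : {set V}) :
  (forall (s' t' : E -> V) (X' : {set V}), #|X'| < #|X| ->
     Heavy s' t' X' -> model hadj s' t' X' -> Z5_conn s' t' X') ->
  Heavy s t X -> model hadj s t X -> ~ Z5_conn s t X -> False.
Proof.
move=> IH HX MX nX; have n4 := n_ge4 HX nX.
have [Br [B1 B2 B3 B4]] := MX.
pose f w := [pick v in X | w \in Br v].
have fP w v : v \in X -> (f w == Some v) = (w \in Br v).
  move=> vX; rewrite /f; case: pickP => [u /andP[uX wu]|/(_ v)];
    last by rewrite vX /= => ->.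
  apply/eqP/idP => [[<-] //|wv]; congr Some; apply/eqP/negPn/negP => uv.
  by have := disjointFr (B3 u v uX vX uv) wu; rewrite wv.
have fX w v : f w = Some v -> v \in X.
  by rewrite /f; case: pickP => // u /andP[uX _] [<-].
have [x0 x0X] : exists x, x \in X by apply/card_gt0P; apply: leq_trans n4.
have [||p [p1 [p2 p3]]] := @extend_labels V f.
- have /set0Pn[w wB] := B1 x0 x0X; exists w; have := fP w x0 x0X.
  by rewrite wB => /eqP->.
- move=> v; case: (boolP (v \in X)) => vX.
    have -> : [set w | f w == Some v] = Br v by apply/setP => w; rewrite inE fP.
    exact: B2.
  move=> K /set0Pn[w]; rewrite !inE => /andP[/eqP/fX]; by rewrite (negbTE vX).
have pX w : p w \in X by have [w' /fX] := p2 w.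
have pB v w : v \in X -> w \in Br v -> p w = v.
  by move=> vX wB; apply: p1; apply/eqP; rewrite fP.
have [|D' [pm' keep]] := plane_map_quotient (p := p) pm.
  move=> v K n1 n2; have [||x [y []]] := p3 v K.
  - by case/set0Pn: n1 => w; rewrite !inE /= => /andP[wv wK]; apply/set0Pn; exists w;
    rewrite !inE wv.
  - by case/set0Pn: n2 => w; rewrite !inE /= => /andP[wK wv]; apply/set0Pn; exists w;
    rewrite !inE wK.
  rewrite !inE => /andP[/eqP px xK] /andP[yK /eqP py].
  move=> /exists_inP[e eD]; rewrite eq_set2 => /orP[]/andP[/eqP se /eqP te];
    by exists e => //; rewrite se te px py xK (negbTE yK).
have imX : p @: [set: W] = X.
  apply/setP => v; apply/imsetP/idP => [[w _ ->] //|vX].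
  by have /set0Pn[w wB] := B1 v vX; exists w; rewrite ?inE // (pB v).
rewrite imX in pm'; set a := p \o sH in pm'; set b := p \o tH in pm'.
(* Several host edges may join the same two classes. [ch] keeps one for each pair of ends, which
   makes [D0] simple; the multiplicities are supplied by [mult s t]. *)
pose ch (S : {set V}) := [pick e in D' | [set a e; b e] == S].
pose D0 := [set e in D' | [&& a e != b e, 0 < mult s t (a e) (b e)
  & ch [set a e; b e] == Some e]].
have sD : D0 \subset D' by apply/subsetP => e; rewrite inE => /andP[].
have [l' [r' [B' pm0]]] := plane_map_restrict pm' sD.
have mD u v : u \in X -> v \in X -> u != v -> 0 < mult s t u v ->
    exists2 e, e \in D0 & [set a e; b e] = [set u; v].
  move=> uX vX uv muv; have [e je] := mult_gt0 muv.
  have we : edge_in s t X e.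
    by case/orP: je => /andP[/eqP es /eqP et]; rewrite /edge_in es et uX vX.
  have nst : s e != t e.
    by case/orP: je => /andP[/eqP-> /eqP->] //; rewrite eq_sym.
  have [x [y [xB yB /exists_inP[h hD /eqP eh]]]] := B4 e we nst.
  have /andP[sX tX] := we.
  have eab : [set a h; b h] = [set u; v].
    have -> : [set a h; b h] = p @: [set sH h; tH h] by rewrite imsetU !imset_set1.
    rewrite eh imsetU !imset_set1 (pB _ _ sX xB) (pB _ _ tX yB).
    by apply/eqP; rewrite -joinsE.
  have hD' : h \in D'.
    apply: keep => //; have : #|[set a h; b h]| = 2 by rewrite eab cards2 uv.
    by rewrite cards2 /a /b /=; case: eqP.
  case che: (ch [set u; v]) => [g|]; last first.
    move: che; rewrite /ch; case: pickP => // /(_ h).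
    by rewrite hD' eab eqxx.
  move: (che); rewrite /ch; case: pickP => // g' /andP[grid_edges /eqP eg] [gg].
  rewrite {g'}gg in grid_edges eg; exists g => //.
  rewrite inE grid_edges eg che eqxx andbT /=.
  have -> : a g != b g.
    have : #|[set a g; b g]| = 2 by rewrite eg cards2 uv.
    by rewrite cards2; case: eqP.
  move/eqP: eg; rewrite eq_set2 => /orP[]/andP[/eqP-> /eqP->] //=.
  by rewrite mult_sym.
apply: (@discharge V I H X (mult s t) a b l' r' D0 B') => //.
- exact: mult_sym.
- by move=> e; rewrite inE => /and4P[].
- move=> e g; rewrite !inE => /and4P[_ _ _ /eqP c1] /and4P[_ _ _ /eqP c2] eg.
  by move: c1; rewrite /= in eg; rewrite eg c2 => -[].
- by move=> e; rewrite inE => /and4P[].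
- move=> x y; exact: (mult_le3 hadj_sym IH HX MX nX).
- move=> x y z; exact: (no_triangle3 hadj_sym IH HX MX nX).
- move=> x y z u; exact: (no_cycle3333 hadj_sym IH HX MX nX).
- move=> x y z u v; exact: (no_cycle2333 hadj_sym IH HX MX nX).
- move=> x y z w w'; exact: (no_double222 hadj_sym IH HX MX nX).
- move=> x y z u; exact: (no_k4 hadj_sym IH HX MX nX).
(* The partition into single vertices yields [total]; each of its crossing edges is counted at the
   edge of [D0] with the same ends. *)
have := HX V id; rewrite imset_id => /heavyW hv.
apply: leq_trans (hv _) _; first by apply: leq_trans n4.
rewrite leq_add2r leq_mul2l /=.
apply: leq_trans (@cross_id2 V E s t X _ _ [seq (a e, b e) | e <- enum D0] _) _.
  move=> u v uX vX uv mp; have [e eD] := mD u v uX vX uv mp.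
  move/eqP; rewrite eq_set2 => /orP[]/andP[/eqP ae /eqP be].
    by apply/orP; left; apply/mapP; exists e; rewrite ?mem_enum // ae be.
  by apply/orP; right; apply/mapP; exists e; rewrite ?mem_enum // ae be.
by rewrite big_map big_enum.
Qed.

Theorem Z5_conn_of_model (s t : E -> V) (X : {set V}) :
  Heavy s t X -> model hadj s t X -> Z5_conn s t X.
Proof.
have [k] := ubnP #|X|; elim: k => // k IH in s t X *.
rewrite ltnS => kX HX MX; apply: NNPP => nX.
apply: (counterexample_false _ HX MX nX) => s' t' X' lt; apply: IH.
exact: leq_trans kX.
Qed.
End Graph.
End Host.

(** * The square grid as a plane map *)

Section Grid.
Variable M : nat.
Let W := ('I_M.+1 * 'I_M.+1)%type.
Let H := (bool * W)%type.
Let I := option ('I_M * 'I_M).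

(* Coordinates are shifted by one, so that the out-of-range values, including 0,
   all denote the outer face [None]. *)
Definition cell (i j : nat) : I :=
  match i, j with
  | i'.+1, j'.+1 =>
    match (insub i' : option 'I_M), (insub j' : option 'I_M) with
    | Some x, Some y => Some (x, y)
    | _, _ => None
    end
  | _, _ => None
  end.

Definition grid_src (e : H) : W := e.2.
Definition grid_tgt (e : H) : W :=
  if e.1 then (inord e.2.1.+1, e.2.2) else (e.2.1, inord e.2.2.+1).
(** An inner [cell i j] is the unit square whose corner with the largest coordinates is [(i, j)]. *)
Definition grid_left (e : H) : I := cell e.2.1.+1 e.2.2.+1.
Definition grid_right (e : H) : I := if e.1 then cell e.2.1.+1 e.2.2 else cell e.2.1
  e.2.2.+1.
Definition grid_edges : {set H} := [set e : H | if e.1 then e.2.1 < M else e.2.2 < M].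

Lemma cell_0r i : cell i 0 = None. Proof. by case: i. Qed.
Lemma cell_outl i j : M < i -> cell i j = None.
Proof.
case: i => // i; rewrite ltnS => iM; case: j => // j /=.
by rewrite insubF // ltnNge iM.
Qed.
Lemma cell_outr i j : M < j -> cell i j = None.
Proof.
case: j => // j; rewrite ltnS => jM; case: i => // i /=.
by rewrite [insub j]insubF ?ltnNge ?jM //; case: insub.
Qed.
Lemma cellS (x y : 'I_M) : cell x.+1 y.+1 = Some (x, y).
Proof. by rewrite /= !valK. Qed.

Arguments cell : simpl never.

Lemma sum_pred1 (T : finType) (P : pred T) (g : T -> nat) w :
  (forall v, P v -> v = w) -> \sum_(v | P v) g v = P w * g w.
Proof.
move=> Pw; case: (boolP (P w)) => pw.
  rewrite (bigD1 w) //= big1 ?addn0 ?mul1n // => v /andP[/Pw -> ].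
  by rewrite eqxx.
by rewrite big1 // => v pv; move: pw; rewrite -(Pw v pv) pv.
Qed.

Lemma sum_edges (P : pred H) (g : H -> nat) :
  \sum_(e | P e) g e =
  \sum_(w | P (true, w)) g (true, w) + \sum_(w | P (false, w)) g (false, w).
Proof.
pose f b w := if P (b, w) then g (b, w) else 0.
transitivity (\sum_(p : H) f p.1 p.2).
  by rewrite big_mkcond; apply: eq_bigr => -[b w] _.
by rewrite -(pair_bigA _ f) big_bool /= /f -!big_mkcond.
Qed.

(** Each of the four squares around a vertex lies beside two of the four edges there. An edge
    missing at the border would have the outer face on both sides, so including it does not change
    the parity. *)
Lemma grid_even v k : ~~ odd (incid_sum grid_src grid_tgt grid_left grid_right
  grid_edges v k).
Proof.
case: v => x y.
pose g e := incid grid_left grid_right k e.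
have -> : incid_sum grid_src grid_tgt grid_left grid_right grid_edges (x, y) k =
    \sum_(e | (e \in grid_edges) && (grid_src e == (x, y))) g e +
    \sum_(e | (e \in grid_edges) && (grid_tgt e == (x, y))) g e.
  rewrite !big_mkcondr -big_split /=; apply: eq_bigr => e eD.
  by rewrite mulnDl; do 2!case: (_ == _); rewrite ?mul1n ?mul0n.
rewrite !sum_edges.
rewrite (@sum_pred1 _ _ _ (x, y)); last by move=> w /andP[_ /eqP].
rewrite (@sum_pred1 _ _ _ (x, y)); last by move=> w /andP[_ /eqP].
(* For [x = 0] there is no preceding vertex; the witness is then a dummy and its predicate is false,
   see [xe]. *)
rewrite (@sum_pred1 _ _ _ (inord x.-1, y)); last first.
  move=> [i j]; rewrite inE /= => /andP[iM /eqP[<- ->]].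
  by congr pair; apply: val_inj; rewrite /= !inordK //= ?(ltnW iM) ?ltnS.
rewrite (@sum_pred1 _ _ _ (x, inord y.-1)); last first.
  move=> [i j]; rewrite inE /= => /andP[jM /eqP[-> <-]].
  by congr pair; apply: val_inj; rewrite /= !inordK //= ?(ltnW jM) ?ltnS.
rewrite !inE /grid_src /grid_tgt /= !eqxx !andbT.
pose d i j := (cell i j == k : nat).
have xM : x <= M by rewrite -ltnS.
have yM : y <= M by rewrite -ltnS.
have t1 : odd ((x < M) * g (true, (x, y))) = odd (d x.+1 y.+1 + d x.+1 y).
  rewrite /g /incid /grid_left /grid_right /=; case: ltnP => xM';
    first by rewrite mul1n.
  by rewrite mul0n /d !cell_outl // addnn odd_double.
have t2 : odd ((y < M) * g (false, (x, y))) = odd (d x.+1 y.+1 + d x y.+1).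
  rewrite /g /incid /grid_left /grid_right /=; case: ltnP => yM';
    first by rewrite mul1n.
  by rewrite mul0n /d !cell_outr // addnn odd_double.
have xx : (inord x.-1 : 'I_M.+1) = x.-1 :> nat by rewrite inordK // ltnS (leq_trans
  (leq_pred _)).
have xe : ((inord x.-1 : 'I_M.+1) < M) && ((inord (inord x.-1 : 'I_M.+1).+1,
  y) == (x, y)) = (0 < x).
  rewrite xx xpair_eqE eqxx andbT -val_eqE /=.
  case: (posnP x) => [x0|xp].
    rewrite x0 /=; apply/negbTE/negP => /andP[M0].
    by rewrite inordK.
  by rewrite prednK // xM inordK ?eqxx.
have yy : (inord y.-1 : 'I_M.+1) = y.-1 :> nat by rewrite inordK // ltnS (leq_trans
  (leq_pred _)).
have ye : ((inord y.-1 : 'I_M.+1) < M) && ((x,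
  inord (inord y.-1 : 'I_M.+1).+1) == (x, y)) = (0 < y).
  rewrite yy xpair_eqE eqxx -val_eqE /=.
  case: (posnP y) => [y0|yp].
    rewrite y0 /=; apply/negbTE/negP => /andP[M0].
    by rewrite inordK.
  by rewrite prednK // yM inordK ?eqxx.
rewrite xe ye.
have t3 : odd ((0 < x) * g (true, (inord x.-1, y))) = odd (d x y.+1 + d x y).
  rewrite /g /incid /grid_left /grid_right /=; case: (posnP x) => [->|xp].
    by rewrite mul0n /d /= addnn odd_double.
  by rewrite mul1n xx prednK.
have t4 : odd ((0 < y) * g (false, (x, inord y.-1))) = odd (d x.+1 y + d x y).
  rewrite /g /incid /grid_left /grid_right /=; case: (posnP y) => [->|yp].
    by rewrite mul0n /d !cell_0r addnn odd_double.
  by rewrite mul1n yy prednK.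
rewrite !oddD t1 t2 t3 t4 !oddD.
by do 4!case: (odd _).
Qed.

(** Decreasing the first coordinate leads from any square to the outer face. *)
Lemma grid_dual : splits grid_left grid_right grid_edges [set: I].
Proof.
move=> K /set0Pn[p]; rewrite !inE /= => pK /set0Pn[q]; rewrite !inE andbT => qK.
apply: NNPP => no.
have same e : e \in grid_edges -> (grid_left e \in K) = (grid_right e \in K).
  by move=> eD; apply/eqP/negPn/negP => ne; apply: no; exists e.
have all i j : (cell i j \in K) = (None \in K).
  elim: i j => [//|i IH] j; case: j => [//|j].
  case: (leqP M i) => iM; first by rewrite cell_outl.
  case: (leqP M j) => jM; first by rewrite cell_outr.
  have := same (false, (inord i, inord j)); rewrite /grid_left /grid_right inE /=.
  by rewrite !inordK ?(leqW iM) ?(leqW jM) // IH => ->.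
have allo z : (z \in K) = (None \in K).
  by case: z => [[x y]|//]; rewrite -cellS all.
by move: pK qK; rewrite (allo p) (allo q) => ->.
Qed.

Lemma grid_primal : splits grid_src grid_tgt grid_edges [set: W].
Proof.
move=> K /set0Pn[p]; rewrite !inE /= => pK /set0Pn[q]; rewrite !inE andbT => qK.
apply: NNPP => no.
have same e : e \in grid_edges -> (grid_src e \in K) = (grid_tgt e \in K).
  by move=> eD; apply/eqP/negPn/negP => ne; apply: no; exists e.
have row i (y : 'I_M.+1) : i <= M -> ((inord i, y) \in K) = ((ord0, y) \in K).
  elim: i => [|i IH] iM.
    by congr ((_, y) \in K); apply: val_inj; rewrite /= inordK.
  rewrite -IH ?(ltnW iM) //; have := same (true, (inord i, y)).
  by rewrite /grid_src /grid_tgt inE /= inordK ?(leqW iM) // => -> //.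
have col j : j <= M -> ((ord0, inord j) \in K) = ((ord0, ord0) \in K).
  elim: j => [|j IH] jM.
    by congr ((_, _) \in K); apply: val_inj; rewrite /= inordK.
  rewrite -IH ?(ltnW jM) //; have := same (false, (ord0, inord j)).
  by rewrite /grid_src /grid_tgt inE /= inordK ?(leqW jM) // => -> //.
have all z : (z \in K) = ((ord0, ord0) \in K).
  case: z => x y; rewrite -[x]inord_val row; last by rewrite -ltnS.
  by rewrite -[y]inord_val col // -ltnS.
by move: pK qK; rewrite (all p) (all q) => ->.
Qed.

Lemma sum_lt : \sum_(i < M.+1) (i < M) = M.
Proof.
rewrite big_ord_recr /= ltnn addn0 (eq_bigr (fun=> 1)); last by move=> i _;
  rewrite ltn_ord.
by rewrite sum1_card card_ord.
Qed.

Lemma card_grid_edges : #|grid_edges| = 2 * (M * M.+1).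
Proof.
rewrite -sum1_card sum_edges.
have e1 : \sum_w (if (true, w) \in grid_edges then 1 else 0) = M * M.+1.
  rewrite (eq_bigr (fun p : W => (fun (i : 'I_M.+1) (_ : 'I_M.+1) => (i < M : nat))
    p.1 p.2)); last first.
    by move=> [i j] _; rewrite inE /=; case: ltnP.
  rewrite -(pair_bigA _ (fun (i : 'I_M.+1) (_ : 'I_M.+1) => (i < M : nat))) /=.
  under eq_bigr => i _ do rewrite sum_nat_const card_ord.
  by rewrite -big_distrr /= sum_lt mulnC.
have e2 : \sum_w (if (false, w) \in grid_edges then 1 else 0) = M * M.+1.
  rewrite (eq_bigr (fun p : W => (fun (_ : 'I_M.+1) (j : 'I_M.+1) => (j < M : nat))
    p.1 p.2)); last first.
    by move=> [i j] _; rewrite inE /=; case: ltnP.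
  rewrite -(pair_bigA _ (fun (_ : 'I_M.+1) (j : 'I_M.+1) => (j < M : nat))) /=.
  by rewrite sum_nat_const card_ord sum_lt mulnC.
by rewrite [X in X + _]big_mkcond [X in _ + X]big_mkcond /= e1 e2 addnn mul2n.
Qed.

Lemma grid_plane_map : plane_map grid_src grid_tgt grid_left grid_right grid_edges
  [set: W] [set: I].
Proof.
split; [exact: grid_even|exact: grid_dual| | |].
- by move=> e _; rewrite !inE.
- by move=> e _; rewrite !inE.
by rewrite card_grid_edges !cardsT card_option !card_prod !card_ord; nia.
Qed.
End Grid.

(** * Branch sets from connected sets for vertices and edges *)

Section BranchSets.
Variables (W V E : finType) (h : rel W) (s t : E -> V).
Hypothesis hsym : symmetric h.
Variables (YV : V -> {set W}) (YE : E -> {set W}).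
Hypothesis YV_neq0 : forall u, YV u != set0.
Hypothesis YV_conn : forall u, hconn h (YV u).
Hypothesis YE_conn : forall e, hconn h (YE e).
Hypothesis YV_disj : forall u v, u != v -> [disjoint YV u & YV v].
Hypothesis YE_disj : forall e f, e != f -> [disjoint YE e & YE f].
Hypothesis YEV_disj : forall e v, v != s e -> v != t e -> [disjoint YE e & YV v].
Hypothesis YE_s : forall e, YE e :&: YV (s e) != set0.
Hypothesis YE_t : forall e, YE e :&: YV (t e) != set0.

(* The middle part of an edge is given to its source, as far as it does not meet
   the target. *)
Let A u := YV u :|: \bigcup_(e | s e == u) (YE e :\: YV (t e)).
Let root u : W := xchoose (set0Pn _ (YV_neq0 u)).
Let step u : rel W := [rel x y | h x y && (y \in A u)].
(** Removing [YV (t e)] may cut pieces of [YE e] off from the rest of [A u]; the component of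
    [root u] discards them. *)
Definition branch u := [set w | connect (step u) (root u) w].

Lemma root_in u : root u \in YV u.
Proof. exact: (xchooseP (set0Pn _ (YV_neq0 u))). Qed.

Lemma branch_ind u (P : W -> Prop) : P (root u) ->
  (forall x y, x \in branch u -> P x -> h x y -> y \in A u -> P y) ->
  forall w, w \in branch u -> P w.
Proof.
move=> P0 PS w; rewrite inE => /connectP[p]; elim/last_ind: p w => [|p x IH] w /=.
  by move=> _ ->.
rewrite rcons_path last_rcons => /andP[pp /andP[hx xA]] ->.
apply: PS hx xA; last by apply: IH pp _.
by rewrite inE; apply/connectP; exists p.
Qed.

Lemma branch_root u : root u \in branch u.
Proof. by rewrite inE connect0. Qed.

Lemma branch_step u x y : x \in branch u -> h x y -> y \in A u -> y \in branch u.
Proof.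
rewrite in_set => cx hxy yA; rewrite in_set.
by apply: connect_trans cx (connect1 _); apply/andP.
Qed.

Lemma branch_sub u : branch u \subset A u.
Proof.
apply/subsetP => w wB; move: w wB; apply: branch_ind => //.
by rewrite inE root_in.
Qed.

Lemma YV_sub_branch u : YV u \subset branch u.
Proof.
apply/subsetP => w wY; apply/negPn/negP => wB.
have [||x [y []]] := @YV_conn u (branch u).
- by apply/set0Pn; exists (root u); rewrite in_setI root_in branch_root.
- by apply/set0Pn; exists w; rewrite in_setD wB.
move=> /setIP[_ xB] /setDP[yY yB] hxy; move/negP: yB; apply.
by apply: branch_step xB hxy _; rewrite inE yY.
Qed.

Lemma branch_conn u : hconn h (branch u).
Proof.
move=> K /set0Pn[w1 /setIP[w1B w1K]] /set0Pn[w2 /setDP[w2B w2K]].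
apply: NNPP => no.
have same w : w \in branch u -> (w \in K) = (root u \in K).
  move: w; apply: branch_ind => // x y xB <- hxy yA.
  have yB := branch_step xB hxy yA.
  case: (boolP (x \in K)) => xK; case: (boolP (y \in K)) => yK //; case: no.
    by exists x, y; split; [apply/setIP|apply/setDP|].
  by exists y, x; split; [apply/setIP|apply/setDP|rewrite hsym].
by rewrite (same _ w2B) -(same _ w1B) w1K in w2K.
Qed.

Lemma A_disj u v : u != v -> [disjoint A u & A v].
Proof.
have aux x y e : x != y -> s e = x -> [disjoint YE e :\: YV (t e) & YV y].
  move=> xy se; case: (eqVneq y (t e)) => [->|yt].
    by rewrite disjoint_sym disjoints_subset setCD subsetUr.
  apply: disjointWl (YEV_disj _ yt); first exact: subsetDl.
  by rewrite se eq_sym.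
move=> uv; rewrite disjoint_sym disjoints_subset; apply/subsetP => w wv.
rewrite inE; apply/negP => wu; move: wu wv.
rewrite !in_setU => /orP[wu|/bigcupP[e /eqP se we]] /orP[wv|/bigcupP[f /eqP sf wf]].
- by rewrite (disjointFr (YV_disj uv) wu) in wv.
- have vu : v != u by rewrite eq_sym.
  by rewrite (disjointFr (aux _ _ _ vu sf) wf) in wu.
- by rewrite (disjointFr (aux _ _ _ uv se) we) in wv.
move: we wf => /setDP[we _] /setDP[wf _].
have ef : e != f by apply: contraNneq uv => ef; rewrite -se -sf ef.
by rewrite (disjointFr (YE_disj ef) we) in wf.
Qed.

(** The connected set [YE e] meets [branch (s e)] and must leave it. The first vertex outside lies
    in [YV (t e)], since any other vertex of [YE e] belongs to [A (s e)] and would have been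
    reached. *)
Lemma model_branch : model h s t [set: V].
Proof.
exists branch; split.
- by move=> u _; apply/set0Pn; exists (root u); apply: branch_root.
- by move=> u _; apply: branch_conn.
- move=> u v _ _ uv; apply: disjointWl (branch_sub u) _.
  by apply: disjointWr (branch_sub v) _; apply: A_disj.
move=> e _ nst.
have [||x [y []]] := @YE_conn e (branch (s e)).
- have /set0Pn[w /setIP[wE wV]] := YE_s e; apply/set0Pn; exists w.
  by rewrite in_setI wE (subsetP (YV_sub_branch _)).
- have /set0Pn[w /setIP[wE wV]] := YE_t e; apply/set0Pn; exists w.
  rewrite in_setD wE andbT; apply/negP => wB.
  have wA := subsetP (branch_sub _) _ wB.
  have wA' : w \in A (t e) by rewrite inE wV.
  by rewrite (disjointFr (A_disj nst) wA) in wA'.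
move=> /setIP[_ xB] /setDP[yE yB] hxy; exists x, y; split=> //.
case: (boolP (y \in YV (t e))) => [|yt]; first exact: (subsetP (YV_sub_branch _)).
move/negP: yB; case; apply: branch_step xB hxy _.
by rewrite in_setU; apply/orP; right; apply/bigcupP; exists e; rewrite // in_setD yt.
Qed.
End BranchSets.

(** * Discretisation of plane drawings *)

From mathcomp Require Import all_classical all_reals all_analysis.
Import numFieldNormedType.Exports.

Section Topology.
Variable R : realType.
Local Open Scope classical_set_scope.
Local Open Scope ring_scope.

(** Any two points of [A] and [B] are more than [1 / k] apart in the maximum norm, so no closed cell
    of side [1 / k] meets both sets. *)
Definition apart (k : nat) (A B : set (R * R)) := forall a b, A a -> B b ->
  ~ (k%:R * `|a.1 - b.1| <= 1 /\ k%:R * `|a.2 - b.2| <= 1).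

Lemma apartW k k' A B : (k <= k')%N -> apart k A B -> apart k' A B.
Proof.
move=> kk ap a b Aa Bb [h1 h2]; apply: (ap a b Aa Bb); split.
  by apply: le_trans h1; rewrite ler_wpM2r // ler_nat.
by apply: le_trans h2; rewrite ler_wpM2r // ler_nat.
Qed.

(** The set of differences is compact, hence closed, and misses 0; so it misses a ball around 0. *)
Lemma apart_compact A B : compact A -> compact B -> A `&` B = set0 ->
  exists k, apart k A B.
Proof.
move=> cA cB AB.
pose f (p : (R * R) * (R * R)) : R * R := p.1 - p.2.
have cf : compact (f @` (A `*` B)).
  apply: continuous_compact; last exact: compact_setX.
  by apply: continuous_subspaceT => x; exact: sub_continuous.
have clf : closed (f @` (A `*` B)) by apply: compact_closed cf; exact: norm_hausdorff.
have n0 : (~` (f @` (A `*` B))) 0.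
  move=> [[a b] [/= Aa Bb]]; rewrite /f /= => /eqP; rewrite subr_eq0 => /eqP ab.
  have : (A `&` B) a by split=> //; rewrite ab.
  by rewrite AB.
have op : open (~` (f @` (A `*` B))) by rewrite openC.
have /nbhs_ballP[e /= e0 be] : nbhs (0 : R * R) (~` (f @` (A `*` B))).
  exact: open_nbhs_nbhs.
pose k := (Num.truncn e^-1).+1.
have ke : e^-1 < k%:R by apply: truncnS_gt.
have kp : (0 : R) < k%:R by rewrite ltr0n.
exists k => a b Aa Bb [h1 h2]; apply: (be (f (a, b))); last by exists (a, b).
have lt x : k%:R * `|x| <= 1 -> `|x| < e.
  move=> kx; have : e^-1 * `|x| < 1 \/ `|x| = 0.
    have [x0|x0] := eqVneq `|x| 0; first by right.
    left; apply: lt_le_trans kx; rewrite ltr_pM2r // lt_neqAle eq_sym x0.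
    by rewrite normr_ge0.
  by case=> [|->//]; rewrite mulrC ltr_pdivrMr // mul1r.
split; rewrite /ball /= /ball_ /= ?sub0r ?normrN; exact: lt.
Qed.

Lemma fst_continuous : continuous (fst : R * R -> R).
Proof. by move=> x; exact: cvg_fst. Qed.

Lemma snd_continuous : continuous (snd : R * R -> R).
Proof. by move=> x; exact: cvg_snd. Qed.

Lemma compact_bound (A : set (R * R)) : compact A ->
  exists C : nat, forall a, A a -> `|a.1| <= C%:R /\ `|a.2| <= C%:R.
Proof.
move=> cA.
have bd (g : R * R -> R) : continuous g -> exists C : nat, forall a,
  A a -> `|g a| <= C%:R.
  move=> cg; have /compact_bounded[N [_ NP]] : compact (g @` A).
    by apply: continuous_compact cA; apply: continuous_subspaceT.
  exists (Num.truncn N).+1 => a Aa.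
  by apply: (NP (Num.truncn N).+1%:R); [exact: truncnS_gt|exists a].
have [C1 h1] := bd fst fst_continuous.
have [C2 h2] := bd snd snd_continuous.
exists (maxn C1 C2) => a Aa; split.
  by apply: le_trans (h1 a Aa) _; rewrite ler_nat leq_maxl.
by apply: le_trans (h2 a Aa) _; rewrite ler_nat leq_maxr.
Qed.

Lemma finite_bound (T : finType) (P : T -> nat -> Prop) :
  (forall x k k', (k <= k')%N -> P x k -> P x k') ->
  (forall x, exists k, P x k) -> exists k, forall x, P x k.
Proof.
move=> mono ex; have [f fP] := choice ex.
exists (\max_x f x)%N => x; apply: mono (fP x); exact: leq_bigmax.
Qed.

Section Cells.
Variables M k C : nat.
Hypothesis kCM : M = (k * C.*2)%N.
Let W : finType := ('I_M.+1 * 'I_M.+1)%type.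

(** Closed intervals, so that a finite union of cells is closed. Among points with [|u| <= C], the
    last index [M] contains only [u = C]. *)
Definition within_cell (i : nat) (u : R) := i%:R <= k%:R * (u + C%:R) <= i.+1%:R.
Definition in_cell (w : W) (q : R * R) :=
  within_cell w.1 q.1 /\ within_cell w.2 q.2.
Definition cells (A : set (R * R)) : {set W} :=
  [set w | `[< exists2 q, A q & in_cell w q >]]%SET.

Lemma cellsP A w : reflect (exists2 q, A q & in_cell w q) (w \in cells A).
Proof. by rewrite inE; exact: asboolP. Qed.

Lemma within_cell_ex u : `|u| <= C%:R -> exists i : 'I_M.+1, within_cell i u.
Proof.
rewrite ler_norml => /andP[lu uu].
have p0 : 0 <= k%:R * (u + C%:R) by rewrite mulr_ge0 // -lerBlDr sub0r.
have pM : k%:R * (u + C%:R) <= M%:R.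
  rewrite kCM natrM ler_wpM2l // -addnn natrD lerD2r //.
have lt : (Num.truncn (k%:R * (u + C%:R)) < M.+1)%N.
  rewrite truncn_lt_nat //; apply: le_lt_trans pM _.
  by rewrite ltr_nat.
exists (Ordinal lt); rewrite /within_cell /=.
by have /andP[-> /ltW->] := truncn_itv p0.
Qed.

Lemma in_cell_ex (q : R * R) : `|q.1| <= C%:R -> `|q.2| <= C%:R ->
  exists w, in_cell w q.
Proof.
by move=> /within_cell_ex[i hi] /within_cell_ex[j hj]; exists (i, j).
Qed.

Lemma cells_disjoint A B : apart k A B -> [disjoint cells A & cells B]%B.
Proof.
move=> ap; rewrite disjoint_subset; apply/fintype.subsetP => w wA.
apply/negP => /= wB; move: wA wB => /cellsP[a Aa [a1 a2]] /cellsP[b Bb [b1 b2]].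
apply: (ap a b Aa Bb).
have aux i u v : within_cell i u -> within_cell i v -> k%:R * `|u - v| <= 1.
  move=> /andP[h1 h2] /andP[h3 h4].
  have e : k%:R * `|u - v| = `|k%:R * (u + C%:R) - k%:R * (v + C%:R)|.
    by rewrite -mulrBr normrM normr_nat; congr (_ * `|_|); ring.
  rewrite e ler_norml; move: h1 h2 h3 h4; rewrite -natr1.
  by move: (k%:R * (u + _)) (k%:R * (v + _)) => x y *; lra.
by split; [apply: aux a1 b1|apply: aux a2 b2].
Qed.

Lemma in_cell_closed w : closed [set q | in_cell w q].
Proof.
have aux i (g : R * R -> R) : continuous g -> closed [set q | within_cell i (g q)].
  move=> cg; have -> : [set q | within_cell i (g q)] =
      (fun q => k%:R * (g q + C%:R)) @^-1` ([set x | i%:R <= x] `&` [set x | x <=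
        i.+1%:R]).
    by apply/seteqP; split => q /= => [/andP|[] h1 h2]; rewrite /within_cell ?h1.
  apply: preimage_closed; last by apply: closedI; [exact: closed_ge|exact: closed_le].
  move=> q _; apply: cvgM; first exact: cvg_cst.
  by apply: cvgD; [exact: cg|exact: cvg_cst].
by apply: closedI; apply: aux; [exact: fst_continuous|exact: snd_continuous].
Qed.

Lemma grid_step1 (w w' : W) : w.2 = w'.2 -> (w'.1 = w.1.+1 :> nat) ->
  hadj (@grid_src M) (@grid_tgt M) (grid_edges M) w w'.
Proof.
case: w w' => [x y] [x' y'] /= -> ex; apply/exists_inP.
exists (true, (x, y')); first by rewrite inE /= -ltnS -ex.
by rewrite /grid_src /grid_tgt /=; apply/eqP; congr [set _; (_, _)]%SET;
  apply: val_inj; rewrite /= inordK -?ex.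
Qed.

Lemma grid_step2 (w w' : W) : w.1 = w'.1 -> (w'.2 = w.2.+1 :> nat) ->
  hadj (@grid_src M) (@grid_tgt M) (grid_edges M) w w'.
Proof.
case: w w' => [x y] [x' y'] /= -> ey; apply/exists_inP.
exists (false, (x', y)); first by rewrite inE /= -ltnS -ey.
by rewrite /grid_src /grid_tgt /=; apply/eqP; congr [set _; (_, _)]%SET;
  apply: val_inj; rewrite /= inordK -?ey.
Qed.

Lemma within_cell_near i j u : within_cell i u -> within_cell j u ->
  [\/ i = j, j = i.+1 | i = j.+1].
Proof.
move=> /andP[h1 h2] /andP[h3 h4].
have : (i <= j.+1)%N by rewrite -(ler_nat R) (le_trans h1).
have : (j <= i.+1)%N by rewrite -(ler_nat R) (le_trans h3).
move=> a b; have [ij|ji|->] := ltngtP i j; last by constructor 1.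
  by constructor 2; apply/eqP; rewrite eqn_leq a.
by constructor 3; apply/eqP; rewrite eqn_leq b.
Qed.

Lemma in_cell_hadj (w w' : W) q : in_cell w q -> in_cell w' q ->
  w.1 = w'.1 \/ w.2 = w'.2 -> w = w' \/ hadj (@grid_src M) (@grid_tgt M) (grid_edges
    M) w w'.
Proof.
case: w w' => [x y] [x' y'] [/= h1 h2] [/= h3 h4] [exx|eyy].
  rewrite exx in h1 *; case: (within_cell_near h2 h4) => e.
  - by left; congr pair; apply: val_inj.
  - by right; apply: grid_step2.
  - by right; rewrite hadj_sym; apply: grid_step2.
rewrite eyy in h2 *; case: (within_cell_near h1 h3) => e.
- by left; congr pair; apply: val_inj.
- by right; apply: grid_step1.
- by right; rewrite hadj_sym; apply: grid_step1.
Qed.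

(** If no grid edge crossed [K], the cells inside [K] and those outside would give two closed sets
    that cover [A] and do not meet on it, contradicting connectedness. *)
Lemma cells_hconn A : connected A ->
  (forall a, A a -> `|a.1| <= C%:R /\ `|a.2| <= C%:R) ->
  hconn (hadj (@grid_src M) (@grid_tgt M) (grid_edges M)) (cells A).
Proof.
move=> cA bA K /set0Pn[w1 /finset.setIP[w1A w1K]] /set0Pn[w2 /finset.setDP[w2A w2K]].
apply: contrapT => no.
have step w w' : w \in cells A -> w' \in cells A ->
    hadj (@grid_src M) (@grid_tgt M) (grid_edges M) w w' -> w \in K -> w' \in K.
  move=> wA w'A hw wK; apply/negPn/negP => w'K; apply: no.
  by exists w, w'; split=> //; [apply/finset.setIP|apply/finset.setDP].
have same w w' q : A q -> in_cell w q -> in_cell w' q -> w \in K -> w' \in K.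
  move=> Aq h1 h2 wK.
  (* Cells that meet only at a corner are not adjacent in the grid; the step between them passes
     through this third cell, which contains [q] too. *)
  have h3 : in_cell (w'.1, w.2) q by split; [exact: h2.1|exact: h1.2].
  have mem v : in_cell v q -> v \in cells A by move=> hv; apply/cellsP; exists q.
  have wK3 : (w'.1, w.2) \in K.
    have [<- //|hw] := in_cell_hadj h1 h3 (or_intror (erefl _)).
    exact: step (mem _ h1) (mem _ h3) hw wK.
  have [<- //|hw] := in_cell_hadj h3 h2 (or_introl (erefl _)).
  exact: step (mem _ h3) (mem _ h2) hw wK3.
pose U (P : pred W) := \bigcup_(w in [set w | P w]) [set q | in_cell w q].
have clU P : closed (U P).
  by apply: closed_bigcup => [|w _]; [exact: finite_finset|exact: in_cell_closed].
have cell q : A q -> exists w, in_cell w q.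
  by move=> /bA[b1 b2]; apply: in_cell_ex.
have eA : A `&` U (mem K) = A.
  apply: cA.
  - have /cellsP[q Aq h] := w1A; exists q; split=> //.
    by exists w1.
  - exists (~` U [pred w | w \notin K]); first by rewrite openC.
    apply/seteqP; split => q [Aq].
      move=> [w wK h]; split=> // -[w' /= w'K h'].
      by rewrite (same _ _ _ Aq h h' wK) in w'K.
    move=> nU; split=> //; have [w h] := cell q Aq; exists w => //.
    by apply/negPn/negP => wK; apply: nU; exists w.
  - by exists (U (mem K)).
have /cellsP[q Aq h] := w2A.
have [_ [w wK h']] : (A `&` U (mem K)) q by rewrite eA.
by rewrite (same _ _ _ Aq h' h wK) in w2K.
Qed.
End Cells.
End Topology.

(** * From a plane drawing to a model in a grid *)

Section Drawing.
Variables (R : realType) (G : multigraph).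
Variables (point : vertex G -> R * R) (arc : edge G -> R -> R * R).
Variables (su tu : edge G -> vertex G).
Local Open Scope classical_set_scope.
Local Open Scope ring_scope.
Hypothesis drawn : is_plane_drawing point arc.
Hypothesis arc0 : forall e, arc e 0 = point (su e).
Hypothesis arc1 : forall e, arc e 1 = point (tu e).
Hypothesis incident : forall v, exists e, su e = v \/ tu e = v.

Definition third (i : 'I_3) : set R := [set x | x \in `[i%:R / 3, i.+1%:R / 3]].
Definition piece (p : edge G * 'I_3) : set (R * R) := arc p.1 @` third p.2.

(** Arcs with a common end cannot be separated near it, so the outer thirds of an arc go to the
    vertices and only the middle third stands for the edge. *)
Definition owner (p : edge G * 'I_3) : vertex G + edge G :=
  if val p.2 == 0%N then inl (su p.1) else
  if val p.2 == 1%N then inr p.1 else inl (tu p.1).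

(** The pairs of owners whose pieces may touch; all other pairs of pieces are disjoint compact
    sets. *)
Definition compatible (a b : vertex G + edge G) : bool :=
  match a, b with
  | inl u, inl v => u == v
  | inr e, inr f => e == f
  | inl u, inr e | inr e, inl u => (u == su e) || (u == tu e)
  end.

Definition at_end e (x : R) v := x = 0 /\ su e = v \/ x = 1 /\ tu e = v.

Lemma third_sub i : third i `<=` [set x | x \in `[0, 1]].
Proof.
move=> x; rewrite /third /= !in_itv /= => /andP[h1 h2]; apply/andP; split.
  by apply: le_trans h1; rewrite divr_ge0.
apply: le_trans h2 _; rewrite ler_pdivrMr // mul1r.
by rewrite (ler_nat R _ 3); exact: ltn_ord.
Qed.

Lemma arcs_meet e f (x y : R) : x \in `[0, 1] -> y \in `[0, 1] ->
  arc e x = arc f y -> (e = f /\ x = y) \/ exists v, at_end e x v /\ at_end f y v.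
Proof.
case: drawn => pinj arcc _ avoid disj.
have split01 (z : R) : z \in `[0, 1] -> [\/ z = 0, z = 1 | z \in `]0, 1[].
  rewrite !in_itv /= => /andP[z0 z1].
  have [->|nz0] := eqVneq z 0; first by constructor 1.
  have [->|nz1] := eqVneq z 1; first by constructor 2.
  by constructor 3; rewrite !lt_neqAle z0 z1 nz1 eq_sym nz0.
have endp g z : z = 0 \/ z = 1 -> exists v, at_end g z v /\ arc g z = point v.
  case=> ->; first by exists (su g); split; [left|].
  by exists (tu g); split; [right|].
have inner g z g' z' : z \in `]0,
  1[ -> z' = 0 \/ z' = 1 -> arc g z = arc g' z' -> False.
  by move=> zi /(endp g')[v [_ ->]] eq; apply: (avoid g v z zi).
move=> x01 y01 eq.
have xx := split01 x x01; have yy := split01 y y01.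
have [xe|xi] : (x = 0 \/ x = 1) \/ x \in `]0, 1[ by case: xx; auto.
  have [ye|yi] : (y = 0 \/ y = 1) \/ y \in `]0, 1[ by case: yy; auto.
    right; have [v [av pv]] := endp e x xe; have [w [aw pw]] := endp f y ye.
    exists v; split=> //; rewrite (_ : v = w) //.
    by apply: pinj; rewrite -pv -pw.
  by case: (inner f y e x yi xe (esym eq)).
have [ye|yi] : (y = 0 \/ y = 1) \/ y \in `]0, 1[ by case: yy; auto.
  by case: (inner e x f y xi ye eq).
left; have ef : e = f by apply: contrapT => nef; apply: (disj e f x y nef xi yi eq).
split=> //; rewrite -ef in eq; have [_ inj] := arcc e.
exact: inj.
Qed.

Lemma owner_end p x v : third p.2 x -> at_end p.1 x v -> owner p = inl v.
Proof.
case: p => e i; rewrite /third /= in_itv /= => /andP[h1 h2].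
have i3 := ltn_ord i.
case=> -[ex ev]; rewrite {}ex in h1 h2; rewrite /owner /=.
  case: (eqVneq (val i) 0%N) => [_|i0]; first by rewrite ev.
  have : (0 : R) < i%:R / 3 by rewrite divr_gt0 // ltr0n lt0n.
  by rewrite ltNge h1.
have i2 : val i = 2%N.
  apply/eqP; rewrite eqn_leq -ltnS i3 /= -ltnS.
  move: h2; rewrite ler_pdivlMr // mul1r (ler_nat R 3 i.+1).
  by [].
by rewrite i2 /= ev.
Qed.

Lemma pieces_apart p q : ~~ compatible (owner p) (owner q) ->
  piece p `&` piece q = set0.
Proof.
move=> nc; apply/seteqP; split => // z [[x px <-] [y qy eq]].
have [[epq exy]|[v [av aw]]] := arcs_meet (third_sub px) (third_sub qy) (esym eq).
  (* A common parameter on one arc forces equal or consecutive thirds, whose owners are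
     compatible. *)
  move/negP: nc; apply; rewrite -exy in qy; move: px qy; clear -epq.
  case: p q epq => e i [f j] /= <-; rewrite /third /= !in_itv /=.
  move=> /andP[h1 h2] /andP[h3 h4].
  have ij : (i <= j.+1)%N.
    by rewrite -(ler_nat R) -(ler_pM2r (_ : (0 : R) < 3^-1)) ?invr_gt0 // (le_trans h1).
  have ji : (j <= i.+1)%N.
    by rewrite -(ler_nat R) -(ler_pM2r (_ : (0 : R) < 3^-1)) ?invr_gt0 // (le_trans h3).
  move: ij ji; rewrite /owner /=.
  case: i h1 h2 => [[|[|[|//]]] ?] ? ?; case: j h3 h4 => [[|[|[|//]]] ?] ? ? //= _ _;
    by rewrite ?eqxx ?orbT.
move/negP: nc; apply; rewrite (owner_end px av) (owner_end qy aw).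
exact: eqxx.
Qed.

Lemma third_segment i : third i = [set` `[i%:R / 3, i.+1%:R / 3]].
Proof. by []. Qed.

Lemma piece_continuous p : {within third p.2, continuous (arc p.1)}.
Proof.
case: drawn => _ arcc _ _ _; have [cont _] := arcc p.1.
by apply: continuous_subspaceW cont; apply: third_sub.
Qed.

Lemma piece_compact p : compact (piece p).
Proof.
apply: continuous_compact; first exact: piece_continuous.
by rewrite third_segment; apply: segment_compact.
Qed.

Lemma piece_connected p : connected (piece p).
Proof.
apply: connected_continuous_connected; last exact: piece_continuous.
by rewrite third_segment; apply: segment_connected.
Qed.

Let i0 : 'I_3 := ord0.
Let i1 : 'I_3 := @Ordinal 3 1 isT.
Let i2 : 'I_3 := ord_max.

Lemma third_0 : third i0 0.
Proof. by rewrite /third /= in_itv /= mul0r lexx divr_ge0. Qed.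

Lemma third_1 : third i2 1.
Proof. by rewrite /third /= in_itv /=; apply/andP; split; lra. Qed.

Lemma drawing_model : exists M,
  model (hadj (@grid_src M) (@grid_tgt M) (grid_edges M)) su tu [set: vertex G]%SET.
Proof.
pose T : finType := (edge G * 'I_3)%type.
have [C bC] : exists C, forall p : T, forall a, piece p a ->
    `|a.1| <= C%:R /\ `|a.2| <= C%:R.
  apply: (finite_bound (P := fun (p : T) C => forall a, piece p a ->
    `|a.1| <= C%:R /\ `|a.2| <= C%:R)).
    move=> p k k' kk H a /H[h1 h2].
    by split; [apply: le_trans h1 _|apply: le_trans h2 _]; rewrite ler_nat.
  by move=> p; apply: compact_bound; apply: piece_compact.
(* There are finitely many pieces, so one scale separates all incompatible pairs. *)
have [k ap] : exists k, forall pq : T * T, ~~ compatible (owner pq.1) (owner pq.2) ->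
    apart k (piece pq.1) (piece pq.2).
  apply: (finite_bound (P := fun (pq : T * T) k =>
    ~~ compatible (owner pq.1) (owner pq.2) -> apart k (piece pq.1) (piece pq.2))).
    by move=> pq k k' kk H /H; apply: apartW.
  move=> [p q] /=; case: (boolP (compatible (owner p) (owner q))) => [_|nc].
    by exists 0%N.
  have [k hk] := apart_compact (piece_compact (p := p)) (piece_compact (p := q))
    (pieces_apart nc).
  by exists k.
pose M := (k.+1 * C.*2)%N; exists M.
pose Y p := cells M k.+1 C (piece p).
have Ydisj p q : ~~ compatible (owner p) (owner q) -> [disjoint Y p & Y q]%B.
  by move=> nc; apply: cells_disjoint => //; apply: apartW (ap (p, q) nc).
have Yconn p : hconn (hadj (@grid_src M) (@grid_tgt M) (grid_edges M)) (Y p).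
  by apply: cells_hconn => //; [exact: piece_connected|exact: bC].
have meet p q z : piece p z -> piece q z -> exists w, w \in Y p /\ w \in Y q.
  move=> pz qz; have [b1 b2] := bC p z pz.
  have [w hw] := @in_cell_ex R M k.+1 C (erefl _) z b1 b2.
  by exists w; split; apply/cellsP; exists z.
pose YV v := (\bigcup_(p | owner p == inl v) Y p)%SET.
have piece_at v p : owner p = inl v -> piece p (point v).
  case: p => e i; rewrite /owner /=; case: (eqVneq (val i) 0%N) => [iz [<-]|iz].
    exists 0; last exact: arc0.
    by have -> /= : i = i0; [apply: val_inj|exact: third_0].
  case: (eqVneq (val i) 1%N) => // iz1 [<-].
  exists 1; last exact: arc1.
  have -> /= : i = i2; last exact: third_1.
  by apply: val_inj; case: i iz iz1 => [[|[|[|]]]].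
have owner_ex v : exists p, owner p = inl v.
  have [e [ev|ev]] := incident v; first by exists (e, i0); rewrite /owner /= ev.
  by exists (e, i2); rewrite /owner /= ev.
apply: (@model_branch _ _ _ _ _ _ (hadj_sym _ _ _) YV (fun e => Y (e, i1))).
- move=> v; have [p pv] := owner_ex v.
  have [w [wp _]] := meet p p _ (piece_at v p pv) (piece_at v p pv).
  by apply/set0Pn; exists w; apply/finset.bigcupP; exists p => //; apply/eqP.
- move=> v; have [p0 p0v] := owner_ex v; have [b1 b2] := bC p0 _ (piece_at v p0 p0v).
  have [r hr] := @in_cell_ex R M k.+1 C (erefl _) _ b1 b2.
  (* All pieces owned by [v] contain [point v], so their cell sets share the cell [r]; this makes
     the union [YV v] connected. *)
  have rY p : owner p = inl v -> r \in Y p.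
    by move=> /piece_at pv; apply/cellsP; exists (point v).
  move=> K /set0Pn[w1 /finset.setIP[w1B w1K]] /set0Pn[w2 /finset.setDP[w2B w2K]].
  have inYV p w : owner p = inl v -> w \in Y p -> w \in YV v.
    by move=> pv wp; apply/finset.bigcupP; exists p => //; apply/eqP.
  have lift p (a b : 'I_M.+1 * 'I_M.+1) : owner p = inl v -> a \in Y p -> b \in Y p
    -> a \in K -> b \notin K ->
      exists a b : 'I_M.+1 * 'I_M.+1, [/\ a \in (YV v :&: K)%SET,
        b \in (YV v :\: K)%SET &
        hadj (@grid_src M) (@grid_tgt M) (grid_edges M) a b].
    move=> pv aY bY aK bK.
    have [||x [y [/finset.setIP[xY xK] /finset.setDP[yY yK] hxy]]] := Yconn p K.
    + by apply/set0Pn; exists a; apply/finset.setIP.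
    + by apply/set0Pn; exists b; apply/finset.setDP.
    exists x, y; split=> //; first by apply/finset.setIP; split=> //; apply: inYV xY.
    by apply/finset.setDP; split=> //; apply: inYV yY.
  case: (boolP (r \in K)) => rK.
    move/finset.bigcupP: w2B => [p /eqP pv wp].
    exact: lift (rY p pv) wp rK w2K.
  move/finset.bigcupP: w1B => [p /eqP pv wp].
  exact: lift wp (rY p pv) w1K rK.
- by move=> e; apply: Yconn.
- move=> u v uv; apply: bigcup_disjoint => q /eqP qv.
  rewrite disjoint_sym; apply: bigcup_disjoint => p /eqP pu.
  by apply: Ydisj; rewrite qv pu /= eq_sym.
- by move=> e f ef; apply: Ydisj.
- move=> e v vs vt; apply: bigcup_disjoint => q /eqP qv.
  by apply: Ydisj; rewrite qv /= negb_or vs vt.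
- move=> e; have [||w [w1 w2]] := meet (e, i1) (e, i0) (arc e (1 / 3)).
  + by exists (1 / 3) => //; rewrite /third /= in_itv /=; apply/andP; split; lra.
  + by exists (1 / 3) => //; rewrite /third /= in_itv /=; apply/andP; split; lra.
  apply/set0Pn; exists w; apply/finset.setIP; split=> //.
  by apply/finset.bigcupP; exists (e, i0).
move=> e; have [||w [w1 w2]] := meet (e, i1) (e, i2) (arc e (2 / 3)).
+ by exists (2 / 3) => //; rewrite /third /= in_itv /=; apply/andP; split; lra.
+ by exists (2 / 3) => //; rewrite /third /= in_itv /=; apply/andP; split; lra.
apply/set0Pn; exists w; apply/finset.setIP; split=> //.
by apply/finset.bigcupP; exists (e, i2).
Qed.
End Drawing.

(** * Edge connectivity *)

Section Conclusion.
Variable G : multigraph.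
Variables su tu : edge G -> vertex G.
Hypothesis su_tu : forall e, ends e = [set su e; tu e]%SET.
Hypothesis conn : edge_connected 11 G.
Local Open Scope nat_scope.

(** Once the edges leaving [K] are deleted, no path starting at [v] can get out of [K]. *)
Lemma edge_cut (K : {set vertex G}) v w : v \in K -> w \notin K ->
  11 <= #|[set e | (su e \in K) != (tu e \in K)]%SET|.
Proof.
move=> vK wK; rewrite leqNgt; apply/negP => /conn/(_ v w)/connectP[p].
elim: p v vK => [|u p IH] v vK /=; first by move=> _ wv; rewrite wv vK in wK.
move=> /andP[/existsP[e /andP[eF ee]] pp]; apply: IH pp => //.
move: eF; rewrite finset.in_set negbK; rewrite su_tu eq_set2 in ee.
by case/orP: ee => /andP[/eqP-> /eqP->]; rewrite vK => /eqP; [move=> <-|move=> ->].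
Qed.

(** An isolated vertex would own no piece of any arc and get an empty branch set. *)
Lemma edge_connected_incident v : 2 <= #|vertex G| ->
  exists e, su e = v \/ tu e = v.
Proof.
move=> n2; have [w wv] : exists w, w \notin [set v]%SET.
  have /card_gt0P[w wP] : 0 < #|~: [set v]%SET| by rewrite cardsCs finset.setCK
    cards1 subn_gt0.
  by exists w; move: wP; rewrite finset.in_setC.
have /card_gt0P[e] : 0 < #|[set e | (su e \in [set v]) != (tu e \in [set v])]%SET|.
  by apply: leq_trans (edge_cut (set11 v) wv).
rewrite !inE => ne; exists e.
by move: ne; case: (eqVneq (su e) v) => [|_]; [left|case: (eqVneq (tu e) v); [right|]].
Qed.

(** At least 11 edges leave each of the [k] parts and each crossing edge leaves two parts, so
    [2 * c >= 11 * k], which exceeds all three bounds. *)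
Lemma edge_connected_Heavy : Heavy su tu [set: vertex G]%SET.
Proof.
move=> T pi; set P := (pi @: _)%SET; set c := cross _ _ _ _.
suff : 2 <= #|P| -> 11 * #|P| <= 2 * c by move=> H; rewrite /heavy; lia.
move=> P2; pose F x := [set e | (pi (su e) == x) != (pi (tu e) == x)]%SET.
have F11 x : x \in P -> 11 <= #|F x|.
  move=> xP; have /imsetP[v _ xv] := xP.
  have /card_gt0P[y] : 0 < #|(P :\ x)%SET|.
    by move: P2; rewrite (cardsD1 x) xP.
  rewrite finset.in_setD1 => /andP[yx /imsetP[w _ yw]].
  have -> : F x = [set e | (su e \in [set u | pi u == x]) != (tu e \in [set u | pi u
    == x])]%SET.
    by apply/setP => e; rewrite !inE.
  apply: (@edge_cut _ v w); rewrite inE ?xv ?eqxx //.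
  by rewrite -xv -yw.
apply: (@leq_trans (\sum_(x in P) #|F x|)).
  by rewrite mulnC -sum_nat_const; apply: leq_sum.
rewrite (eq_bigr (fun x => \sum_e ((pi (su e) == x) != (pi (tu e) == x) : nat)));
  last first.
  move=> x _; rewrite -sum1_card big_mkcond; apply: eq_bigr => e _.
  by rewrite inE; case: ifP.
rewrite exchange_big /= /c crossE big_distrr /=; apply: leq_sum => e _.
rewrite /edge_in !inE /=.
case: (eqVneq (pi (su e)) (pi (tu e))) => [->|npi].
  by rewrite big1 // => x _; rewrite eqxx.
apply: (@leq_trans (\sum_(x in P) ((pi (su e) == x) + (pi (tu e) == x)))).
  by apply: leq_sum => x _; case: (_ == x); case: (_ == x).
rewrite big_split /=.
have aux z : \sum_(x in P) (z == x : nat) <= 1.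
  case: (boolP (z \in P)) => zP.
    by rewrite (bigD1 z) //= eqxx big1 // => x /andP[_]; rewrite eq_sym => /negbTE->.
  by rewrite big1 // => x xP; case: eqP => // zx; rewrite zx xP in zP.
exact: leq_add (aux _) (aux _).
Qed.

Lemma Z5_conn_strongly : Z5_conn su tu [set: vertex G]%SET -> strongly_Z5_connected G.
Proof.
move=> szG b; rewrite /Z5_boundary => b0.
have [|o oP] := szG b.
  by rewrite -[RHS]b0; apply: eq_bigl => v; rewrite inE.
pose tl e := if o e then su e else tu e; pose hd e := if o e then tu e else su e.
have eo e : ends e = [set tl e; hd e]%SET.
  by rewrite su_tu /tl /hd; case: (o e); rewrite // finset.setUC.
exists (Orientation eo) => v; rewrite -(oP v) ?inE // /net.
have cnt (f : edge G -> vertex G) :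
    (#|[set e | f e == v]%SET|%:R = \sum_e (f e == v)%:R :> 'Z_5)%R.
  rewrite -sum1_card natr_sum big_mkcond; apply: eq_bigr => e _.
  by rewrite inE; case: ifP.
rewrite /outdeg /indeg /= !cnt -sumrB; apply: eq_big => e;
  first by rewrite /edge_in !inE.
by rewrite /tl /hd /inc /sg; case: (o e); rewrite ?mul1r // mulN1r opprB.
Qed.
End Conclusion.

Theorem theorem2p3 (R : realType) (G : multigraph) (planarG : planar R G)
  (connG : edge_connected 11 G) : strongly_Z5_connected G.
Proof.
have [point [arc drawn]] := planarG.
have arc_ends e : exists p : vertex G * vertex G,
    [/\ ends e = [set p.1; p.2]%SET, arc e 0%R = point p.1
      & arc e 1%R = point p.2].
  by case: drawn => _ _ /(_ e)[u [v uv]] _ _; exists (u, v).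
have [f fP] := choice arc_ends.
have su_tu e : ends e = [set (f e).1; (f e).2]%SET by have [] := fP e.
apply: (Z5_conn_strongly su_tu).
(* A single vertex carries no edges and hence has no piece in the drawing, so this case is settled
   separately. *)
case: (leqP #|vertex G| 1) => [n1|n2]; first by apply: Z5_conn_card_le1; rewrite cardsT.
have [M model] : exists M, model (hadj (@grid_src M) (@grid_tgt M) (grid_edges M))
    (fun e => (f e).1) (fun e => (f e).2) [set: vertex G]%SET.
  apply: (drawing_model drawn) => [e|e|v]; [by have [] := fP e|by have [] := fP e|].
  exact: (edge_connected_incident su_tu connG v n2).
apply: (Z5_conn_of_model (@grid_plane_map M) (@grid_primal M) _ model).
exact: edge_connected_Heavy.
Qed.
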